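(* Let $d=1$ and $n\in\mathbb{N}$, let $V(x)=\frac14x^4-\frac12x^2$, and let $\mu_\varepsilon(\mathrm{d}x)=Z_\varepsilon^{-1}e^{-V(x)/\varepsilon}\,\mathrm{d}x$ (with $Z_\varepsilon$ the normalizing constant) be the invariant measure of $\mathrm{d}X_\varepsilon=-V'(X_\varepsilon)\,\mathrm{d}t+\sqrt{2\varepsilon}\,\mathrm{d}W_t$. Let the initial data $(\xi_\varepsilon)_{\varepsilon\in(0,1)}$ satisfy Assumptions A1 and A2, and let $b_m(F):=\lim_{t\to\infty}a_m(t,F)$, $0\le m\le n$, be the long-time limits of the weak expansion coefficients (see context). Then for every $F\in C^{n+1}(\mathbb{R})$ such that, for some $q,C>0$, $\max_{0\le i\le n+1}|F^{(i)}(x)|\le C(1+|x|^q)$ for all $x\in\mathbb{R}$: (i) There exist $\varepsilon_0\in(0,1]$ and $(B_m(F))_{0\le m\le n}$ such that for every $\varepsilon\in(0,\varepsilon_0)$, $$\int_{\mathbb{R}}F(x)\,\mu_\varepsilon(\mathrm{d}x)=\sum_{m=0}^n\varepsilon^{m/2}B_m(F)+R_n(F,\varepsilon),\qquad |R_n(F,\varepsilon)|\le C(n,F)\,\varepsilon^{(n+1)/2},$$ for some constant $C(n,F)>0$ independent of $\varepsilon$. (ii) If $\mathbb{P}(\xi_0>0)=\mathbb{P}(\xi_0<0)=\frac12$, then $B_m(F)=b_m(F)$ for every $m\in\{0,\dots,n\}$.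
   Context: $\mathbb{N}=\{0,1,2,\dots\}$, $\mathbb{N}_+=\{1,2,\dots\}$. $(W_t)_{t\ge0}$ is a standard one-dimensional Brownian motion and the initial data are independent of $W$: the real random variables $(\xi_\varepsilon)_{\varepsilon\in(0,1)}$ together with $\xi_0,\dots,\xi_n$ below are jointly independent of $W$. For $m\in\mathbb{N}_+$ and $1\le i\le m$, $\mathcal{D}_i^m:=\{(j_1,\dots,j_i)\in(\mathbb{N}_+)^i: j_1+\dots+j_i=m\}$; $\mathcal{D}_i^m=\varnothing$ if $i>m$ or $i\le0$ or $m\le0$; sums over the empty set are $0$. Assumption A1: there exist random variables $\xi_0,\dots,\xi_n$ such that for every $p\ge1$ and $0\le k\le n$, $\mathbb{E}|\xi_k|^{2p}<\infty$ and $\mathbb{E}\bigl|\xi_\varepsilon-\sum_{j=0}^k\varepsilon^{j/2}\xi_j\bigr|^{2p}\le C(k,p)\,\varepsilon^{(k+1)p}$ for all $\varepsilon\in(0,1)$, with $C(k,p)$ independent of $\varepsilon$. Assumption A2: there exist constants $r_{max}>r_{min}>0$ such that $r_{min}<|\xi_0|<r_{max}$ almost surely. Expansion coefficients ($d=1$): $\mathrm{d}\bar X_0=(\bar X_0-\bar X_0^3)\,\mathrm{d}t$, $\bar X_0(0)=\xi_0$; $\mathrm{d}\bar X_1=(1-3\bar X_0^2)\bar X_1\,\mathrm{d}t+\sqrt2\,\mathrm{d}W_t$, $\bar X_1(0)=\xi_1$; and for $m\ge2$, $\mathrm{d}\bar X_m=(1-3\bar X_0^2)\bar X_m\,\mathrm{d}t-\sum_{(i,j)\in\mathcal{D}_2^m}3\bar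 X_0\bar X_i\bar X_j\,\mathrm{d}t-\sum_{(i,j,k)\in\mathcal{D}_3^m}\bar X_i\bar X_j\bar X_k\,\mathrm{d}t$, $\bar X_m(0)=\xi_m$. Weak expansion coefficients: $a_0(t,F):=\mathbb{E}[F(\bar X_0(t))]$ and, for $1\le m\le n$, $a_m(t,F):=\mathbb{E}\bigl[\sum_{i=1}^m\frac1{i!}\sum_{(j_1,\dots,j_i)\in\mathcal{D}_i^m}F^{(i)}(\bar X_0(t))\prod_{k=1}^i\bar X_{j_k}(t)\bigr]$. Under A1 and A2 the limits $b_m(F)=\lim_{t\to\infty}a_m(t,F)$ exist and are given by $b_0(F)=F(1)\mathbb{P}(\xi_0>0)+F(-1)\mathbb{P}(\xi_0<0)$ and, for $1\le m\le n$, $b_m(F)=\mathbb{P}(\xi_0>0)\sum_{i=1}^m\frac{c_{m,i}}{i!}F^{(i)}(1)+\mathbb{P}(\xi_0<0)\sum_{i=1}^m\frac{\bar c_{m,i}}{i!}F^{(i)}(-1)$, where $c_{m,i},\bar c_{m,i}$ ($1\le i\le m\le n$) are determined by $$c_{m,i}=\frac{i-1}{2}c_{m-2,i-2}-\frac32c_{m,i+1}-\frac12c_{m,i+2},\qquad \bar c_{m,i}=\frac{i-1}{2}\bar c_{m-2,i-2}+\frac32\bar c_{m,i+1}-\frac12\bar c_{m,i+2},$$ with $c_{1,1}=\bar c_{1,1}=0$, $c_{2,2}=\bar c_{2,2}=\frac12$, $c_{0,0}=\bar c_{0,0}=1$, and $c_{k,j}=\bar c_{k,j}=0$ whenever $(k,j)\notin\{(0,0)\}\cup\{(k,j):k\ge1,1\le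 j\le k\}$. *)

(* Defs.v *)
From HB Require Import structures.
From mathcomp Require Import all_boot all_order all_algebra.
From mathcomp Require Import all_classical all_reals all_analysis.
From mathcomp Require Import measurable_realfun.

Set Implicit Arguments.
Unset Strict Implicit.
Unset Printing Implicit Defensive.
Import Order.TTheory GRing.Theory Num.Theory.
Import numFieldNormedType.Exports.
Local Open Scope classical_set_scope.
Local Open Scope ring_scope.

Section independence.
Context d (T : measurableType d) (R : realType) (P : probability T R).
Implicit Types (S : set (T -> R)) (G H : set (set T)).

Definition sigma_of S : set (set T) :=
  <<s \bigcup_(X in S) preimage_set_system setT X measurable >>.

Definition independent_sigma G H :=
  forall A B, G A -> H B -> P (A `&` B) = (P A * P B)%E.

End independence.

Section brownian_motion.
Context d (T : measurableType d) (R : realType) (P : probability T R).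
Implicit Types (W : R -> {RV P >-> R}).

(* Only the times t >= 0 matter; [W t] is unconstrained for t < 0.  The second
   argument of [normal_prob] is the standard deviation. *)
Definition brownian_motion W :=
  [/\ {ae P, forall w, W 0 w = 0},
      {ae P, forall w, {within `[0, +oo[, continuous (fun t => W t w)}},
      forall s t, 0 <= s < t -> forall A, measurable A ->
        P ((W t \- W s) @^-1` A) = normal_prob 0 (Num.sqrt (t - s)) A &
      forall s t, 0 <= s < t ->
        independent_sigma P (sigma_of [set (W t \- W s : T -> R)])
          (sigma_of [set (W u : T -> R) | u in `[0, s]])].

(* The initial data are independent of W as a whole; nothing is assumed on the
   dependence among them. *)
Definition data_independent (n : nat) W (xieps : R -> {RV P >-> R})
    (xi : nat -> {RV P >-> R}) :=
  independent_sigma P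
    (sigma_of ([set (xieps e : T -> R) | e in `]0, 1[] `|`
               [set (xi k : T -> R) | k in [set k | (k <= n)%N]]))
    (sigma_of [set (W u : T -> R) | u in `[0, +oo[]).

End brownian_motion.

Section initial_data.
Context d (T : measurableType d) (R : realType) (P : probability T R).

Definition assumption_A1 (n : nat) (xieps : R -> {RV P >-> R})
    (xi : nat -> {RV P >-> R}) :=
  forall (p : R) (k : nat), 1 <= p -> (k <= n)%N ->
    ('E_P[fun w => (`|xi k w| `^ (2 * p))%R] < +oo)%E /\
    exists C : R, forall e : R, 0 < e < 1 ->
      ('E_P[fun w =>
          (`|xieps e w - \sum_(j < k.+1) e `^ (j%:R / 2) * xi j w|
             `^ (2 * p))%R]
        <= (C * e `^ (k.+1%:R * p))%:E)%E.

Definition assumption_A2 (xi0 : {RV P >-> R}) :=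
  exists rmin rmax : R, [/\ 0 < rmin, rmin < rmax &
    {ae P, forall w, rmin < `|xi0 w| < rmax}].

End initial_data.

(* D_i^m: compositions of m into i parts.  Every part is at most m, so ranging
   over 'I_m.+1 loses nothing; D_0^0 is empty by convention. *)
Definition compositions (i m : nat) : {set {ffun 'I_i -> 'I_m.+1}} :=
  [set j : {ffun 'I_i -> 'I_m.+1} |
    [&& (0 < i)%N, [forall k, (0 < j k)%N] & (\sum_k j k == m)%N]]%SET.

Section expansion.
Context d (T : measurableType d) (R : realType) (P : probability T R).
Implicit Types (X : nat -> R -> {RV P >-> R}) (F : R -> R).

(* [x k] is the value of the k-th coefficient at the current time. *)
Definition expansion_drift (m : nat) (x : nat -> R) : R :=
  if m == 0%N then x 0%N - x 0%N ^+ 3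
  else (1 - 3 * x 0%N ^+ 2) * x m
       - \sum_(j in compositions 2 m) 3 * x 0%N * \prod_k x (j k)
       - \sum_(j in compositions 3 m) \prod_k x (j k).

(* The noise is additive and enters only the equation of order 1, so the SDEs
   are pathwise integral equations.  For m = 1 both sums in the drift are
   empty. *)
Definition expansion_solution (n : nat) (W : R -> {RV P >-> R})
    (xi : nat -> {RV P >-> R}) X :=
  forall m, (m <= n)%N -> {ae P, forall w,
    {within `[0, +oo[, continuous (fun t => X m t w)} /\
    forall t, 0 <= t ->
      X m t w = xi m w
        + \int[lebesgue_measure]_(s in `[0, t])
            expansion_drift m (fun k => X k s w)
        + (if m == 1%N then Num.sqrt 2 * W t w else 0)}.

Definition weak_coef X F (m : nat) (t : R) : \bar R :=
  if m == 0%N then 'E_P[fun w => F (X 0%N t w)]%E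
  else 'E_P[fun w => (\sum_(1 <= i < m.+1) (i`!%:R)^-1 *
         \sum_(j in compositions i m)
           F^`(i)%classic (X 0%N t w) * \prod_k X (j k) t w)%R]%E.

End expansion.

Section test_functions.
Context (R : realType).
Implicit Types (F : R -> R).

Definition C_k (k : nat) F :=
  (forall i, (i < k)%N -> forall x, derivable F^`(i)%classic x 1) /\
  continuous F^`(k)%classic.

Definition poly_growth (k : nat) F :=
  exists q C : R, [/\ 0 < q, 0 < C & forall i, (i <= k)%N ->
    forall x, `|F^`(i)%classic x| <= C * (1 + `|x| `^ q)].

End test_functions.

Section gibbs.
Context (R : realType).
Implicit Types (e x : R).
Local Notation mu := (@lebesgue_measure R).

Definition double_well x : R := x ^+ 4 / 4 - x ^+ 2 / 2.

Definition partition_function e : R :=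
  \int[mu]_x expR (- double_well x / e).

Definition gibbs_pdf e x : R :=
  (partition_function e)^-1 * expR (- double_well x / e).

Definition gibbs e (A : set R) : \bar R :=
  (\int[mu]_(x in A) (gibbs_pdf e x)%:E)%E.

Lemma gibbs_pdf_ge0 e x : 0 <= gibbs_pdf e x.
Proof.
rewrite mulr_ge0 ?expR_ge0// invr_ge0 fine_ge0//.
by apply: integral_ge0 => y _; rewrite lee_fin expR_ge0.
Qed.

Lemma measurable_gibbs_pdf e : measurable_fun setT (gibbs_pdf e).
Proof.
apply: measurable_funM => //; apply: measurableT_comp => //.
apply: measurable_funM => //; apply: measurableT_comp => //.
by apply: measurable_funB; apply: measurable_funM => //;
  apply: measurable_funX.
Qed.

Let gibbs0 e : gibbs e set0 = 0%E.
Proof. by rewrite /gibbs integral_set0. Qed.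

Let gibbs_ge0 e A : (0 <= gibbs e A)%E.
Proof. by apply: integral_ge0 => x _; rewrite lee_fin gibbs_pdf_ge0. Qed.

Let gibbs_sigma_additive e : semi_sigma_additive (gibbs e).
Proof.
move=> /= A mA tA mUA; rewrite /gibbs ge0_integral_bigcup//=.
- by apply: is_cvg_ereal_nneg_natsum_cond => k _ _; exact: gibbs_ge0.
- apply/measurable_EFinP; apply: measurable_funTS.
  exact: measurable_gibbs_pdf.
- by move=> x _; rewrite lee_fin gibbs_pdf_ge0.
Qed.

HB.instance Definition _ e := isMeasure.Build _ _ _
  (gibbs e) (gibbs0 e) (gibbs_ge0 e) (@gibbs_sigma_additive e).

End gibbs.

(* Main.v *)
(* Laplace's method.  For x >= 0 and V the double well, V(x) + 1/4 >= (x - 1)^2 / 4,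
   so that the Gibbs weight is dominated by a Gaussian of variance 2 e and its moments
   of (x - 1)^p are O(e^(p/2)).  Integration by parts relates consecutive moments by
   the recursion which defines the numbers c_{m,i}, up to exponentially small boundary
   terms.  Taylor's formula for F at 1 and -1 then yields the expansion, with
   B_m = sum_i (F^(i)(1) + (-1)^i F^(i)(-1)) c_{m,i} / (2 i!).

   Long time limits.  The polynomial Y = sum_{m >= 1} X_m 'X^m (mod 'X^{n+1}) turns
   the sums over compositions into coefficients of powers of Y.  On {+-xi_0 > 0}, X_0
   converges to +-1 exponentially fast, and a one-step expansion of Y^i over a time
   s^2, with an error O(s^3) in every L^p, plays the role of Ito's formula:
   g(t) = E[(Y_t^i)_m ; +-xi_0 > 0] satisfies g' = - 2 i g + (terms with smaller 2m - i)
   up to that error.  Hence these means converge, by induction on 2m - i, to the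
   solution of the same recursion. *)
Require Import Defs.
From mathcomp Require Import all_boot all_order all_algebra.
From mathcomp Require Import all_classical all_reals all_analysis.
From mathcomp Require Import ring lra zify measurable_realfun.
Import Order.TTheory GRing.Theory Num.Theory.
Import numFieldNormedType.Exports.
Local Open Scope classical_set_scope.
Local Open Scope ring_scope.
Set Implicit Arguments.
Unset Strict Implicit.
Unset Printing Implicit Defensive.

(** Subtracting the additive noise leaves paths that are continuously differentiable in time, so the
    whole hierarchy can be treated by ordinary calculus, path by path. Brownian motion enters
    through its increments alone: their mean, variance, moments and independence of the past. Time
    integrals are used as pointwise limits of Riemann sums, for which measurability, adaptedness and
    moment bounds are statements about finite sums at fixed times; joint measurability in time and
    outcome never comes up. With a time step h = s^2 the one-step error is O(h^(3/2)), small
    compared with h, which is why freezing the drift and expanding to second order in the noise is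
    precise enough. Uniformity in time rests on the explicit solution for X_0, hence on an explicit
    linearised flow which contracts at rate 2 for every outcome. The two halves of the argument meet
    in a single array of numbers: reflecting the left well onto the right one multiplies c_{m,i} by
    (-1)^i, which gives the barred coefficients. *)

Section weak_coefficients.
Context (R : realType).
Implicit Types (m i f : nat).

(* Recursion with fuel: the recurrence for c_{m,i} only calls indices with a
   smaller value of 2m - i, so that fuel 2m + 1 suffices. *)
Fixpoint limit_coef_rec f m i : R :=
  if f is f.+1 then
    if i == 0%N then (m == 0%N)%:R
    else if (m < i)%N then 0
    else i.-1%:R / 2 * limit_coef_rec f (m - 2) (i - 2)
         - 3 / 2 * limit_coef_rec f m i.+1 - 1 / 2 * limit_coef_rec f m i.+2
  else 0.

(** Only the numbers attached to the well at 1 are encoded: (-1)^i c_{m,i} satisfies the recurrence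
    and the initial values of the barred numbers, so the other well costs only a sign. *)
Definition limit_coef m i : R := limit_coef_rec (2 * m).+1 m i.

Lemma limit_coef_rec_stable f g m i : (2 * m - i < f)%N -> (2 * m - i < g)%N ->
  limit_coef_rec f m i = limit_coef_rec g m i.
Proof.
elim: f g m i => [//|f IH] [//|g] m i hf hg /=.
case: eqP => // /eqP i0; case: ltnP => // im.
rewrite (IH g m i.+1) ?(IH g m i.+2); try lia.
(* At i = 1 the truncated index [i - 2] is 0 instead of -1; the factor [i.-1] vanishes there and
   hides the difference. *)
case: i i0 im hf hg => [|[|i]]// _ im hf hg; first by rewrite !mul0r.
by rewrite (IH g)//; lia.
Qed.

Lemma limit_coef0 m : limit_coef m 0 = (m == 0%N)%:R.
Proof. by []. Qed.

Lemma limit_coef_gt m i : (m < i)%N -> limit_coef m i = 0.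
Proof. by rewrite /limit_coef /= => mi; case: eqP => [i0|_]; [lia|rewrite mi]. Qed.

Lemma limit_coefE m i : (0 < i <= m)%N ->
  2 * limit_coef m i = i.-1%:R * limit_coef (m - 2) (i - 2)
    - 3 * limit_coef m i.+1 - limit_coef m i.+2.
Proof.
move=> /andP[i0 im].
rewrite {1}/limit_coef /= (gtn_eqF i0) (leq_gtF im).
rewrite (@limit_coef_rec_stable _ (2 * m).+1 m i.+1); try lia.
rewrite (@limit_coef_rec_stable _ (2 * m).+1 m i.+2); try lia.
rewrite -!/(limit_coef _ _).
case: i i0 im => [//|[|i]] _ im; first by rewrite /= !mul0r; lra.
rewrite (@limit_coef_rec_stable _ (2 * (m - 2)).+1)//; try lia.
by rewrite -!/(limit_coef _ _); lra.
Qed.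

End weak_coefficients.

(** * Convergence of a perturbed linear recursion *)

Section one_step.
Context (R : realType).
Implicit Types (g r : R -> R) (l L C M : R).

Lemma exp_small (a : R) (M e : R) : 0 <= a < 1 -> 0 <= M -> 0 < e ->
  exists K : nat, a ^+ K * M < e.
Proof.
move=> /andP[a0 a1] M0 e0.
have ha : `|a| < 1 by rewrite ger0_norm.
have h := @cvg_expr R a ha.
have h' : (fun K => a ^+ K * M) @ \oo --> (0 : R).
  by rewrite -(mul0r M); apply: cvgMl.
have /cvgrPdist_lt/(_ e e0)[K _ /(_ K (leqnn K))] := h'.
by rewrite /= sub0r normrN ger0_norm ?mulr_ge0 ?exprn_ge0// => hK; exists K.
Qed.

(* The scheme is a contraction up to an error h (o(1) + O(sqrt h)): iterate it
   with a fixed small step. *)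
Lemma cvg_one_step g r l L C M : 0 < l ->
  (forall t : R, 0 <= t -> `|g t| <= M) ->
  (forall t s : R, 0 <= t -> 0 < s <= 1 ->
    `|g (t + s ^+ 2) - g t - s ^+ 2 * (- l * g t + r t)| <= C * s ^+ 3) ->
  r t @[t --> +oo] --> L ->
  g t @[t --> +oo] --> L / l.
Proof.
move=> l0 gM step rL.
pose M' := M + `|L / l|.
pose v t := g t - L / l.
have vM t : 0 <= t -> `|v t| <= M'.
  by move=> t0; rewrite (le_trans (ler_normB _ _))// lerD2r gM.
have M'0 : 0 <= M' by rewrite (le_trans _ (vM 0 _)).
have C0 : 0 <= C.
  have := step 0 1 (lexx _); rewrite ltr01 lexx => /(_ isT).
  by rewrite !expr1n mulr1; apply: le_trans.
apply/cvgrPdist_lt => e e0.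
have e2 : 0 < e / 2 by rewrite divr_gt0.
(* Three constraints: s <= 1 makes [step] applicable; together with s l <= 1 it gives s^2 l <= 1, so
   that 1 - s^2 l is a contraction factor; C s <= l e / 4 makes the error C s^3 at most half of the
   allowance s^2 l (e / 2), the other half being left to r - L. The denominator C + 1 avoids a
   division by zero. *)
pose s := Num.min 1 (Num.min (l ^-1) (l * (e / 2) / 2 / (C + 1))).
have s0 : 0 < s.
  rewrite /s !lt_min ltr01 invr_gt0 l0/= divr_gt0// ?mulr_gt0// ?invr_gt0//.
  by rewrite ltr_wpDl.
have s1 : s <= 1 by rewrite /s ge_min lexx.
have sl1 : s * l <= 1.
  by rewrite -ler_pdivlMr// mul1r /s !ge_min lexx orbT.
have sl : s ^+ 2 * l <= 1.
  by have := mulr_ge0 (ltW s0) (ltW l0); nra.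
have sC : C * s <= l * (e / 2) / 2.
  have : s <= l * (e / 2) / 2 / (C + 1) by rewrite /s !ge_min lexx !orbT.
  rewrite ler_pdivlMr ?ltr_wpDl// => h; nra.
have [T [Treal hT]] : \forall t \near +oo, `|L - r t| < l * (e / 2) / 2.
  move/cvgrPdist_lt : rL; apply; by rewrite !divr_gt0// mulr_gt0.
pose T1 := Num.max T 0 + 1.
have T1T : T < T1 by have : T <= Num.max T 0; [rewrite le_max lexx|rewrite /T1; lra].
have T10 : 0 <= T1 by rewrite addr_ge0// le_max lexx orbT.
have iter1 t : T1 <= t -> `|v (t + s ^+ 2)| <= (1 - s ^+ 2 * l) * `|v t| + s ^+ 2 * (l * (e / 2)).
  move=> Tt.
  have t0 : 0 <= t by rewrite (le_trans T10).
  have := step t s t0; rewrite s0 s1 => /(_ isT) hs.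
  have hr := ltW (hT t (lt_le_trans T1T Tt)).
  have -> : v (t + s ^+ 2) = (1 - s ^+ 2 * l) * v t +
      (s ^+ 2 * (r t - L) + (g (t + s ^+ 2) - g t - s ^+ 2 * (- l * g t + r t))).
    by rewrite /v; field; rewrite gt_eqF.
  rewrite (le_trans (ler_normD _ _))//.
  rewrite normrM (ger0_norm (_ : 0 <= 1 - _)) ?subr_ge0// lerD2l.
  rewrite (le_trans (ler_normD _ _))//.
  rewrite normrM (ger0_norm (exprn_ge0 _ (ltW s0))).
  rewrite distrC in hr.
  have : C * s ^+ 3 <= s ^+ 2 * (l * (e / 2) / 2).
    rewrite [_ ^+ 3]exprS mulrA [leLHS]mulrC.
    by rewrite ler_wpM2l// exprn_ge0// ltW.
  have : s ^+ 2 * `|r t - L| <= s ^+ 2 * (l * (e / 2) / 2).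
    by rewrite ler_wpM2l// exprn_ge0// ltW.
  move: hs; set x := s ^+ 2 * (l * (e / 2) / 2).
  have -> : s ^+ 2 * (l * (e / 2)) = x + x by rewrite /x; field.
  by lra.
have iterK K t : T1 <= t ->
    `|v (t + K%:R * s ^+ 2)| <= (1 - s ^+ 2 * l) ^+ K * M' + e / 2.
  move=> Tt; elim: K => [|K IH].
    by rewrite mul0r addr0 expr0 mul1r; have := vM t (le_trans T10 Tt); lra.
  rewrite -natr1 mulrDl mul1r addrA (le_trans (iter1 _ _))//.
    by rewrite (le_trans Tt)// lerDl mulr_ge0// exprn_ge0// ltW.
  have : (1 - s ^+ 2 * l) * `|v (t + K%:R * s ^+ 2)| <=
     (1 - s ^+ 2 * l) * ((1 - s ^+ 2 * l) ^+ K * M' + e / 2).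
    by rewrite ler_wpM2l// subr_ge0.
  rewrite mulrDr mulrA -exprS => h; lra.
have [K hK] : exists K : nat, (1 - s ^+ 2 * l) ^+ K * M' < e / 2.
  apply: exp_small => //; rewrite subr_ge0 sl/= ltrBlDr ltrDl.
  by rewrite mulr_gt0// exprn_gt0.
(* Any t beyond this bound is reached in K steps from a time at least T1; the bound M' is uniform in
   the starting time, so one K serves all t. *)
exists (T1 + K%:R * s ^+ 2); split; first exact: num_real.
move=> t ht.
have := iterK K (t - K%:R * s ^+ 2); rewrite subrK => /(_ _)/le_lt_trans => h.
rewrite distrC; apply: h; first by rewrite lerBrDr ltW.
lra.
Qed.

End one_step.

(** * Mean value and Taylor bounds, Riemann sums *)

Section real_functions.
Context (R : realType).
Implicit Types (F f y : R -> R) (a b s t x M e d : R).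

Lemma mvt_le F F' a b M :
  (forall x, is_derive x 1 F (F' x)) ->
  (forall x, `|x - a| <= `|b - a| -> `|F' x| <= M) ->
  `|F b - F a| <= M * `|b - a|.
Proof.
move=> dF bF.
have cF : continuous F.
  by move=> x; apply/differentiable_continuous/derivable1_diffP.
have [ab|ba] := leP a b.
  have [c] := MVT_segment ab (fun x _ => dF x) (continuous_subspaceT cF).
  rewrite in_itv/= => /andP[ac cb] ->; rewrite normrM ler_wpM2r//.
  by apply: bF; rewrite !ger0_norm ?subr_ge0// lerD2r.
have [c] := MVT_segment (ltW ba) (fun x _ => dF x) (continuous_subspaceT cF).
rewrite in_itv/= => /andP[bc ca] h; rewrite distrC h normrM (distrC a b).
rewrite ler_wpM2r//; apply: bF.
by rewrite !ler0_norm ?subr_le0 ?(ltW ba)// lerN2 lerD2r.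
Qed.

Lemma is_derive_pow_shift a i x :
  is_derive x 1 (fun x : R => (x - a) ^+ i) (i%:R * (x - a) ^+ i.-1).
Proof.
have d1 : is_derive x 1 (fun x : R => x - a) 1.
  by apply: is_derive_eq; rewrite oppr0 addr0.
have := @is_deriveX R R (fun x => x - a) i x 1 1 d1.
by rewrite exprfctE /GRing.scale/= mulr1 mulr_natl.
Qed.

(** Induction on [n]: the remainder vanishes at [a] and its derivative is the remainder of one order
    less for F', so each order costs one mean value inequality on the ball of radius |b - a|. Using
    suprema instead of integrals loses the factor 1/n!. *)
Lemma taylor_bound n F a b M :
  (forall i, (i < n)%N -> forall x, derivable F^`(i)%classic x 1) ->
  (forall x, `|x - a| <= `|b - a| -> `|F^`(n)%classic x| <= M) ->
  `|F b - \sum_(i < n) F^`(i)%classic a / i`!%:R * (b - a) ^+ i|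
    <= M * `|b - a| ^+ n.
Proof.
elim: n F b => [|n IH] F b dF bF.
  by rewrite big_ord0 subr0 expr0 mulr1; apply: bF.
pose h x := F x - \sum_(i < n.+1) F^`(i)%classic a / i`!%:R * (x - a) ^+ i.
pose h' x := F^`()%classic x -
  \sum_(i < n) F^`()^`(i)%classic a / i`!%:R * (x - a) ^+ i.
have dh x : is_derive x 1 h (h' x).
  rewrite /h; apply: is_deriveB.
    by rewrite derive1E; apply: derivableP; exact: (dF 0%N).
  have -> : (fun x => \sum_(i < n.+1) F^`(i)%classic a / i`!%:R * (x - a) ^+ i) =
      \sum_(i < n.+1) (fun x => F^`(i)%classic a / i`!%:R * (x - a) ^+ i).
    by apply/funext => z; rewrite fct_sumE.
  have -> : \sum_(i < n) F^`()^`(i)%classic a / i`!%:R * (x - a) ^+ i =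
      \sum_(i < n.+1) F^`(i)%classic a / i`!%:R * (i%:R * (x - a) ^+ i.-1).
    rewrite [RHS]big_ord_recl (_ : nat_of_ord ord0 = 0%N)// mul0r mulr0 add0r.
    apply: eq_bigr => i _; rewrite lift0 derive1Sn factS natrM.
    have p0 : i.+1%:R != 0 :> R by [].
    have q0 : i`!%:R != 0 :> R by rewrite pnatr_eq0 -lt0n fact_gt0.
    rewrite -pred_Sn; move: (i.+1%:R) (i`!%:R) p0 q0 => p q p0 q0.
    by field; rewrite p0 q0.
  apply: is_derive_sum => i.
  have := is_derive_pow_shift a i x => ?.
  exact: is_deriveZ.
have ha : h a = 0.
  rewrite /h big_ord_recl big1 => [|i _]; last by rewrite lift0 subrr expr0n mulr0.
  by rewrite addr0 (_ : nat_of_ord ord0 = 0%N)// expr0 fact0 divr1 mulr1 subrr.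
have : `|h b - h a| <= M * `|b - a| ^+ n * `|b - a|.
  apply: (mvt_le dh) => x xb.
  apply: le_trans (_ : M * `|x - a| ^+ n <= _).
    apply: IH => [i ni z|z zx].
      by rewrite -derive1Sn; exact: dF.
    by rewrite -derive1Sn; apply: bF; exact: le_trans xb.
  have M0 : 0 <= M by rewrite (le_trans _ (bF a _))// subrr normr0.
  by rewrite ler_wpM2l// lerXn2r ?nnegrE.
by rewrite ha subr0 -mulrA -exprSr.
Qed.

(** [z] may leave the segment. Compactness is applied, through a near covering, to the property of
    being a modulus of continuity at x, which persists under small changes of x. *)
Lemma segment_unif_continuous f a b e : continuous f -> 0 < e ->
  exists2 d, 0 < d & forall x z : R, a <= x <= b -> `|x - z| < d -> `|f x - f z| < e.
Proof.
move=> cf e0.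
have /compact_near_coveringP/(_ R (0:R)^'+
   (fun d x : R => forall y : R, `|x - y| < d -> `|f x - f y| < e)) := @segment_compact R a b.
have h0 : forall x, `[a, b]%classic x -> \forall x' \near x & i \near (0:R)^'+,
   (fun d x : R => forall y : R, `|x - y| < d -> `|f x - f y| < e) i x'.
  move=> x _.
  have /cvgrPdist_lt/(_ (e / 2))[|d /= d0 hd] := cf x; first by rewrite divr_gt0.
  exists (ball x (d / 2), [set i | i < d / 2]) => /=.
    split; first by apply: nbhsx_ballx; rewrite divr_gt0.
    by apply: nbhs_right_lt; rewrite divr_gt0.
  move=> [x' i]/= [xx' id] y x'y.
  have h1 := hd x'; have h2 := hd y.
  have {}h1 : `|f x - f x'| < e / 2.
    by apply: h1; rewrite /ball/= in xx' *; lra.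
  have {}h2 : `|f x - f y| < e / 2.
    apply: h2; rewrite /ball/= in xx' *.
    rewrite -(subrKA x') (le_lt_trans (ler_normD _ _))//; lra.
  rewrite -(subrKA (f x)) (le_lt_trans (ler_normD _ _))// distrC; lra.
move=> /(_ _ h0) hh.
have [d [d0 hd]] := filter_ex (filterI (nbhs_right_gt (0:R)) hh).
exists d => // x y xab; exact: hd.
Qed.

Definition riemann_sum f s t (N : nat) : R :=
  \sum_(j < N.+1) (t - s) / N.+1%:R * f (s + (t - s) * (j%:R / N.+1%:R)).

(** The mean value theorem on each open cell turns the increment of [y] into h f(c), and uniform
    continuity of [f] compares c with the left endpoint. Differentiability is asked at positive
    times, where the pathwise equations provide it. *)
Lemma riemann_sum_cvg f y s t : 0 <= s <= t -> continuous f -> continuous y ->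
  (forall u : R, 0 < u -> is_derive u 1 y (f u)) ->
  riemann_sum f s t N @[N --> \oo] --> y t - y s.
Proof.
move=> /andP[s0 st] cf cy dy.
have [->|ts] := eqVneq s t.
  rewrite subrr (_ : riemann_sum _ _ _ = fun=> 0); first exact: cvg_cst.
  apply/funext => N; rewrite /riemann_sum big1// => j _.
  by rewrite subrr !mul0r.
have {ts}st' : s < t by rewrite lt_neqAle ts.
apply/cvgrPdist_lt => e e0.
have es0 : 0 < e / (t - s) / 2 by rewrite !divr_gt0// subr_gt0.
have [d d0 hd] := @segment_unif_continuous f s t _ cf es0.
have [N0 _ hN0] : \forall N \near \oo, (t - s) / N.+1%:R < d.
  have : (t - s) * (N.+1%:R)^-1 @[N --> \oo] --> (t - s) * 0.
    by apply: cvgMr; exact: cvg_harmonic.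
  rewrite mulr0 => /cvgrPdist_lt/(_ d d0); apply: filterS => N.
  by rewrite sub0r normrN ger0_norm// mulr_ge0// subr_ge0.
exists N0 => // N /= NN0.
have {}hN0 := hN0 N NN0.
set h := (t - s) / N.+1%:R in hN0 *.
have h0 : 0 < h by rewrite divr_gt0// subr_gt0.
have hN : h * N.+1%:R = t - s by rewrite /h divfK.
pose u j := s + h * j%:R.
have uE (j : nat) : s + (t - s) * (j%:R / N.+1%:R) = u j by rewrite /u /h; field.
have -> : y t - y s = \sum_(j < N.+1) (y (u j.+1) - y (u j)).
  rewrite -(big_mkord xpredT (fun j => y (u j.+1) - y (u j))).
  rewrite (@telescope_sumr _ 0 N.+1 (y \o u))//= /u hN mulr0 addr0; congr (y _ - _).
  by rewrite addrC subrK.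
rewrite /riemann_sum -/h -sumrB.
have hj (j : 'I_N.+1) : `|y (u j.+1) - y (u j) -
   h * f (s + (t - s) * (j%:R / N.+1%:R))| <= h * (e / (t - s) / 2).
  rewrite uE.
  have uu : u j.+1 - u j = h by rewrite /u -natr1; ring.
  have uj0 : s <= u j by rewrite /u lerDl mulr_ge0// ltW.
  have ujt : u j.+1 <= t.
    rewrite /u -lerBrDl -hN ler_wpM2l ?(ltW h0)// ler_nat.
    by have := ltn_ord j.
  have ujj : u j < u j.+1 by rewrite -subr_gt0 uu.
  have dyj c : c \in `]u j, u j.+1[ -> is_derive c 1 y (f c).
    by rewrite in_itv/= => /andP[c1 _]; apply: dy; rewrite (le_lt_trans _ c1)// (le_trans s0).
  have [c] := MVT ujj dyj (continuous_subspaceT cy).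
  rewrite in_itv/= uu => /andP[c1 c2] ->.
  rewrite mulrC -mulrBr normrM (gtr0_norm h0) ler_wpM2l ?(ltW h0)//.
  apply/ltW/hd.
    by rewrite (le_trans uj0 (ltW c1)) (le_trans (ltW c2)).
  by rewrite gtr0_norm ?subr_gt0//; lra.
rewrite (le_lt_trans (ler_norm_sum _ _ _))//.
apply: le_lt_trans (_ : \sum_(j < N.+1) (h * (e / (t - s) / 2)) < _).
  by apply: ler_sum => j _.
rewrite sumr_const card_ord -[X in X < _]mulr_natl.
rewrite (_ : _ * _ = h * N.+1%:R * (e / (t - s) / 2)); last by ring.
rewrite hN.
have ts0 : t - s != 0 by rewrite gt_eqF// subr_gt0.
by rewrite (_ : (t - s) * _ = e / 2); [lra | field].
Qed.

End real_functions.

(** * Compositions and coefficients of powers of polynomials *)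

Section compositions.
Local Open Scope nat_scope.
Implicit Types (i m : nat).

Lemma composition_gt0 i m (j : {ffun 'I_i -> 'I_m.+1}) k :
  (j \in compositions i m)%SET -> 0 < j k.
Proof. by rewrite inE => /and3P[_ /forallP/(_ k)]. Qed.

(** There is another part, and it is positive. This makes the hierarchy triangular: the nonlinear
    terms of order m involve orders below m only. *)
Lemma composition_lt i m (j : {ffun 'I_i -> 'I_m.+1}) k : 1 < i ->
  (j \in compositions i m)%SET -> j k < m.
Proof.
move=> i1 hj; have := hj; rewrite inE => /and3P[_ _ /eqP jm].
apply: leq_trans (_ : j k < \sum_k j k) _; last by rewrite jm.
have [l lk] : exists l : 'I_i, l != k.
  have i0 : 0 < i by apply: ltn_trans i1.
  have [/eqP k0|k0] := boolP (k == 0 :> nat).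
    by exists (Ordinal i1); apply/eqP => /(congr1 val)/=; rewrite k0.
  by exists (Ordinal i0); apply/eqP => /(congr1 val)/= h; rewrite -h in k0.
rewrite (bigD1 k)//= (bigD1 l)//= -[X in X < _]addn0 ltn_add2l.
by rewrite (leq_trans (composition_gt0 l hj))// leq_addr.
Qed.

End compositions.

Section composition_coefficients.
Context (A : comNzRingType).
Implicit Types (p q : {poly A}) (i m : nat).

Lemma coef_exp_eq_mod p q i m : (forall l, (l <= m)%N -> p`_l = q`_l) ->
  forall l, (l <= m)%N -> (p ^+ i)`_l = (q ^+ i)`_l.
Proof.
move=> pq; elim: i => [|i IH] l lm; first by rewrite !expr0.
rewrite !exprS !coefM; apply: eq_bigr => k _.
rewrite pq ?IH//; first by rewrite (leq_trans _ lm)// leq_subr.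
by rewrite (leq_trans _ lm)// -ltnS.
Qed.

(** Distributing the power gives a sum over all index tuples of total m; the vanishing constant
    coefficient kills those with a zero part, which are the ones excluded from [compositions]. *)
Lemma coef_exp_compositions p i m : p`_0 = 0 -> (0 < i)%N ->
  (p ^+ i)`_m = \sum_(j in compositions i m) \prod_k p`_(j k).
Proof.
move=> p0 i0.
(* Truncating p at degree m lets the distributed sum range over functions into ['I_m.+1]. *)
rewrite (@coef_exp_eq_mod p (\sum_(a < m.+1) p`_a *: 'X^a) i m) //; last first.
  move=> l lm; rewrite -poly_def coef_poly ltnS lm//.
rewrite -[i in _ ^+ i]card_ord -prodr_const bigA_distr_bigA/= coef_sum.
rewrite big_mkcond [RHS]big_mkcond/=; apply: eq_bigr => j _.
rewrite scaler_prod prodrXr coefZ coefXn.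
have [jc|jc] := boolP (j \in compositions i m)%SET.
  by have := jc; rewrite inE => /and3P[_ _ /eqP ->]; rewrite eqxx mulr1.
have [jm|_] := eqVneq m (\sum_k j k)%N; last by rewrite mulr0.
rewrite mulr1; move: jc; rewrite inE i0 -jm eqxx andbT/= negb_forall.
move=> /existsP[k]; rewrite lt0n negbK => /eqP jk.
by rewrite (bigD1 k)//= jk p0 mul0r.
Qed.

End composition_coefficients.

(** * Inequalities for even powers of exponent 2^k *)

Section dyadic_powers.
Context (R : realType).
Implicit Types (x y K : R) (k : nat).

Lemma pow2_even k : ~~ odd (2 ^ k.+1).
Proof. by rewrite oddX. Qed.

Lemma exprp_ge0 k x : 0 <= x ^+ (2 ^ k.+1).
Proof. exact/exprn_even_ge0/pow2_even. Qed.

Lemma normXp k x : `|x| ^+ (2 ^ k.+1) = x ^+ (2 ^ k.+1).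
Proof. by rewrite -normrX ger0_norm// exprp_ge0. Qed.

Lemma le_normXp k x y : `|x| <= `|y| -> x ^+ (2 ^ k.+1) <= y ^+ (2 ^ k.+1).
Proof. by move=> xy; rewrite -normXp -(normXp _ y) lerXn2r ?nnegrE. Qed.

Lemma exprpD_le k x y : (x + y) ^+ (2 ^ k.+1) <=
  2 ^+ (2 ^ k.+1) * (x ^+ (2 ^ k.+1) + y ^+ (2 ^ k.+1)).
Proof.
wlog xy : x y / `|x| <= `|y|.
  move=> h; have [/h//|/ltW/h] := leP `|x| `|y|.
  by rewrite addrC [X in _ <= _ * X]addrC.
apply: le_trans (_ : (2 * y) ^+ (2 ^ k.+1) <= _).
  apply: le_normXp; rewrite normrM ger0_norm// (le_trans (ler_normD _ _))//.
  by move: xy; lra.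
rewrite exprMn ler_wpM2l ?exprp_ge0//.
by rewrite lerDr exprp_ge0.
Qed.

Lemma exprpM_le k x y : (x * y) ^+ (2 ^ k.+1) <=
  x ^+ (2 ^ k.+2) + y ^+ (2 ^ k.+2).
Proof.
rewrite exprMn (expnSr _ k.+1) !exprM.
by have := sqr_ge0 (x ^+ (2 ^ k.+1) - y ^+ (2 ^ k.+1)); nra.
Qed.

(** Induction on [k] by squaring: the Cauchy-Schwarz inequality, and then the case [k] for the
    squares of the x_j. *)
Lemma jensen_pow2 (J : finType) k (w x : J -> R) K : 0 < K ->
  (forall j, 0 <= w j) -> \sum_j w j <= K ->
  (\sum_j w j * x j) ^+ (2 ^ k) <= K ^+ (2 ^ k).-1 * \sum_j w j * x j ^+ (2 ^ k).
Proof.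
move=> K0 w0 wK; elim: k x => [|k IH] x.
  by rewrite expn0 mul1r expr1; under [leRHS]eq_bigr do rewrite expr1.
have sq : (\sum_j w j * x j) ^+ 2 <= K * \sum_j w j * x j ^+ 2.
  set A := \sum_j w j * x j.
  (* A / K is the barycentre only when the weights sum to K exactly; a smaller sum goes in the right
     direction, since it multiplies the nonnegative term (A / K)^2. *)
  have : 0 <= \sum_j w j * (x j - A / K) ^+ 2.
    by apply: sumr_ge0 => j _; rewrite mulr_ge0// sqr_ge0.
  have -> : \sum_j w j * (x j - A / K) ^+ 2 =
     \sum_j w j * x j ^+ 2 - 2 * (A / K) * A + (A / K) ^+ 2 * \sum_j w j.
    rewrite /A !mulr_sumr -sumrB -big_split/=; apply: eq_bigr => j _; ring.
  have h : (A / K) ^+ 2 * \sum_j w j <= A ^+ 2 / K.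
    apply: le_trans (_ : (A / K) ^+ 2 * K <= _).
      by rewrite ler_wpM2l// sqr_ge0.
    by rewrite le_eqVlt; apply/orP; left; apply/eqP; field; rewrite gt_eqF.
  move=> h2; rewrite mulrC -ler_pdivrMr//.
  have -> : A ^+ 2 / K = 2 * (A / K) * A - A ^+ 2 / K by field; rewrite gt_eqF.
  lra.
rewrite expnS !exprM.
apply: le_trans (_ : (K * \sum_j w j * x j ^+ 2) ^+ (2 ^ k) <= _).
  by rewrite lerXn2r ?nnegrE ?sqr_ge0// (le_trans _ sq)// sqr_ge0.
rewrite exprMn; apply: le_trans (_ : K ^+ (2 ^ k) * (K ^+ (2 ^ k).-1 *
   \sum_j w j * x j ^+ 2 ^+ (2 ^ k)) <= _).
  by rewrite ler_wpM2l ?exprn_ge0 ?(ltW K0).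
rewrite mulrA -exprD le_eqVlt; apply/orP; left; apply/eqP; congr (_ * _).
  by congr (_ ^+ _); have := expn_gt0 2 k; lia.
by apply: eq_bigr => j _; rewrite exprM.
Qed.

End dyadic_powers.

(** * Moments and orders of magnitude in every L^p *)

Section moments.
Context d (T : measurableType d) (R : realType) (P : probability T R).
Local Notation E f := (\int[P]_w (f w)%:E)%E.

Lemma le_moment (f g : T -> R) : measurable_fun setT f -> measurable_fun setT g ->
  (forall w, 0 <= f w <= g w) -> (E f <= E g)%E.
Proof.
move=> mf mg fg; apply: ge0_le_integral => //.
- by move=> w _; rewrite lee_fin; case/andP: (fg w).
- exact/measurable_EFinP.
- exact/measurable_EFinP.
- by move=> w _; rewrite lee_fin; case/andP: (fg w).
Qed.

Lemma moment_cst (c : R) : E (fun=> c) = c%:E.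
Proof. by rewrite integral_cst//= probability_setT mule1. Qed.

(* Fatou's lemma along the Riemann sums, each of them bounded by Jensen's
   inequality. *)
Lemma moment_riemann_limit (f : R -> T -> R) (D : T -> R) (s t : R) (phi : R -> R)
    (K M : R) k : 0 <= s <= t -> 0 < K ->
  (forall u, s <= u <= t -> measurable_fun setT (f u)) ->
  measurable_fun setT D ->
  (forall w, riemann_sum (f^~ w) s t N @[N --> \oo] --> D w) ->
  (forall u, 0 < phi u) -> (forall N, riemann_sum phi s t N <= K) ->
  (forall u, s <= u <= t ->
     (E (fun w => f u w ^+ (2 ^ k.+1)) <= (M * phi u ^+ (2 ^ k.+1))%:E)%E) ->
  (E (fun w => D w ^+ (2 ^ k.+1)) <= (M * K ^+ (2 ^ k.+1))%:E)%E.
Proof.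
move=> /andP[s0 st] K0 mf mD fD phi0 phiK fM.
have uin (N : nat) (j : 'I_N.+1) :
    s <= s + (t - s) * (j%:R / N.+1%:R) <= t.
  have j1 : 0 <= (j%:R / N.+1%:R : R) <= 1.
    rewrite divr_ge0//= ler_pdivrMr// mul1r ler_nat.
    by rewrite ltnW.
  by move: j1; set q := _ / _ => /andP[q0 q1]; apply/andP; split; nra.
have M0 : 0 <= M.
  have /andP[h1 h2] := uin 0%N ord0.
  have := fM _ (uin 0%N ord0); set u0 := _ + _ => h.
  have : (0 <= (M * phi u0 ^+ (2 ^ k.+1))%:E)%E.
    by apply: le_trans h; apply: integral_ge0 => w _; rewrite lee_fin exprp_ge0.
  by rewrite lee_fin pmulr_lge0// exprn_gt0.
have mR N : measurable_fun setT (fun w => riemann_sum (f^~ w) s t N).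
  apply: measurable_sum => j; apply: measurable_funM => //.
  by apply: mf; exact: uin.
have bR N : (E (fun w => riemann_sum (f^~ w) s t N ^+ (2 ^ k.+1))
     <= (M * K ^+ (2 ^ k.+1))%:E)%E.
  pose u (j : 'I_N.+1) := s + (t - s) * (j%:R / N.+1%:R).
  (* The majorant phi is moved into the Jensen weights and f is divided by it: the total weight is
     then at most K, whatever the length of [s, t]. *)
  pose c (j : 'I_N.+1) := (t - s) / N.+1%:R * phi (u j).
  have c0 j : 0 <= c j by rewrite mulr_ge0 ?divr_ge0 ?subr_ge0 ?(ltW (phi0 _)).
  have p0 j : phi (u j) != 0 by rewrite gt_eqF.
  have h w : 0 <= riemann_sum (f^~ w) s t N ^+ (2 ^ k.+1) <= K ^+ (2 ^ k.+1).-1 *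
      \sum_j c j * (f (u j) w / phi (u j)) ^+ (2 ^ k.+1).
    rewrite exprp_ge0/=.
    apply: le_trans (jensen_pow2 _ _ K0 c0 _); last exact: phiK.
    rewrite le_eqVlt; apply/orP; left; apply/eqP; congr (_ ^+ _).
    apply: eq_bigr => j _; rewrite /c -/(u j).
    by rewrite -[RHS]mulrA [phi _ * _]mulrC divfK.
  have mfu j : measurable_fun setT (fun w => c j * (f (u j) w / phi (u j)) ^+ (2 ^ k.+1)).
    apply: measurable_funM => //; apply: measurable_funX.
    by apply: measurable_funM => //; apply: mf; exact: uin.
  apply: le_trans (le_moment _ _ h) _.
  - exact: measurable_funX.
  - by apply: measurable_funM => //; apply: measurable_sum.
  under eq_integral do rewrite EFinM.
  rewrite ge0_integralZl_EFin//; last 3 first.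
  - by move=> w _; rewrite lee_fin sumr_ge0// => j _; rewrite mulr_ge0// exprp_ge0.
  - by apply/measurable_EFinP; apply: measurable_sum.
  - by rewrite exprn_ge0// ltW.
  have -> : M * K ^+ (2 ^ k.+1) = K ^+ (2 ^ k.+1).-1 * (M * K).
    by rewrite mulrCA -exprSr prednK// expn_gt0.
  rewrite EFinM lee_wpmul2l ?lee_fin ?exprn_ge0 ?(ltW K0)//.
  under eq_integral do rewrite -sumEFin.
  rewrite ge0_integral_sum//; last 2 first.
  - by move=> j; apply/measurable_EFinP.
  - by move=> j w _; rewrite lee_fin mulr_ge0// exprp_ge0.
  apply: le_trans (_ : (\sum_(j < N.+1) (c j * M)%:E)%E <= _)%E.
    apply: lee_sum => j _.
    under eq_integral => w _ do rewrite exprMn mulrA mulrAC EFinM.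
    rewrite ge0_integralZl_EFin//; last 3 first.
    - by move=> w _; rewrite lee_fin exprp_ge0.
    - by apply/measurable_EFinP; apply: measurable_funX; apply: mf; exact: uin.
    - by rewrite mulr_ge0// exprp_ge0.
    apply: le_trans (_ : ((c j * (phi (u j))^-1 ^+ (2 ^ k.+1))%:E *
      (M * phi (u j) ^+ (2 ^ k.+1))%:E)%E <= _)%E.
      rewrite lee_wpmul2l ?lee_fin ?mulr_ge0 ?exprp_ge0//.
        by rewrite subr_ge0.
        exact: ltW.
      by apply: fM; exact: uin.
    rewrite -EFinM lee_fin exprVn le_eqVlt; apply/orP; left; apply/eqP.
    by field; rewrite expf_neq0.
  rewrite sumEFin lee_fin -mulr_suml mulrC ler_wpM2l//.
  exact: phiK.
pose g N w := (riemann_sum (f^~ w) s t N ^+ (2 ^ k.+1))%:E.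
have gD w : limn_einf (g^~ w) = (D w ^+ (2 ^ k.+1))%:E.
  have : (g^~ w) N @[N --> \oo] --> (D w ^+ (2 ^ k.+1))%:E.
    apply: cvg_EFin; first exact: nearW.
    have cX : {for D w, continuous (fun x : R => x ^+ (2 ^ k.+1))}.
      exact: exprn_continuous.
    exact: continuous_cvg cX (fD w).
  by move/cvg_limn_einf_sup => [].
have -> : E (fun w => D w ^+ (2 ^ k.+1)) = (\int[P]_w limn_einf (g^~ w))%E.
  by apply: eq_integral => w _; rewrite gD.
apply: le_trans (fatou _ _ _ _) _ => //.
- by move=> N; apply/measurable_EFinP; exact: measurable_funX.
- by move=> N w _; rewrite lee_fin exprp_ge0.
rewrite limn_einf_lim; apply: lime_le; first exact: is_cvg_einfs.
by apply: nearW => N; apply: le_trans (bR N); apply: ereal_inf_lbound => /=; exists N => /=.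
Qed.

End moments.

Section orders.
Context d (T : measurableType d) (R : realType) (P : probability T R).
Local Notation E f := (\int[P]_w (f w)%:E)%E.

(* f_i = O(gamma_i^a) in every L^p; only the exponents p = 2^k are used, since
   they suffice to control all the others. *)
Definition bigO (I : Type) (gamma : I -> R) (a : nat) (f : I -> T -> R) :=
  (forall i, measurable_fun setT (f i)) /\
  forall k, exists C, forall i,
    (E (fun w => (f i w / gamma i ^+ a) ^+ (2 ^ k.+1)) <= C%:E)%E.

Section gauge.
Context (I : Type) (gamma : I -> R) (gamma01 : forall i, 0 < gamma i <= 1).
Implicit Types (f g : I -> T -> R) (a b k : nat).

Let g0 i : 0 < gamma i. Proof. by case/andP: (gamma01 i). Qed.
Let g1 i : gamma i <= 1. Proof. by case/andP: (gamma01 i). Qed.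
Let ga0 a i : gamma i ^+ a != 0. Proof. by rewrite expf_neq0// gt_eqF. Qed.
Let pos a i : 0 < gamma i ^+ a. Proof. by rewrite exprn_gt0. Qed.

Local Hint Resolve ga0 : core.

Lemma bigO_measurable a f i : bigO gamma a f -> measurable_fun setT (f i).
Proof. by case. Qed.

Lemma bigO_dom a f g (c : R) : (forall i, measurable_fun setT (f i)) ->
  (forall i w, `|f i w| <= c * `|g i w|) -> bigO gamma a g -> bigO gamma a f.
Proof.
move=> mf fg [mg Og]; split => // k; have [C hC] := Og k.
exists (c ^+ (2 ^ k.+1) * C) => i; rewrite EFinM.
apply: le_trans (_ : (c ^+ (2 ^ k.+1))%:E *
   E (fun w => (g i w / gamma i ^+ a) ^+ (2 ^ k.+1))%R <= _)%E; last first.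
  by rewrite lee_wpmul2l// lee_fin exprp_ge0.
rewrite -ge0_integralZl_EFin ?exprp_ge0//; last 2 first.
- by move=> w _; rewrite lee_fin exprp_ge0.
- by apply/measurable_EFinP; apply: measurable_funX; apply: measurable_funM.
under [X in (_ <= X)%E]eq_integral do rewrite -EFinM -exprMn.
apply: le_moment => [||w].
- by apply: measurable_funX; apply: measurable_funM.
- by apply: measurable_funX; do 2 apply: measurable_funM => //.
rewrite exprp_ge0/= le_normXp// mulrA !normrM ler_wpM2r//.
by rewrite (le_trans (fg i w))// ler_wpM2r// ler_norm.
Qed.

Lemma bigO_bounded f (M : R) : (forall i, measurable_fun setT (f i)) ->
  (forall i w, `|f i w| <= M) -> bigO gamma 0 f.
Proof.
move=> mf fM; split => // k; exists (M ^+ (2 ^ k.+1)) => i.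
rewrite -(moment_cst P); apply: le_moment => [||w].
- by apply: measurable_funX; apply: measurable_funM.
- exact: measurable_cst.
rewrite exprp_ge0/= divr1 le_normXp//.
by rewrite (le_trans (fM i w))// ler_norm.
Qed.

Lemma bigO_cst (c : R) : bigO gamma 0 (fun _ _ => c).
Proof. exact: (@bigO_bounded _ `|c|). Qed.

Lemma bigO_gauge a : bigO gamma a (fun i _ => gamma i ^+ a).
Proof.
split => // k; exists 1 => i.
by rewrite divff// expr1n moment_cst.
Qed.

Lemma eq_bigO a f g : (forall i w, f i w = g i w) -> bigO gamma a f -> bigO gamma a g.
Proof. by move=> fg; have -> : f = g by apply/funext => i; apply/funext => w. Qed.

Lemma bigO_le a b f : (b <= a)%N -> bigO gamma a f -> bigO gamma b f.
Proof.
move=> ba [mf Of]; split => // k; have [C hC] := Of k; exists C => i.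
apply: le_trans (hC i); apply: le_moment => [||w].
- by apply: measurable_funX; apply: measurable_funM.
- by apply: measurable_funX; apply: measurable_funM.
rewrite exprp_ge0/= le_normXp// !normrM ler_wpM2l// !normfV !gtr0_norm ?pos//.
by rewrite lef_pV2 ?posrE ?pos// ler_wiXn2l// ltW.
Qed.

Lemma bigON a f : bigO gamma a f -> bigO gamma a (fun i w => - f i w).
Proof.
move=> Of; apply: (bigO_dom (c := 1)) (Of) => [i|i w].
  by apply: measurableT_comp => //; case: Of.
by rewrite normrN mul1r.
Qed.

Lemma bigOD a f g : bigO gamma a f -> bigO gamma a g ->
  bigO gamma a (fun i w => f i w + g i w).
Proof.
move=> [mf Of] [mg Og]; split => [i|k]; first exact: measurable_funD.
have [Cf hf] := Of k; have [Cg hg] := Og k.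
exists (2 ^+ (2 ^ k.+1) * (Cf + Cg)) => i.
have mf' : measurable_fun setT (fun w => (f i w / gamma i ^+ a) ^+ (2 ^ k.+1)).
  by apply: measurable_funX; apply: measurable_funM.
have mg' : measurable_fun setT (fun w => (g i w / gamma i ^+ a) ^+ (2 ^ k.+1)).
  by apply: measurable_funX; apply: measurable_funM.
apply: le_trans (_ : E (fun w => 2 ^+ (2 ^ k.+1) * ((f i w / gamma i ^+ a) ^+ (2 ^ k.+1)
   + (g i w / gamma i ^+ a) ^+ (2 ^ k.+1)))%R <= _)%E.
  apply: le_moment => [||w].
  - by apply: measurable_funX; apply: measurable_funM => //; apply: measurable_funD.
  - by apply: measurable_funM => //; apply: measurable_funD.
  by rewrite exprp_ge0/= mulrDl exprpD_le.
under eq_integral do rewrite EFinM EFinD.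
rewrite ge0_integralZl_EFin ?exprp_ge0//; last 2 first.
- by move=> w _; rewrite -EFinD lee_fin addr_ge0 ?exprp_ge0.
- by apply: emeasurable_funD; apply/measurable_EFinP.
rewrite EFinM lee_wpmul2l ?lee_fin ?exprp_ge0//.
rewrite ge0_integralD//; last 4 first.
- by move=> w _; rewrite lee_fin exprp_ge0.
- exact/measurable_EFinP.
- by move=> w _; rewrite lee_fin exprp_ge0.
- exact/measurable_EFinP.
by rewrite EFinD leeD.
Qed.

Lemma bigOB a f g : bigO gamma a f -> bigO gamma a g ->
  bigO gamma a (fun i w => f i w - g i w).
Proof. by move=> Of Og; apply: bigOD => //; exact: bigON. Qed.

(** A product in L^p needs both factors in L^(2p), that is the next dyadic exponent. This is why the
    definition asks for all of them at once. *)
Lemma bigOM a b f g : bigO gamma a f -> bigO gamma b g ->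
  bigO gamma (a + b) (fun i w => f i w * g i w).
Proof.
move=> [mf Of] [mg Og]; split => [i|k]; first exact: measurable_funM.
have [Cf hf] := Of k.+1; have [Cg hg] := Og k.+1.
exists (Cf + Cg) => i.
have mf' : measurable_fun setT (fun w => (f i w / gamma i ^+ a) ^+ (2 ^ k.+2)).
  by apply: measurable_funX; apply: measurable_funM.
have mg' : measurable_fun setT (fun w => (g i w / gamma i ^+ b) ^+ (2 ^ k.+2)).
  by apply: measurable_funX; apply: measurable_funM.
apply: le_trans (_ : E (fun w => (f i w / gamma i ^+ a) ^+ (2 ^ k.+2)
   + (g i w / gamma i ^+ b) ^+ (2 ^ k.+2))%R <= _)%E.
  apply: le_moment => [||w].
  - by apply: measurable_funX; do 2 apply: measurable_funM => //.
  - exact: measurable_funD.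
  by rewrite exprp_ge0/= exprD invfM mulrACA exprpM_le.
under eq_integral do rewrite EFinD.
rewrite ge0_integralD//; last 4 first.
- by move=> w _; rewrite lee_fin exprp_ge0.
- exact/measurable_EFinP.
- by move=> w _; rewrite lee_fin exprp_ge0.
- exact/measurable_EFinP.
by rewrite EFinD leeD.
Qed.

Lemma bigOMl0 a f g : bigO gamma 0 f -> bigO gamma a g ->
  bigO gamma a (fun i w => f i w * g i w).
Proof. by move=> Of Og; have := bigOM Of Og. Qed.

Lemma bigOZ a (c : R) f : bigO gamma a f -> bigO gamma a (fun i w => c * f i w).
Proof. by move=> Of; apply: (bigOMl0 (bigO_cst c) Of). Qed.

Lemma bigO0 a : bigO gamma a (fun _ _ => 0).
Proof. by apply: eq_bigO (bigOZ 0 (bigO_gauge a)) => i w; rewrite mul0r. Qed.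

Lemma bigO_sum a (J : Type) (r : seq J) (Q : pred J) (F : J -> I -> T -> R) :
  (forall j, Q j -> bigO gamma a (F j)) ->
  bigO gamma a (fun i w => \sum_(j <- r | Q j) F j i w).
Proof.
move=> OF; elim: r => [|j r IH].
  by apply: eq_bigO (bigO0 a) => i w; rewrite big_nil.
have [Qj|Qj] := boolP (Q j).
  by apply: eq_bigO (bigOD (OF j Qj) IH) => i w; rewrite big_cons Qj.
by apply: eq_bigO IH => i w; rewrite big_cons (negbTE Qj).
Qed.

Lemma bigO_prod (J : Type) (r : seq J) (Q : pred J) (F : J -> I -> T -> R) :
  (forall j, Q j -> bigO gamma 0 (F j)) ->
  bigO gamma 0 (fun i w => \prod_(j <- r | Q j) F j i w).
Proof.
move=> OF; elim: r => [|j r IH].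
  by apply: eq_bigO (bigO_cst 1) => i w; rewrite big_nil.
have [Qj|Qj] := boolP (Q j).
  by apply: eq_bigO (bigOM (OF j Qj) IH) => i w; rewrite big_cons Qj.
by apply: eq_bigO IH => i w; rewrite big_cons (negbTE Qj).
Qed.

Lemma bigO_moment a f k : bigO gamma a f -> exists C, forall i,
  (E (fun w => f i w ^+ (2 ^ k.+1)) <= (C * (gamma i ^+ a) ^+ (2 ^ k.+1))%:E)%E.
Proof.
move=> [mf Of]; have [C hC] := Of k; exists C => i.
rewrite mulrC EFinM.
apply: le_trans (_ : ((gamma i ^+ a) ^+ (2 ^ k.+1))%:E *
  E (fun w => (f i w / gamma i ^+ a) ^+ (2 ^ k.+1))%R <= _)%E; last first.
  by rewrite lee_wpmul2l// lee_fin exprp_ge0.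
rewrite -ge0_integralZl_EFin ?exprp_ge0//; last 2 first.
- by move=> w _; rewrite lee_fin exprp_ge0.
- by apply/measurable_EFinP; apply: measurable_funX; apply: measurable_funM.
rewrite le_eqVlt; apply/orP; left; apply/eqP; apply: eq_integral => w _.
by rewrite -EFinM -exprMn mulrC divfK.
Qed.

Lemma bigO_intro a f : (forall i, measurable_fun setT (f i)) ->
  (forall k, exists C, forall i,
    (E (fun w => f i w ^+ (2 ^ k.+1)) <= (C * (gamma i ^+ a) ^+ (2 ^ k.+1))%:E)%E) ->
  bigO gamma a f.
Proof.
move=> mf Of; split => // k; have [C hC] := Of k; exists C => i.
under eq_integral do rewrite exprMn mulrC EFinM.
rewrite ge0_integralZl_EFin ?exprp_ge0//; last 2 first.
- by move=> w _; rewrite lee_fin exprp_ge0.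
- by apply/measurable_EFinP; apply: measurable_funX.
apply: le_trans (_ : ((gamma i ^+ a)^-1 ^+ (2 ^ k.+1))%:E *
  (C * (gamma i ^+ a) ^+ (2 ^ k.+1))%:E <= _)%E.
  by rewrite lee_wpmul2l// lee_fin exprp_ge0.
rewrite -EFinM lee_fin exprVn mulrC mulfK// expf_neq0//.
Qed.

(** The inequality |x| <= 1 + x^2 reduces the first moment to the exponent 2 of the definition. *)
Lemma bigO_integrable_norm a f : bigO gamma a f -> exists C, forall i,
  (E (fun w => `|f i w|) <= (C * gamma i ^+ a)%:E)%E.
Proof.
move=> Of; have [mf Of'] := Of; have [C hC] := Of' 0%N.
exists (1 + C) => i; rewrite mulrC EFinM.
apply: le_trans (_ : (gamma i ^+ a)%:E *
  E (fun w => 1 + (f i w / gamma i ^+ a) ^+ 2)%R <= _)%E; last first.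
  rewrite lee_wpmul2l ?lee_fin ?(ltW (pos _ _))//.
  under eq_integral do rewrite EFinD.
  rewrite ge0_integralD//; last 2 first.
  - by move=> w _; rewrite lee_fin sqr_ge0.
  - by apply/measurable_EFinP; apply: measurable_funX; apply: measurable_funM.
  by rewrite moment_cst EFinD leeD.
rewrite -ge0_integralZl_EFin ?(ltW (pos _ _))//; last 2 first.
- by move=> w _; rewrite lee_fin addr_ge0// sqr_ge0.
- apply/measurable_EFinP; apply: measurable_funD => //.
  by apply: measurable_funX; apply: measurable_funM.
under [X in (_ <= X)%E]eq_integral do rewrite -EFinM.
apply: le_moment => [||w].
- exact: measurableT_comp.
- apply: measurable_funM => //; apply: measurable_funD => //.
  by apply: measurable_funX; apply: measurable_funM.
rewrite normr_ge0/= mulrC -ler_pdivrMr// -[X in _ / X]gtr0_norm// -normf_div.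
rewrite -real_normK ?num_real//.
have := normr_ge0 (f i w / gamma i ^+ a); set x := `|_| => x0.
by have := sqr_ge0 (x - 1); nra.
Qed.

Lemma bigO_integrable a f i : bigO gamma a f -> P.-integrable setT (EFin \o f i).
Proof.
move=> Of; have [C hC] := bigO_integrable_norm Of.
apply/integrableP; split; first by apply/measurable_EFinP; case: Of.
by rewrite /=; apply: le_lt_trans (hC i) _; rewrite ltry.
Qed.

Lemma bigO_expectation a f : bigO gamma a f ->
  exists C, forall i, `|\int[P]_w f i w| <= C * gamma i ^+ a.
Proof.
move=> Of; have [C hC] := bigO_integrable_norm Of; exists C => i.
have intf := bigO_integrable i Of.
apply: le_trans (le_normr_Rintegral _ intf) _ => //.
rewrite -lee_fin /Rintegral fineK; first exact: hC.
have : P.-integrable setT (EFin \o (fun w => `|f i w|)) by exact: integrable_norm.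
exact: integrable_fin_num.
Qed.

End gauge.

(** With exponent 0 the gauge does not enter the bound. Estimates uniform in time thereby become
    estimates uniform over time steps, at their starting or stopping times. *)
Lemma bigO_reindex0 (I J : Type) (gI : I -> R) (gJ : J -> R) (h : J -> I) f :
  bigO gI 0 f -> bigO gJ 0 (fun j => f (h j)).
Proof.
move=> [mf Of]; split => [j|k]; first exact: mf.
by have [C hC] := Of k; exists C => j; apply: le_trans (hC (h j)); rewrite !expr0.
Qed.

End orders.

(** * Image measures given by a density *)

Section density.
Local Open Scope ereal_scope.
Context d d' (T : measurableType d) (T' : measurableType d') (R : realType).
Context (mu : {measure set T -> \bar R}) (nu : {measure set T' -> \bar R}).
Context (phi : T' -> T) (mphi : measurable_fun setT phi) (p : T -> R).
Context (p0 : forall x, (0 <= p x)%R) (mp : measurable_fun setT p).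
Context (nuE : forall A, measurable A ->
  nu (phi @^-1` A) = \int[mu]_(x in A) (p x)%:E).
Import HBNNSimple.

Let mpE : measurable_fun setT (EFin \o p).
Proof. exact/measurable_EFinP. Qed.

Let density_nnsfun (h : {nnsfun T >-> R}) :
  \int[mu]_x ((h x)%:E * (p x)%:E) = \int[nu]_x (h (phi x))%:E.
Proof.
have pos y x : y \in range h -> 0 <= (y * \1_(h @^-1` [set y]) x)%:E.
  by rewrite inE => -[t _ <-]; rewrite lee_fin mulr_ge0.
have pos' y x : 0 <= (y * \1_(h @^-1` [set y]) x)%:E.
  by rewrite EFinM nnfun_muleindic_ge0.
transitivity (\int[mu]_x (\sum_(y \in range h)
    ((y * \1_(h @^-1` [set y]) x)%:E * (p x)%:E))).
  apply: eq_integral => x _; rewrite [in LHS](fimfunE h) -fsumEFin//.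
  by rewrite ge0_mule_fsuml.
rewrite ge0_integral_fsum//; last 2 first.
- move=> y; apply: emeasurable_funM => //; apply/measurable_EFinP.
  exact: measurable_funM.
- by move=> y x _; rewrite mule_ge0// lee_fin.
transitivity (\int[nu]_x (\sum_(y \in range h)
    (y * \1_(h @^-1` [set y]) (phi x))%:E)); last first.
  by apply: eq_integral => x _; rewrite [in RHS](fimfunE h) -fsumEFin.
have mi y : measurable_fun setT (fun x => (\1_(h @^-1` [set y]) (phi x))%:E : \bar R).
  by apply/measurable_EFinP; apply: measurableT_comp.
rewrite ge0_integral_fsum//; last first.
  move=> y; under eq_fun do rewrite EFinM.
  by apply: emeasurable_funM.
apply: eq_fsbigr => y; rewrite inE => -[t _ <-].
under eq_integral do rewrite EFinM -muleA.
rewrite ge0_integralZl//; last 3 first.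
- by apply: emeasurable_funM => //; exact/measurable_EFinP.
- by move=> x _; rewrite mule_ge0// lee_fin.
- by rewrite lee_fin.
under [RHS]eq_integral do rewrite EFinM.
rewrite ge0_integralZl//; last by rewrite lee_fin.
congr (_ * _).
transitivity (\int[nu]_x (\1_(phi @^-1` (h @^-1` [set h t])) x)%:E); last by [].
rewrite integral_indic//; last by rewrite -[_ @^-1` _]setTI; exact: mphi.
rewrite setIT nuE// [RHS]integral_mkcond.
by apply: eq_integral => x _; rewrite epatch_indic muleC.
Qed.

Lemma ge0_integral_density (f : T -> \bar R) :
  measurable_fun setT f -> (forall x, 0 <= f x) ->
  \int[nu]_x f (phi x) = \int[mu]_x (f x * (p x)%:E).
Proof.
move=> mf f0.
pose h := nnsfun_approx measurableT mf.
have hf x : (h n x)%:E @[n --> \oo] --> f x.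
  by apply: (cvg_nnsfun_approx (D := setT)).
have hh x a b : (a <= b)%N -> (h a x)%:E <= (h b x)%:E.
  by move=> ab; rewrite lee_fin; exact/lefP/nd_nnsfun_approx.
transitivity (limn (fun n => \int[nu]_x (h n (phi x))%:E)).
  rewrite -monotone_convergence//; last 3 first.
  - by move=> n; apply/measurable_EFinP; exact: measurableT_comp.
  - by move=> n x _; rewrite lee_fin.
  - by move=> x _ a b; exact: hh.
  by apply: eq_integral => x _; apply/esym/cvg_lim => //; exact: hf.
transitivity (limn (fun n => \int[mu]_x ((h n x)%:E * (p x)%:E))).
  by apply/congr_lim/funext => n; rewrite density_nnsfun.
rewrite -monotone_convergence//; last 3 first.
- by move=> n; apply: emeasurable_funM => //; exact/measurable_EFinP.
- by move=> n x _; rewrite mule_ge0 ?lee_fin.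
- by move=> x _ a b ab; rewrite lee_wpmul2r ?hh ?lee_fin.
apply: eq_integral => x _; apply: cvg_lim => //.
by apply: cvgeZr => //; exact: hf.
Qed.

(** The density is nonnegative, so multiplying by it commutes with positive and negative parts, and
    both sides are the same difference of integrals, integrable or not. It serves for the law of a
    Brownian increment, with [phi] the increment, and for the Gibbs measure, with [phi] the
    identity. *)
Lemma integral_density (f : T -> R) : measurable_fun setT f ->
  \int[nu]_x (f (phi x))%:E = \int[mu]_x (f x * p x)%:E.
Proof.
move=> mf; rewrite integralE [RHS]integralE.
have mfE : measurable_fun setT (EFin \o f) by exact/measurable_EFinP.
have := ge0_integral_density (measurable_funepos mfE) (funepos_ge0 _).
have := ge0_integral_density (measurable_funeneg mfE) (funeneg_ge0 _).
move=> en ep; congr (_ - _).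
- transitivity (\int[nu]_x (EFin \o f)^\+ (phi x)).
    by apply: eq_integral => x _; rewrite !funeposE.
  rewrite ep; apply: eq_integral => x _.
  rewrite !funeposE -!EFin_max -EFinM; congr (_%:E).
  by rewrite maxr_pMl// mul0r.
- transitivity (\int[nu]_x (EFin \o f)^\- (phi x)).
    by apply: eq_integral => x _; rewrite !funenegE.
  rewrite en; apply: eq_integral => x _.
  rewrite !funenegE -!EFinN -!EFin_max -EFinM; congr (_%:E).
  by rewrite maxr_pMl// mul0r mulNr.
Qed.

End density.

(** * Gaussian integrals *)

Section gaussian.
Context (R : realType).
Local Notation leb := (@lebesgue_measure R).
Implicit Types (x m s : R) (p : nat).

Lemma pow_le_fact_expR p x : 0 <= x -> x ^+ p <= p`!%:R * expR x.
Proof.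
move=> x0; case: p => [|p].
  by rewrite expr0 fact0 mul1r -expR0 ler_expR.
rewrite -ler_pdivrMl ?ltr0n ?fact_gt0// mulrC.
by have := expR_ge1Dxn p x0; lra.
Qed.

(** With u = (x - m) / s, the exponent u^2 / 2 splits as 3 u^2 / 8 + u^2 / 8, and u^2 / 8 is the
    exponent for the deviation 2 s; the peak is halved, hence the factor 2. *)
Lemma normal_pdf_double m s x : 0 < s ->
  normal_pdf m s x = 2 * expR (- (3 / 8) * ((x - m) / s) ^+ 2) * normal_pdf m (2 * s) x.
Proof.
move=> s0; have s20 : 2 * s != 0 by rewrite mulf_neq0// gt_eqF.
rewrite !normal_pdfE ?gt_eqF// ?mulr_gt0//.
have -> : normal_peak (2 * s) = normal_peak s / 2.
  rewrite /normal_peak.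
  have -> : (2 * s) ^+ 2 * pi *+ 2 = 2 ^+ 2 * (s ^+ 2 * pi *+ 2) by ring.
  rewrite sqrtrM ?sqr_ge0//.
  by rewrite sqrtr_sqr ger0_norm// invfM mulrC.
have -> : normal_fun m s x = expR (- (3 / 8) * ((x - m) / s) ^+ 2) * normal_fun m (2 * s) x.
  by rewrite /normal_fun -expRD; congr expR; field; rewrite gt_eqF.
by rewrite mulrACA mulrC -!mulrA; field.
Qed.

(** Part of the Gaussian decay absorbs the polynomial factor; what is left is a normal density, of
    integral 1, so that moments are bounded without being computed. *)
Lemma pow_normal_pdf_le p m s x : 0 < s ->
  `|x - m| ^+ p * normal_pdf m s x <=
    (2 * p`!%:R * expR 1) * s ^+ p * normal_pdf m (2 * s) x.
Proof.
move=> s0; rewrite normal_pdf_double// mulrA ler_wpM2r ?normal_pdf_ge0//.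
set u := `|x - m| / s.
have u0 : 0 <= u by rewrite divr_ge0// ltW.
have -> : `|x - m| = u * s by rewrite divfK// gt_eqF.
have -> : ((x - m) / s) ^+ 2 = u ^+ 2.
  by rewrite -real_normK ?num_real// normrM normfV (gtr0_norm s0).
rewrite exprMn.
have h : u ^+ p * expR (- (3 / 8) * u ^+ 2) <= p`!%:R * expR 1.
  apply: le_trans (_ : p`!%:R * expR u * expR (- (3 / 8) * u ^+ 2) <= _).
    by rewrite ler_wpM2r ?expR_ge0// pow_le_fact_expR.
  rewrite -mulrA -expRD ler_wpM2l// ler_expR.
  (* Completing the square, u - 3 u^2 / 8 is at most 2/3, its value at u = 4/3. *)
  by have := sqr_ge0 (u - 4 / 3); nra.
have sp0 : 0 <= s ^+ p by rewrite exprn_ge0// ltW.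
have -> : u ^+ p * s ^+ p * (2 * expR (- (3 / 8) * u ^+ 2)) =
  2 * s ^+ p * (u ^+ p * expR (- (3 / 8) * u ^+ 2)) by ring.
have -> : 2 * p`!%:R * expR 1 * s ^+ p = 2 * s ^+ p * (p`!%:R * expR 1) by ring.
by rewrite ler_wpM2l// mulr_ge0.
Qed.

Lemma integral_pow_normal_pdf p m s : 0 < s ->
  (\int[leb]_x (`|x - m| ^+ p * normal_pdf m s x)%:E <=
   ((2 * p`!%:R * expR 1) * s ^+ p)%:E)%E.
Proof.
move=> s0.
have c0 : 0 <= 2 * p`!%:R * expR 1 * s ^+ p.
  by rewrite !mulr_ge0 ?expR_ge0 ?exprn_ge0 ?(ltW s0).
apply: le_trans (_ : \int[leb]_x ((2 * p`!%:R * expR 1) * s ^+ p *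
   normal_pdf m (2 * s) x)%:E <= _)%E.
  apply: ge0_le_integral => //.
  - by move=> x _; rewrite lee_fin mulr_ge0 ?normal_pdf_ge0 ?exprn_ge0.
  - apply/measurable_EFinP; apply: measurable_funM.
      by apply: measurable_funX; apply: measurableT_comp => //; apply: measurable_funB.
    exact: measurable_normal_pdf.
  - apply/measurable_EFinP; apply: measurable_funM => //.
    exact: measurable_normal_pdf.
  - by move=> x _; rewrite lee_fin pow_normal_pdf_le.
under eq_integral do rewrite EFinM.
rewrite ge0_integralZl_EFin//.
- by rewrite integral_normal_pdf mule1.
- by move=> x _; rewrite lee_fin normal_pdf_ge0.
- by apply/measurable_EFinP; exact: measurable_normal_pdf.
Qed.

(* The fundamental theorem of calculus on an exhaustion of an unbounded
   domain. *)
Lemma integral_deriv_exhaustion (f F : R -> R) (D : set R) (a b : nat -> R) (l : R) :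
  measurable D -> leb.-integrable D (EFin \o f) -> continuous f ->
  (forall x, is_derive x 1 F (f x)) -> (forall n, a n < b n) ->
  (forall n x, a n <= x <= b n -> D x) ->
  (forall x, D x -> \forall n \near \oo, a n <= x <= b n) ->
  F (b n) - F (a n) @[n --> \oo] --> l ->
  (\int[leb]_(x in D) (f x)%:E = l%:E)%E.
Proof.
move=> mD fi cf dF ab abD Dab Fl.
have cF : continuous F.
  by move=> x; apply/differentiable_continuous/derivable1_diffP.
have intab n : (\int[leb]_(x in D) (f x * \1_`[a n, b n] x)%:E = (F (b n) - F (a n))%:E)%E.
  rewrite EFinB -(continuous_FTC2 (f := f) (ab n)).
  - rewrite [LHS]integral_mkcond [RHS]integral_mkcond.
    apply: eq_integral => x _; rewrite /patch indicE.
    have [xab|xab] := boolP (x \in `[a n, b n]%classic).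
      have /mem_set -> : D x.
        by apply: (abD n); move: xab; rewrite inE/= in_itv.
      by rewrite mulr1.
    by case: ifP => // _; rewrite mulr0.
  - exact: continuous_subspaceT.
  - split; first by move=> x _; have := dF x; case.
    + exact/cvg_at_right_filter/cF.
    + exact/cvg_at_left_filter/cF.
  - by move=> x _; rewrite derive1E; have := dF x => ?; exact: derive_val.
have mf : measurable_fun D f by apply/measurable_EFinP; exact: measurable_int fi.
have h : (\int[leb]_(x in D) (f x * \1_`[a n, b n] x)%:E)%E @[n --> \oo] -->
    (\int[leb]_(x in D) (f x)%:E)%E.
  apply: (@dominated_cvg _ _ _ leb D mD (fun n x => (f x * \1_`[a n, b n] x)%:E)
    (fun x => (f x)%:E) (fun x => `|f x|%:E)) => //.
  - move=> n; apply/measurable_EFinP; apply: measurable_funM => //.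
  - move=> x Dx; have := Dab x Dx => -[N _ hN]; apply: cvg_near_cst.
    exists N => // n Nn; have := hN n Nn => /= xab.
    by rewrite indicE mem_set ?mulr1//= in_itv.
  - exact: integrable_norm.
  - move=> n x _; rewrite lee_fin normrM ler_piMr// indicE.
    by case: (_ \in _); rewrite ?normr1 ?normr0.
have h2 : (\int[leb]_(x in D) (f x * \1_`[a n, b n] x)%:E)%E @[n --> \oo] --> l%:E.
  rewrite (_ : (fun n => _) = (fun n => (F (b n) - F (a n))%:E)); last exact/funext.
  by apply: cvg_EFin => //; exact: nearW.
exact: cvg_unique h h2.
Qed.

Lemma is_derive_normal_pdf m s x : s != 0 ->
  is_derive x 1 (normal_pdf m s) (- (x - m) / s ^+ 2 * normal_pdf m s x).
Proof.
move=> s0; rewrite normal_pdfE// /normal_fun.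
have d1 : is_derive x 1 (fun x : R => x - m) 1.
  by apply: is_derive_eq; rewrite oppr0 addr0.
have d2 : is_derive x 1 (fun x : R => - (x - m) ^+ 2 / (s ^+ 2 *+ 2)) (- (x - m) / s ^+ 2).
  apply: is_derive_eq; rewrite /GRing.scale/=; field.
  by rewrite s0.
have d3 := @is_derive1_comp R expR (fun x : R => - (x - m) ^+ 2 / (s ^+ 2 *+ 2)) x _ _
  (is_derive_expR _) d2.
apply: (is_derive_eq (@is_deriveZ R R R _ (normal_peak s) x 1 _ d3)).
by rewrite /GRing.scale/= [X in _ * X]mulrC mulrCA.
Qed.

End gaussian.

Lemma integrable_distribution d d' (T : measurableType d) (T' : measurableType d')
    (R : realType) (P : probability T R) (X : {RV P >-> T'}) (f : T' -> \bar R) :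
  measurable_fun setT f -> P.-integrable setT (f \o X) ->
  (distribution P X).-integrable setT f.
Proof.
move=> mf /integrableP[_ fi]; apply/integrableP; split => //.
by rewrite (ge0_integral_distribution X (f := fun x => `|f x|%E))//; exact: measurableT_comp.
Qed.

Section gaussian_moments.
Context (R : realType).
Local Notation leb := (@lebesgue_measure R).
Implicit Types (x s : R) (p : nat).

Let integrable_pow_normal_pdf p s : 0 < s ->
  leb.-integrable setT (fun x => (x ^+ p * normal_pdf 0 s x)%:E).
Proof.
move=> s0; apply/integrableP; split.
  apply/measurable_EFinP; apply: measurable_funM; first exact: measurable_funX.
  exact: measurable_normal_pdf.
apply: le_lt_trans (_ : (\int[leb]_x (`|x - 0| ^+ p * normal_pdf 0 s x)%:E < +oo)%E).
  rewrite le_eqVlt; apply/orP; left; apply/eqP; apply: eq_integral => x _ /=.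
  by rewrite subr0 normrM normrX (ger0_norm (normal_pdf_ge0 _ _ _)).
by rewrite (le_lt_trans (integral_pow_normal_pdf p 0 s0))// ltry.
Qed.

Let ltNn n : - n.+1%:R < n.+1%:R :> R.
Proof. by rewrite -subr_gt0 opprK -natrD ltr0n. Qed.

Let near_within x : \forall n \near \oo, - n.+1%:R <= x <= n.+1%:R.
Proof.
near=> n; rewrite -ler_norml.
have : `|x| <= n%:R by near: n; exact: nbhs_infty_ger.
by move/le_trans; apply; rewrite ler_nat.
Unshelve. all: by end_near. Qed.

Let cpdf s : s != 0 -> continuous (normal_pdf (0 : R) s).
Proof. exact: continuous_normal_pdf. Qed.

Lemma normal_pdf_mean s : 0 < s -> (\int[leb]_x (x * normal_pdf 0 s x)%:E = 0)%E.
Proof.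
move=> s0; have sn0 : s != 0 by rewrite gt_eqF.
apply: (@integral_deriv_exhaustion R _ (fun x => - s ^+ 2 * normal_pdf 0 s x) setT
  (fun n => - n.+1%:R) (fun n => n.+1%:R)) => //.
- apply: eq_integrable (integrable_pow_normal_pdf 1 s0) => //.
- by move=> x; apply: cvgM; [exact: cvg_id|exact: cpdf].
- move=> x; have d := is_derive_normal_pdf 0 x sn0.
  apply: (is_derive_eq (@is_deriveZ R R R _ (- s ^+ 2) x 1 _ d)).
  by rewrite /GRing.scale/= subr0; field.
- rewrite (_ : (fun n => _) = (fun=> 0)); first exact: cvg_cst.
  apply/funext => n; rewrite -mulrBr !normal_pdfE// /normal_fun !subr0 sqrrN.
  by rewrite subrr mulr0.
Qed.

(** n^2 times the density at n is bounded, by [pow_normal_pdf_le] at power 2, so one power of n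
    leaves O(1/n). *)
Let pdf_tail s : 0 < s -> n.+1%:R * normal_pdf 0 s n.+1%:R @[n --> \oo] --> (0 : R).
Proof.
move=> s0; have s20 : 2 * s != 0 by rewrite mulf_neq0// gt_eqF.
pose C : R := 2 * 2`!%:R * expR 1 * s ^+ 2 * normal_peak (2 * s).
apply: (@squeeze_cvgr _ _ _ _ (fun=> 0) (fun n => C * n.+1%:R^-1)).
- apply: nearW => n; rewrite mulr_ge0 ?normal_pdf_ge0//=.
  rewrite ler_pdivlMr ?ltr0n// mulrAC -expr2.
  have := @pow_normal_pdf_le R 2 0 s n.+1%:R s0; rewrite subr0 ger0_norm// => h.
  apply: (le_trans h); rewrite /C ler_wpM2l ?normal_pdf_ub//.
  by rewrite !mulr_ge0 ?expR_ge0 ?exprn_ge0 ?(ltW s0).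
- exact: cvg_cst.
- by rewrite -(mulr0 C); apply: cvgMr; exact: cvg_harmonic.
Qed.

(** The function [g] is the derivative of x times the density, which vanishes at both ends; its
    integral 0 compares the mass 1 with the second moment divided by s^2. *)
Lemma normal_pdf_variance s : 0 < s ->
  (\int[leb]_x (x ^+ 2 * normal_pdf 0 s x)%:E = (s ^+ 2)%:E)%E.
Proof.
move=> s0; have sn0 : s != 0 by rewrite gt_eqF.
pose g x := normal_pdf 0 s x - x ^+ 2 / s ^+ 2 * normal_pdf 0 s x.
have i2 := integrable_pow_normal_pdf 2 s0.
have i0 := integrable_normal_pdf 0 s.
have i2' : leb.-integrable setT (fun x => (s ^- 2)%:E * (x ^+ 2 * normal_pdf 0 s x)%:E)%E.
  exact: integrableZl.
have gE x : (g x)%:E = ((normal_pdf 0 s x)%:E - (s ^- 2)%:E * (x ^+ 2 * normal_pdf 0 s x)%:E)%E.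
  by rewrite -EFinM -EFinB /g mulrA [in RHS](mulrC (s ^- 2)).
have h0 : (\int[leb]_x (g x)%:E = 0%:E)%E.
  apply: (@integral_deriv_exhaustion R _ (fun x => x * normal_pdf 0 s x) setT
    (fun n => - n.+1%:R) (fun n => n.+1%:R)) => //.
  - by apply: eq_integrable (integrableB measurableT i0 i2') => // x _; rewrite /= gE.
  - move=> x; apply: cvgB; first exact: cpdf.
    by apply: cvgM; [apply: cvgMl; exact: exprn_continuous|exact: cpdf].
  - move=> x; have d := is_derive_normal_pdf 0 x sn0.
    have := @is_deriveM R R id (normal_pdf 0 s) x 1 _ _ (is_derive_id x 1) d.
    move=> h; apply: (is_derive_eq h).
    by rewrite /GRing.scale/= subr0 /g; field.
  - rewrite (_ : (fun n => _) = (fun n => 2 * (n.+1%:R * normal_pdf 0 s n.+1%:R))).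
      by rewrite -[X in _ --> X](mulr0 2); apply: cvgMr; exact: pdf_tail.
    apply/funext => n;
    have -> : normal_pdf 0 s (- n.+1%:R) = normal_pdf 0 s n.+1%:R.
      by rewrite !normal_pdfE// /normal_fun !subr0 sqrrN.
    ring.
move: h0; under eq_integral do rewrite gE.
rewrite integralB// integral_normal_pdf integralZl// => h.
have fin2 := integrable_fin_num measurableT i2.
move: h; rewrite -(fineK fin2) -EFinM -EFinB => -[h]; congr (_%:E).
have : s ^- 2 * fine (\int[leb]_x (x ^+ 2 * normal_pdf 0 s x)%:E)%E = 1 by lra.
by move/(congr1 ( *%R (s ^+ 2))); rewrite mulrA divff ?expf_neq0// mul1r mulr1.
Qed.

Section increments.
Context d (T : measurableType d) (P : probability T R).
Context (D : T -> R) (s : R) (mD : measurable_fun setT D) (s0 : 0 < s).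
Context (Dnormal : forall A, measurable A -> P (D @^-1` A) = normal_prob 0 s A).

Let pdf0 x : 0 <= normal_pdf 0 s x. Proof. exact: normal_pdf_ge0. Qed.

Let mD' : measurable_fun setT (D : T -> measurableTypeR R). Proof. exact: mD. Qed.

Let dens := @integral_density _ _ _ T R leb P D mD' (normal_pdf 0 s)
  pdf0 (measurable_normal_pdf 0 s) Dnormal.

Lemma normal_moment k :
  (\int[P]_w (D w ^+ (2 ^ k.+1))%:E <=
    ((2 * (2 ^ k.+1)`!%:R * expR 1) * s ^+ (2 ^ k.+1))%:E)%E.
Proof.
rewrite (dens (f := fun x => x ^+ (2 ^ k.+1))); last exact: measurable_funX.
apply: le_trans (integral_pow_normal_pdf (2 ^ k.+1) 0 s0).
rewrite le_eqVlt; apply/orP; left; apply/eqP; apply: eq_integral => x _.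
by rewrite subr0 normXp.
Qed.

Lemma normal_mean : (\int[P]_w (D w)%:E = 0)%E.
Proof. by rewrite (dens (f := id))// normal_pdf_mean. Qed.

Lemma normal_variance : (\int[P]_w (D w ^+ 2)%:E = (s ^+ 2)%:E)%E.
Proof.
rewrite (dens (f := fun x => x ^+ 2)); last exact: measurable_funX.
exact: normal_pdf_variance.
Qed.

End increments.

End gaussian_moments.

Section independence.
Context d (T : measurableType d) (R : realType) (P : probability T R).

(** The joint law and the product of the laws agree on rectangles, hence everywhere, and Fubini's
    theorem factors the integral of z.1 z.2. *)
Lemma integral_indep (X Y : T -> R) (mX : measurable_fun setT X)
  (mY : measurable_fun setT Y) :
  (forall A B, measurable A -> measurable B ->
    P (X @^-1` A `&` Y @^-1` B) = (P (X @^-1` A) * P (Y @^-1` B))%E) ->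
  P.-integrable setT (EFin \o X) -> P.-integrable setT (EFin \o Y) ->
  P.-integrable setT (fun w => (X w * Y w)%:E) ->
  (\int[P]_w (X w * Y w)%:E = \int[P]_w (X w)%:E * \int[P]_w (Y w)%:E)%E.
Proof.
move=> XY iX iY iXY.
pose Xm : {RV P >-> R} := mfun_Sub (mem_set mX : X \in mfun).
pose Ym : {RV P >-> R} := mfun_Sub (mem_set mY : Y \in mfun).
have mXY : measurable_fun setT (fun w => (X w, Y w)) by exact: measurable_fun_pair.
pose Zm : {RV P >-> (R * R)%type} := mfun_Sub (mem_set mXY : _ \in mfun).
pose m1 : probability _ R := distribution P Xm.
pose m2 : probability _ R := distribution P Ym.
pose f (z : R * R) := (z.1 * z.2)%:E.
have mf : measurable_fun setT f.
  by apply/measurable_EFinP; apply: measurable_funM.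
have prodE A : measurable A -> distribution P Zm A = (m1 \x m2)%E A.
  move=> mA; apply/esym; move: A mA; apply: product_measure_unique => B C mB mC.
  exact: XY.
have fi : (m1 \x m2)%E.-integrable setT f.
  apply/integrableP; split => //.
  rewrite (eq_measure_integral (distribution P Zm)); last first.
    by move=> A mA _; exact/esym/prodE.
  by have /integrableP[] := integrable_distribution (X := Zm) mf iXY.
transitivity (\int[(m1 \x m2)%E]_z f z)%E.
  rewrite (eq_measure_integral (distribution P Zm)); last first.
    by move=> A mA _; exact/esym/prodE.
  by rewrite (integral_distribution (X := Zm)).
rewrite -integral12_prod_meas1//.
have iYf := integrable_fin_num measurableT iY.
have iX1 : m1.-integrable setT EFin by exact: (integrable_distribution (X := Xm)).
have iY2 : m2.-integrable setT EFin by exact: (integrable_distribution (X := Ym)).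
have e1 : (\int[m1]_x x%:E = \int[P]_w (X w)%:E)%E.
  by rewrite (integral_distribution (X := Xm) (f := EFin)).
have e2 : (\int[m2]_x x%:E = \int[P]_w (Y w)%:E)%E.
  by rewrite (integral_distribution (X := Ym) (f := EFin)).
transitivity (\int[m1]_x (x%:E * \int[P]_w (Y w)%:E))%E.
  apply: eq_integral => x _; rewrite /fubini_F -e2 -integralZl//.
by rewrite -(fineK iYf) integralZr// e1.
Qed.

End independence.

(** * Laplace asymptotics in one well *)

Section well.
Context (R : realType).
Local Notation leb := (@lebesgue_measure R).
Local Notation half := `[(0 : R), +oo[%classic.
Implicit Types (x r : R) (p N : nat).

(* The Gibbs weight at temperature r^2, normalised so as to be maximal at the
   bottom of the wells. *)
Definition well r x : R := expR (- ((x ^+ 2 - 1) ^+ 2 / 4) / r ^+ 2).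

Lemma well_ge0 r x : 0 <= well r x. Proof. exact: expR_ge0. Qed.

Lemma is_derive_well r x : r != 0 ->
  is_derive x 1 (well r) (- (x ^+ 3 - x) / r ^+ 2 * well r x).
Proof.
move=> r0.
have d1 : is_derive x 1 (fun x : R => - ((x ^+ 2 - 1) ^+ 2 / 4) / r ^+ 2)
    (- (x ^+ 3 - x) / r ^+ 2).
  by apply: is_derive_eq; rewrite /GRing.scale/=; field.
have := @is_derive1_comp R expR _ x _ _ (is_derive_expR _) d1.
by move=> h; apply: (is_derive_eq h); rewrite mulrC.
Qed.

Lemma continuous_well r : r != 0 -> continuous (well r).
Proof.
move=> r0 x; apply/differentiable_continuous/derivable1_diffP.
by have := is_derive_well x r0; case.
Qed.

Lemma measurable_well r : measurable_fun setT (well r).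
Proof.
apply: measurableT_comp => //; apply: measurable_funM => //.
apply: measurableT_comp => //; apply: measurable_funM => //.
by apply: measurable_funX; apply: measurable_funB => //; apply: measurable_funX.
Qed.

Local Notation sd r := (Num.sqrt 2 * r).

Let sd_gt0 r : 0 < r -> 0 < sd r.
Proof. by move=> r0; rewrite mulr_gt0// sqrtr_gt0. Qed.

Lemma well_le r x : 0 < r -> 0 <= x ->
  well r x <= (normal_peak (sd r))^-1 * normal_pdf 1 (sd r) x.
Proof.
move=> r0 x0; have s0 := sd_gt0 r0.
rewrite normal_pdfE ?gt_eqF// mulrA mulVf ?mul1r; last first.
  by rewrite gt_eqF// normal_peak_gt0// gt_eqF.
rewrite /well /normal_fun ler_expR exprMn sqr_sqrtr//.
rewrite -subr_ge0.
have -> : - (x - 1) ^+ 2 / (2 * r ^+ 2 *+ 2) - - ((x ^+ 2 - 1) ^+ 2 / 4) / r ^+ 2 =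
  ((x - 1) * r^-1) ^+ 2 * (x * (x + 2)) / 4.
  by field; rewrite gt_eqF.
by rewrite divr_ge0// mulr_ge0 ?sqr_ge0// mulr_ge0// addr_ge0.
Qed.

(** The power of r beyond p is the mass of the unnormalised Gaussian; it cancels against the lower
    bound [well_mass] once moments are normalised. *)
Lemma well_moment p : exists2 C, 0 <= C & forall r, 0 < r ->
  (\int[leb]_(x in half) (`|x - 1| ^+ p * well r x)%:E <= (C * r ^+ p.+1)%:E)%E.
Proof.
pose C := Num.sqrt (pi *+ 2) * (2 * p`!%:R * expR 1) * Num.sqrt 2 ^+ p.+1 : R.
exists C; first by rewrite !mulr_ge0 ?expR_ge0 ?sqrtr_ge0 ?exprn_ge0 ?sqrtr_ge0.
move=> r r0; have s0 := sd_gt0 r0.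
have pk : (normal_peak (sd r))^-1 = Num.sqrt (pi *+ 2) * sd r.
  rewrite /normal_peak invrK -mulrnAr sqrtrM ?sqr_ge0// sqrtr_sqr gtr0_norm//.
  by rewrite mulrC.
have pk0 : 0 <= (normal_peak (sd r))^-1.
  by rewrite pk mulr_ge0 ?sqrtr_ge0// ltW.
have m1 : measurable_fun setT (fun x => `|x - 1| ^+ p).
  by apply: measurable_funX; apply: measurableT_comp => //; apply: measurable_funB.
have m2 : measurable_fun setT (fun x => `|x - 1| ^+ p * normal_pdf 1 (sd r) x).
  by apply: measurable_funM => //; exact: measurable_normal_pdf.
apply: le_trans (_ : (\int[leb]_(x in half)
   ((normal_peak (sd r))^-1 * (`|x - 1| ^+ p * normal_pdf 1 (sd r) x))%:E <= _)%E).
  apply: ge0_le_integral => //.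
  - by move=> x _; rewrite lee_fin mulr_ge0 ?exprn_ge0 ?well_ge0.
  - apply/measurable_EFinP/measurable_funTS; apply: measurable_funM => //.
    exact: measurable_well.
  - apply/measurable_EFinP/measurable_funTS; exact: measurable_funM.
  - move=> x; rewrite /= in_itv/= andbT => x0.
    by rewrite lee_fin mulrCA ler_wpM2l ?exprn_ge0// well_le.
apply: le_trans (_ : (\int[leb]_x
   ((normal_peak (sd r))^-1 * (`|x - 1| ^+ p * normal_pdf 1 (sd r) x))%:E <= _)%E).
  apply: ge0_subset_integral => //.
  - by apply/measurable_EFinP; exact: measurable_funM.
  - by move=> x _; rewrite lee_fin mulr_ge0// mulr_ge0 ?exprn_ge0 ?normal_pdf_ge0.
under eq_integral do rewrite EFinM.
rewrite ge0_integralZl_EFin//; last 2 first.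
- by move=> x _; rewrite lee_fin mulr_ge0 ?exprn_ge0 ?normal_pdf_ge0.
- exact/measurable_EFinP.
apply: le_trans (lee_wpmul2l _ (integral_pow_normal_pdf p 1 s0)) _.
  by rewrite lee_fin.
rewrite -EFinM lee_fin pk /C [(sd r) ^+ p]exprMn !exprS le_eqVlt.
by apply/orP; left; apply/eqP; ring.
Qed.

Lemma integrable_well (f : R -> R) p r (C : R) : 0 < r -> measurable_fun setT f ->
  (forall x, 0 <= x -> `|f x| <= C * `|x - 1| ^+ p) ->
  leb.-integrable half (fun x => (f x * well r x)%:E).
Proof.
move=> r0 mf fC; have [K K0 hK] := well_moment p.
have mw := measurable_well r.
have mx : measurable_fun setT (fun x => `|x - 1| ^+ p).
  by apply: measurable_funX; apply: measurableT_comp => //; apply: measurable_funB.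
have ip : leb.-integrable half (fun x => `|C|%:E * (`|x - 1| ^+ p * well r x)%:E)%E.
  apply: integrableZl => //; apply/integrableP; split.
    by apply/measurable_EFinP/measurable_funTS; exact: measurable_funM.
  apply: le_lt_trans (_ : (K * r ^+ p.+1)%:E < +oo)%E; last exact: ltry.
  apply: le_trans (hK r r0).
  rewrite le_eqVlt; apply/orP; left; apply/eqP; apply: eq_integral => x _.
  by rewrite gee0_abs// lee_fin mulr_ge0 ?well_ge0// exprn_ge0.
apply: le_integrable ip => //.
  by apply/measurable_EFinP/measurable_funTS; exact: measurable_funM.
move=> x; rewrite /= in_itv/= andbT => x0.
rewrite lee_fin !normrM normr_id (ger0_norm (well_ge0 _ _)) mulrA ler_wpM2r ?well_ge0//.
by rewrite (le_trans (fC x x0))// normrX normr_id ler_wpM2r ?exprn_ge0// ler_norm.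
Qed.

Definition well_int r (f : R -> R) : R := \int[leb]_(x in half) (f x * well r x).

Lemma well_int_le (f : R -> R) p r (C K : R) : 0 < r -> 0 <= C ->
  measurable_fun setT f -> (forall x, 0 <= x -> `|f x| <= C * `|x - 1| ^+ p) ->
  (forall r, 0 < r ->
  (\int[leb]_(x in half) (`|x - 1| ^+ p * well r x)%:E <= (K * r ^+ p.+1)%:E)%E) ->
  `|well_int r f| <= C * (K * r ^+ p.+1).
Proof.
move=> r0 C0 mf fC hK.
have ifw := integrable_well r0 mf fC.
apply: le_trans (le_normr_Rintegral _ ifw) _ => //.
rewrite -lee_fin /Rintegral fineK; last first.
  have : leb.-integrable half (EFin \o (fun x => `|f x * well r x|)) by exact: integrable_norm.
  exact: integrable_fin_num.
rewrite EFinM; apply: le_trans (lee_wpmul2l _ (hK r r0)); last by rewrite lee_fin.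
have mx : measurable_fun setT (fun x => `|x - 1| ^+ p * well r x).
  apply: measurable_funM; last exact: measurable_well.
  by apply: measurable_funX; apply: measurableT_comp => //; apply: measurable_funB.
rewrite -ge0_integralZl_EFin//; last 2 first.
- by move=> x _; rewrite lee_fin mulr_ge0 ?well_ge0// exprn_ge0.
- exact/measurable_EFinP/measurable_funTS.
apply: ge0_le_integral => //.
- apply/measurable_EFinP/measurable_funTS; apply: measurableT_comp => //.
  by apply: measurable_funM => //; exact: measurable_well.
- by apply/measurable_EFinP/measurable_funTS; exact: measurable_funM.
move=> x; rewrite /= in_itv/= andbT => x0.
rewrite lee_fin normrM (ger0_norm (well_ge0 _ _)) mulrA ler_wpM2r ?well_ge0//.
exact: fC.
Qed.

Lemma well_mass : exists2 c, 0 < c & forall r, 0 < r <= 1 -> c * r <= well_int r (fun=> 1).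
Proof.
(* On [1, 1 + r] one has (x - 1)^2 <= r^2, and (x + 1)^2 <= 9 because r <= 1; the weight is thus at
   least exp(-9/4) on an interval of length r. *)
exists (expR (- (9 / 4))); first exact: expR_gt0.
move=> r /andP[r0 r1].
have i1 : leb.-integrable half (fun x => (1 * well r x)%:E).
  by apply: (@integrable_well (fun=> 1) 0 r 1) => // x _; rewrite normr1 mulr1.
rewrite -lee_fin /well_int /Rintegral fineK; last exact: integrable_fin_num.
pose D : set R := `[1, 1 + r]%classic.
have mD : measurable D by exact: measurable_itv.
apply: le_trans (_ : (\int[leb]_(x in D) (1 * well r x)%:E <= _)%E); last first.
  apply: ge0_subset_integral => //.
  - apply/measurable_EFinP/measurable_funTS; apply: measurable_funM => //.
    exact: measurable_well.
  - by move=> x _; rewrite lee_fin mul1r well_ge0.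
  - by move=> x; rewrite /D /= !in_itv/= andbT => /andP[x1 _]; exact: le_trans x1.
apply: le_trans (_ : (\int[leb]_(x in D) (expR (- (9 / 4)))%:E <= _)%E).
  rewrite integral_cst//= lebesgue_measure_itv/= lte_fin ltrDl r0.
  by rewrite -EFinB -EFinM lee_fin (addrC 1) addrK.
apply: ge0_le_integral => //.
  apply/measurable_EFinP/measurable_funTS; apply: measurable_funM => //.
  exact: measurable_well.
move=> x; rewrite /D/= in_itv/= => /andP[x1 xr].
rewrite lee_fin mul1r /well ler_expR mulNr lerN2 ler_pdivrMr ?exprn_gt0//.
have -> : (x ^+ 2 - 1) ^+ 2 = (x - 1) ^+ 2 * (x + 1) ^+ 2 by ring.
have h1 : (x - 1) ^+ 2 <= r ^+ 2 by rewrite lerXn2r ?nnegrE ?subr_ge0//; lra.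
have h2 : (x + 1) ^+ 2 <= 9 by nra.
by have := sqr_ge0 (x - 1); have := sqr_ge0 (x + 1); nra.
Qed.

End well.

Section well_moments.
Context (R : realType).
Local Notation leb := (@lebesgue_measure R).
Local Notation half := `[(0 : R), +oo[%classic.
Implicit Types (x r : R) (p N : nat).

Local Notation pow p := (fun x : R => (x - 1) ^+ p).

Lemma measurable_pow_shift p : measurable_fun setT (pow p).
Proof. by apply: measurable_funX; apply: measurable_funB. Qed.

Lemma continuous_pow_shift p : continuous (pow p).
Proof.
move=> x; apply/differentiable_continuous/derivable1_diffP.
by have [] := is_derive_pow_shift 1 p x.
Qed.

Lemma integrable_pow_well p r : 0 < r ->
  leb.-integrable half (fun x => ((x - 1) ^+ p * well r x)%:E).
Proof.
move=> r0; apply: (@integrable_well R (pow p) p r 1) => //.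
  exact: measurable_pow_shift.
by move=> x _; rewrite mul1r normrX.
Qed.

Lemma pow_well_cvg0 p r : 0 < r ->
  (n.+2%:R - 1) ^+ p * well r n.+2%:R @[n --> \oo] --> (0 : R).
Proof.
move=> r0.
have s0 : 0 < Num.sqrt 2 * r by rewrite mulr_gt0// sqrtr_gt0.
set s := Num.sqrt 2 * r in s0.
have pk0 : 0 <= (normal_peak s)^-1 by rewrite invr_ge0 normal_peak_ge0.
pose C : R := (normal_peak s)^-1 * (2 * p.+1`!%:R * expR 1 * s ^+ p.+1 * normal_peak (2 * s)).
have s20 : 2 * s != 0 by rewrite mulf_neq0// gt_eqF.
apply: (@squeeze_cvgr _ _ _ _ (fun=> 0) (fun n => C * n.+1%:R^-1)).
- apply: nearW => n.
  have -> : n.+2%:R - 1 = n.+1%:R :> R by rewrite -natr1 addrK.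
  rewrite mulr_ge0 ?well_ge0//= ler_pdivlMr ?ltr0n// mulrAC -exprSr.
  apply: le_trans (_ : n.+1%:R ^+ p.+1 * ((normal_peak s)^-1 * normal_pdf 1 s n.+2%:R) <= _).
    by rewrite ler_wpM2l ?exprn_ge0// well_le.
  rewrite mulrCA /C ler_wpM2l//.
  have := @pow_normal_pdf_le R p.+1 1 s n.+2%:R s0.
  rewrite -natr1 addrK ger0_norm// => /le_trans; apply.
  rewrite ler_wpM2l ?normal_pdf_ub//.
  by rewrite !mulr_ge0 ?expR_ge0 ?exprn_ge0 ?(ltW s0).
- exact: cvg_cst.
- by rewrite -(mulr0 C); apply: cvgMr; exact: cvg_harmonic.
Qed.

(* Integration by parts against the generator applied to (x - 1)^p; the
   boundary term at the origin is exponentially small. *)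
Lemma well_int_recurrence p r : 0 < r ->
  well_int r (pow p.+3) + 3 * well_int r (pow p.+2) + 2 * well_int r (pow p.+1)
  = r ^+ 2 * (p%:R * well_int r (pow p.-1)) + r ^+ 2 * ((-1) ^+ p * well r 0).
Proof.
move=> r0; have rn0 : r != 0 by rewrite gt_eqF.
(* With y = x - 1, V'(x) = x^3 - x = y^3 + 3 y^2 + 2 y, whence the coefficients 1, 3, 2; [f] is the
   derivative of y^p times the weight. *)
pose f x := p%:R * ((x - 1) ^+ p.-1 * well r x) - r ^- 2 *
  ((x - 1) ^+ p.+3 * well r x + 3 * ((x - 1) ^+ p.+2 * well r x)
   + 2 * ((x - 1) ^+ p.+1 * well r x)).
have ip q := integrable_pow_well q r0.
have mh : @measurable _ (measurableTypeR R) half by exact: measurable_itv.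
have iZ (c : R) q : leb.-integrable half (fun x => (c * ((x - 1) ^+ q * well r x))%:E).
  by apply: eq_integrable (integrableZl mh c (ip q)).
have iS1 : leb.-integrable half
    (fun x => ((x - 1) ^+ p.+3 * well r x + 3 * ((x - 1) ^+ p.+2 * well r x))%:E).
  by apply: eq_integrable (integrableD mh (ip p.+3) (iZ 3 p.+2)).
have iS : leb.-integrable half (fun x => ((x - 1) ^+ p.+3 * well r x + 3 * ((x - 1) ^+ p.+2 * well r x)
   + 2 * ((x - 1) ^+ p.+1 * well r x))%:E).
  by apply: eq_integrable (integrableD mh iS1 (iZ 2 p.+1)).
have iSZ : leb.-integrable half (fun x => (r ^- 2 * ((x - 1) ^+ p.+3 * well r x + 3 * ((x - 1) ^+ p.+2 * well r x)
   + 2 * ((x - 1) ^+ p.+1 * well r x)))%:E).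
  by apply: eq_integrable (integrableZl mh (r ^- 2) iS).
have fi : leb.-integrable half (EFin \o f).
  by apply: eq_integrable (integrableB mh (iZ p%:R p.-1) iSZ).
have h : (\int[leb]_(x in half) (f x)%:E = (- ((-1) ^+ p * well r 0))%:E)%E.
  apply: (@integral_deriv_exhaustion R _ (fun x => (x - 1) ^+ p * well r x) half
    (fun n => 0) (fun n => n.+2%:R)) => //.
  - move=> x; have cM q : {for x, continuous (fun x => (x - 1) ^+ q * well r x)}.
      apply: cvgM; first exact: continuous_pow_shift.
      exact: continuous_well.
    have cZ (c : R) q : {for x, continuous (fun x => c * ((x - 1) ^+ q * well r x))}.
      by apply: cvgMr; exact: cM.
    rewrite /f; apply: cvgB; first exact: cZ.
    apply: cvgMr; apply: cvgD; last exact: cZ.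
    by apply: cvgD; [exact: cM|exact: cZ].
  - move=> x; have := @is_deriveM R R (pow p) (well r) x 1 _ _
      (is_derive_pow_shift 1 p x) (is_derive_well x rn0).
    move=> h; apply: (is_derive_eq h).
    by rewrite /GRing.scale/= /f !exprSr; field; exact: rn0.
  - by move=> n x /andP[x0 _]; rewrite /= in_itv/= x0.
  - move=> x; rewrite /= in_itv/= andbT => x0.
    near=> n; rewrite x0/=.
    have : x <= n%:R by near: n; exact: nbhs_infty_ger.
    by move/le_trans; apply; rewrite ler_nat; exact: leqW.
  - rewrite sub0r -[X in _ --> X]sub0r; apply: cvgB; last exact: cvg_cst.
    exact: pow_well_cvg0.
move/(congr1 fine): h.
rewrite /= -[LHS]/(\int[leb]_(x in half) f x) /f.
have eZ (c : R) q : \int[leb]_(x in half) (c * ((x - 1) ^+ q * well r x)) =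
    c * well_int r (pow q).
  exact: (@RintegralZl _ _ _ leb half (fun x => (x - 1) ^+ q * well r x) c mh (ip q)).
rewrite (@RintegralB _ _ _ leb half _ _ mh (iZ p%:R p.-1) iSZ) eZ.
rewrite (@RintegralZl _ _ _ leb half _ (r ^- 2) mh iS).
rewrite (@RintegralD _ _ _ leb half _ _ mh iS1 (iZ 2 p.+1)) eZ.
rewrite (@RintegralD _ _ _ leb half _ _ mh (ip p.+3) (iZ 3 p.+2)) eZ.
rewrite -!/(well_int r _).
set A := well_int _ _; set B := well_int _ _; set C := well_int _ _; set D := well_int _ _.
move=> e.
have -> : (-1) ^+ p * well r 0 = - (p%:R * A - r ^- 2 * (B + 3 * C + 2 * D)).
  by rewrite e opprK.
by field.
Unshelve. all: by end_near. Qed.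

Definition well_mom p r : R := well_int r (pow p) / well_int r (fun=> 1).

Lemma well_mass_gt0 r : 0 < r <= 1 -> 0 < well_int r (fun=> 1).
Proof.
move=> r01; have [c c0 hc] := well_mass R; apply: lt_le_trans (hc r r01).
by case/andP: r01 => r0 _; rewrite mulr_gt0.
Qed.

Lemma well_ratio_le (f : R -> R) p (C : R) : 0 <= C ->
  measurable_fun setT f -> (forall x, 0 <= x -> `|f x| <= C * `|x - 1| ^+ p) ->
  exists2 K, 0 <= K & forall r, 0 < r <= 1 ->
    `|well_int r f / well_int r (fun=> 1)| <= K * r ^+ p.
Proof.
move=> C0 mf fC.
have [K K0 hK] := well_moment R p; have [c c0 hc] := well_mass R.
exists (C * K / c); first by rewrite divr_ge0 ?(ltW c0)// mulr_ge0.
move=> r r01; have m0 := well_mass_gt0 r01; have hcr := hc r r01.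
case/andP: r01 => r0 r1.
rewrite normrM normfV (gtr0_norm m0) ler_pdivrMr//.
apply: le_trans (well_int_le r0 C0 mf fC hK) _.
have -> : C * (K * r ^+ p.+1) = C * K / c * r ^+ p * (c * r).
  by rewrite exprS; field; rewrite gt_eqF.
rewrite ler_wpM2l//.
by rewrite !mulr_ge0 ?invr_ge0 ?exprn_ge0 ?(ltW c0) ?(ltW r0).
Qed.

Lemma well_mom_le p : exists2 K, 0 <= K & forall r, 0 < r <= 1 ->
  `|well_mom p r| <= K * r ^+ p.
Proof.
apply: (@well_ratio_le (pow p) p 1) => //; first exact: measurable_pow_shift.
by move=> x _; rewrite mul1r normrX.
Qed.

Lemma well_mom0 r : 0 < r <= 1 -> well_mom 0 r = 1.
Proof.
move=> r01; have m0 := well_mass_gt0 r01.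
rewrite /well_mom (_ : pow 0 = fun=> 1); first by rewrite divff// gt_eqF.
by apply/funext => x; rewrite expr0.
Qed.

(** exp(-1/z) <= N! z^N at z = 4 r^2: the barrier height 1/4 makes the weight at the origin smaller
    than any power of r, including the 1/r lost in dividing by the mass. *)
Lemma well0_small N : exists2 K, 0 <= K & forall r, 0 < r <= 1 ->
  r ^+ 2 * well r 0 / well_int r (fun=> 1) <= K * r ^+ N.
Proof.
have [c c0 hc] := well_mass R.
exists (N`!%:R * 4 ^+ N / c); first by rewrite divr_ge0 ?(ltW c0).
move=> r r01; have m0 := well_mass_gt0 r01; have hcr := hc r r01.
case/andP: r01 => r0 r1.
have w0 : well r 0 <= N`!%:R * (4 * r ^+ 2) ^+ N.
  have h := @pow_le_fact_expR R N ((4 * r ^+ 2)^-1) _.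
  have -> : well r 0 = (expR ((4 * r ^+ 2)^-1))^-1.
    rewrite -expRN /well; congr expR; field; exact: lt0r_neq0.
  have z0 : 0 < 4 * r ^+ 2 by rewrite mulr_gt0// exprn_gt0.
  rewrite -div1r ler_pdivrMr ?expR_gt0// mulrAC -ler_pdivrMr ?exprn_gt0//.
  by rewrite div1r -exprVn; apply: h; rewrite invr_ge0 ltW.
rewrite ler_pdivrMr//.
apply: le_trans (_ : N`!%:R * 4 ^+ N / c * r ^+ N * (c * r) <= _); last first.
  by rewrite ler_wpM2l// !mulr_ge0 ?invr_ge0 ?exprn_ge0 ?(ltW c0) ?(ltW r0).
apply: le_trans (_ : r ^+ 2 * (N`!%:R * (4 * r ^+ 2) ^+ N) <= _).
  by rewrite ler_wpM2l// sqr_ge0.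
have -> : N`!%:R * 4 ^+ N / c * r ^+ N * (c * r) = N`!%:R * 4 ^+ N * r ^+ N.+1.
  by rewrite exprS; field; rewrite gt_eqF.
have -> : r ^+ 2 * (N`!%:R * (4 * r ^+ 2) ^+ N) = N`!%:R * 4 ^+ N * r ^+ (2 + 2 * N).
  by rewrite exprMn exprD exprM; ring.
rewrite ler_wpM2l ?mulr_ge0 ?exprn_ge0// ler_wiXn2l ?(ltW r0)//; lia.
Qed.

Lemma well_mom_recurrence p N : exists2 K, 0 <= K & forall r, 0 < r <= 1 ->
  `|2 * well_mom p.+1 r - (r ^+ 2 * (p%:R * well_mom p.-1 r)
     - 3 * well_mom p.+2 r - well_mom p.+3 r)| <= K * r ^+ N.
Proof.
have [K K0 hK] := well0_small N; exists K => // r r01.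
have m0 := well_mass_gt0 r01; have := hK r r01.
case/andP: r01 => r0 r1.
have := well_int_recurrence p r0; rewrite /well_mom.
set I0 := well_int r (fun=> 1) in m0 *.
set A := well_int r _; set B := well_int r _; set C := well_int r _; set D := well_int r _.
move=> e h.
have -> : 2 * (C / I0) - (r ^+ 2 * (p%:R * (D / I0)) - 3 * (B / I0) - A / I0) =
   (-1) ^+ p * (r ^+ 2 * well r 0 / I0).
  have -> : A = r ^+ 2 * (p%:R * D) + r ^+ 2 * ((-1) ^+ p * well r 0) - 3 * B - 2 * C.
    by rewrite -e; ring.
  by field; rewrite gt_eqF.
rewrite normrMsign ger0_norm// divr_ge0 ?(ltW m0)//.
by rewrite mulr_ge0 ?well_ge0// sqr_ge0.
Qed.

End well_moments.

Section well_expansion.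
Context (R : realType).
Implicit Types (r : R) (p N m : nat).

(** Extends the recurrence to all indices, so that it can be summed over m. The guard is essential:
    for m < 2 the truncated [m - 2] is 0, and at p = 1 the unguarded term would be c_{0,0} = 1. *)
Lemma limit_coef_recurrence m p :
  2 * limit_coef R m p.+1 =
    (if (2 <= m)%N then p%:R * limit_coef R (m - 2) p.-1 else 0)
    - 3 * limit_coef R m p.+2 - limit_coef R m p.+3.
Proof.
have [mp|mp] := ltnP m p.+1.
  have z i : (m < i)%N -> limit_coef R m i = 0 by exact: limit_coef_gt.
  rewrite (z p.+1)// (z p.+2)//; last by lia.
  rewrite (z p.+3); last by lia.
  case: ifP => m2; last by rewrite !mulr0 !subr0.
  by rewrite limit_coef_gt ?mulr0 ?subr0//; lia.
rewrite limit_coefE//= subSS subn1; case: ifPn => // m2.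
have -> : p = 0%N by lia.
by rewrite mul0r.
Qed.

(** Induction on 2N - p: the moments satisfy, up to O(r^(N+1)), the recursion obeyed by the
    truncated series. Both N and p vary, because the term carrying r^2 lowers p + 1 to p - 1 and
    allows the order N to drop by 2. For p > N every coefficient vanishes and the moment is itself
    of the size of the error. *)
Lemma well_mom_expansion N p : exists2 K, 0 <= K & forall r, 0 < r <= 1 ->
  `|well_mom p r - \sum_(m < N.+1) r ^+ m * limit_coef R m p| <= K * r ^+ N.+1.
Proof.
have [k] := ubnP (2 * N - p)%N; elim: k N p => // k IH N p hk.
have [pN|pN] := ltnP N p.
  have [K K0 hK] := well_mom_le R p; exists K => // r r01.
  rewrite big1 => [|m _]; last by rewrite limit_coef_gt ?mulr0//; have := ltn_ord m; lia.
  rewrite subr0 (le_trans (hK r r01))// ler_wpM2l//.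
  by case/andP: r01 => r0 r1; rewrite ler_wiXn2l// ltW.
have [p0|p0] := posnP p.
  exists 0 => // r r01.
  rewrite p0 well_mom0// big_ord_recl big1 => [|m _]; last by rewrite limit_coef0 mulr0.
  by rewrite expr0 limit_coef0 mul1r addr0 subrr normr0 mul0r.
case: p p0 hk pN => // p _ hk pN.
have [K1 K10 h1] := IH N p.+2 ltac:(lia).
have [K2 K20 h2] := IH N p.+3 ltac:(lia).
have [K3 K30 h3] := well_mom_recurrence R p N.+1.
have [K4 K40 h4] : exists2 K, 0 <= K & forall r, 0 < r <= 1 ->
  `|r ^+ 2 * (p%:R * well_mom p.-1 r) - \sum_(m < N.+1) r ^+ m *
     (if (2 <= m)%N then p%:R * limit_coef R (m - 2) p.-1 else 0)| <= K * r ^+ N.+1.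
  have [p0|p0] := posnP p.
    exists 0 => // r _; rewrite p0 mul0r mulr0 sub0r big1 ?oppr0 ?normr0 ?mul0r// => m _.
    by case: ifP => _; rewrite ?mul0r mulr0.
  (* Here p >= 1 and p + 1 <= N, so N >= 2; the factor r^2 compensates for expanding at order N -
     2. *)
  have [N' NN] : exists N', N = N'.+2 by exists N.-2; lia.
  have [K K0 hK] := IH N' p.-1 ltac:(lia).
  exists (p%:R * K); first by rewrite mulr_ge0.
  move=> r r01; have h := hK r r01; case/andP: r01 => r0 r1.
  rewrite NN [X in _ - X](_ : _ =
    r ^+ 2 * (p%:R * \sum_(m < N'.+1) r ^+ m * limit_coef R m p.-1)); last first.
    rewrite 2!big_ord_recl [X in X + _]mulr0 [X in _ + (X + _)]mulr0 !add0r.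
    rewrite !mulr_sumr; apply: eq_bigr => i _.
    rewrite !lift0 (_ : (2 <= i.+2)%N = true)// -addn2 addnK exprD; ring.
  rewrite -mulrBr -mulrBr.
  rewrite (normrM (r ^+ 2)) (ger0_norm (sqr_ge0 r)) normrM (ger0_norm (ler0n _ _)).
  have -> : p%:R * K * r ^+ N'.+3 = r ^+ 2 * (p%:R * (K * r ^+ N'.+1)).
    by rewrite !exprS; ring.
  by rewrite ler_wpM2l ?sqr_ge0// ler_wpM2l.
exists ((K3 + K4 + 3 * K1 + K2) / 2); first by rewrite divr_ge0// !addr_ge0// mulr_ge0.
move=> r r01.
have := h1 r r01; have := h2 r r01; have := h3 r r01; have := h4 r r01.
set S0 := \sum_(m < N.+1) r ^+ m * limit_coef R m p.+1.
set S1 := \sum_(m < N.+1) r ^+ m * limit_coef R m p.+2.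
set S2 := \sum_(m < N.+1) r ^+ m * limit_coef R m p.+3.
set S4 := \sum_(m < N.+1) r ^+ m * (if _ then _ else _).
have -> : S0 = (S4 - 3 * S1 - S2) / 2.
  rewrite /S4 /S1 /S2 mulr_sumr -!sumrB mulr_suml; apply: eq_bigr => m _.
  have := limit_coef_recurrence m p => e.
  have -> : limit_coef R m p.+1 = (2 * limit_coef R m p.+1) / 2 by field.
  by rewrite e; field.
set X := r ^+ 2 * _; set A := well_mom p.+1 r; set B := well_mom p.+2 r; set C := well_mom p.+3 r.
move=> h4' h3' h2' h1'.
have -> : A - (S4 - 3 * S1 - S2) / 2 = ((2 * A - (X - 3 * B - C)) + (X - S4) - 3 * (B - S1) - (C - S2)) / 2.
  by field.
rewrite normrM [`|2^-1|]ger0_norm// mulrAC ler_wpM2r//.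
have h3B : `|3 * (B - S1)| <= 3 * (K1 * r ^+ N.+1) by rewrite normrM ger0_norm// ler_wpM2l.
have -> : (K3 + K4 + 3 * K1 + K2) * r ^+ N.+1 = K3 * r ^+ N.+1 + K4 * r ^+ N.+1 +
   3 * (K1 * r ^+ N.+1) + K2 * r ^+ N.+1 by ring.
apply: le_trans (ler_normB _ _) _; apply: lerD => //.
apply: le_trans (ler_normB _ _) _; apply: lerD => //.
by apply: le_trans (ler_normD _ _) _; apply: lerD.
Qed.

End well_expansion.

(** * Expansion of the Gibbs integral *)

Section taylor_growth.
Context (R : realType).

(** The first power rules near [a], the second one far away, where the growth of the last derivative
    takes over. The real exponent q is rounded up to a natural number [Q], so that the moments of
    the well apply. *)
Lemma taylor_growth n (F : R -> R) : C_k n.+1 F -> poly_growth n.+1 F ->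
  exists C : R, exists Q : nat, 0 <= C /\ forall a b : R, `|a| = 1 ->
  `|F b - \sum_(i < n.+1) F^`(i)%classic a / i`!%:R * (b - a) ^+ i|
    <= C * (`|b - a| ^+ n.+1 + `|b - a| ^+ (n.+1 + Q)).
Proof.
move=> [dF _] [q [C [q0 C0 bF]]].
pose Q := (Num.truncn q).+1.
have qQ : q <= Q%:R by rewrite ltW// truncnS_gt.
exists (2 * C * 2 ^+ Q * 2), Q; split.
  by rewrite !mulr_ge0 ?exprn_ge0 ?(ltW C0).
move=> a b a1; set y := `|b - a|.
have y0 : 0 <= y := normr_ge0 _.
have hM x : `|x - a| <= y -> `|F^`(n.+1)%classic x| <= 2 * C * 2 ^+ Q * 2 * (1 + y ^+ Q).
  move=> xa; apply: le_trans (bF n.+1 (leqnn _) x) _.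
  have x1 : `|x| <= 1 + y.
    by rewrite -(subrK a x) (le_trans (ler_normD _ _))// a1 addrC lerD2l.
  have xq : `|x| `^ q <= (1 + y) ^+ Q.
    apply: le_trans (_ : (1 + y) `^ q <= _).
      by apply: ge0_ler_powR => //; rewrite ?nnegrE ?addr_ge0// ltW.
    rewrite -powR_mulrn ?addr_ge0//.
    by apply: ler_powR => //; rewrite lerDl.
  have h1 : (1 + y) ^+ Q <= 2 ^+ Q * (1 + y ^+ Q).
    have [yl|yl] := leP y 1.
      apply: le_trans (_ : 2 ^+ Q <= _).
        by rewrite lerXn2r ?nnegrE ?addr_ge0//; lra.
      by rewrite ler_peMr ?exprn_ge0// lerDl exprn_ge0.
    apply: le_trans (_ : (2 * y) ^+ Q <= _).
      by rewrite lerXn2r ?nnegrE ?addr_ge0 ?mulr_ge0//; lra.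
    by rewrite exprMn ler_wpM2l ?exprn_ge0// lerDr.
  have h2 : 1 <= 2 ^+ Q * (1 + y ^+ Q).
    rewrite -[X in X <= _]mulr1 ler_pM// ?exprn_ege1//; first by lra.
    by rewrite lerDl exprn_ge0.
  set Z := 2 ^+ Q * (1 + y ^+ Q) in h1 h2.
  have -> : 2 * C * 2 ^+ Q * 2 * (1 + y ^+ Q) = C * (4 * Z) by rewrite /Z; ring.
  rewrite ler_wpM2l ?(ltW C0)//; lra.
apply: le_trans (taylor_bound dF hM) _.
by rewrite -/y exprD le_eqVlt; apply/orP; left; apply/eqP; ring.
Qed.

End taylor_growth.

Section gibbs_expansion.
Context (R : realType).
Local Notation leb := (@lebesgue_measure R).
Local Notation half := `[(0 : R), +oo[%classic.
Implicit Types (x r : R) (p N m n : nat) (F : R -> R).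

Let mhalf : @measurable _ (measurableTypeR R) half.
Proof. exact: measurable_itv. Qed.

(** Folds the left half-line onto the right one. The Gibbs weight being even, only the well at 1 has
    to be analysed, for F(x) and for F(-x). *)
Lemma integral_halves (g : R -> R) : measurable_fun setT g ->
  leb.-integrable half (EFin \o g) ->
  leb.-integrable half (fun x => (g (- x))%:E) ->
  (\int[leb]_x (g x)%:E = \int[leb]_(x in half) (g x)%:E + \int[leb]_(x in half) (g (- x))%:E)%E.
Proof.
move=> mg ig igN.
pose neg : set R := `]-oo, 0[%classic.
have mneg : @measurable _ (measurableTypeR R) neg by exact: measurable_itv.
have mgE : measurable_fun setT (EFin \o g) by exact/measurable_EFinP.
have mN : @measurable_fun _ _ (measurableTypeR R) (measurableTypeR R) setT (-%R).
  exact: oppr_measurable.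
rewrite -(setUv half) setCitvr -/neg integral_setU//; last 2 first.
- exact: measurable_funTS.
- by apply/disj_setPS => x []; rewrite /neg/= !in_itv/= andbT => x0 /(le_lt_trans x0); rewrite ltxx.
congr (_ + _)%E.
(* The endpoint 0, of measure zero, is dropped so that the reflection exchanges two open
   half-lines. *)
rewrite -(integral_itv_obnd_cbnd (r := 0) (b := +oo%O)); last first.
  by apply/measurable_EFinP/measurable_funTS; exact: measurableT_comp.
pose pos : set R := `]0, +oo[%classic.
have posE : pos = (-%R : R -> measurableTypeR R) @^-1` neg.
  by apply/seteqP; split => x; rewrite /pos /neg/= !in_itv/= andbT oppr_lt0.
have ipos : leb.-integrable pos (fun x => (g (- x))%:E).
  apply: integrableS igN => //; first by exact: measurable_itv.
  by move=> x; rewrite /pos/= !in_itv/= !andbT => /ltW.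
rewrite (@eq_measure_integral _ _ _ _ (pushforward leb (-%R : R -> measurableTypeR R))); last first.
  by move=> A mA _; exact/esym/lebesgue_measureN.
rewrite (@integral_pushforward _ _ _ _ R _ mN leb neg (EFin \o g))//; last first.
  by rewrite -posE.
by rewrite -posE.
Qed.

Lemma C_k_continuous n F : C_k n.+1 F -> continuous F.
Proof.
move=> [dF _] x; apply/differentiable_continuous/derivable1_diffP.
exact: (dF 0%N).
Qed.

Lemma well_even r x : well r (- x) = well r x.
Proof. by rewrite /well sqrrN. Qed.

(** V(x) = (x^2 - 1)^2 / 4 - 1/4; the factor coming from the minimum -1/4 cancels against the
    partition function. *)
Lemma double_well_weight r x : r != 0 ->
  expR (- double_well x / r ^+ 2) = expR ((4 * r ^+ 2)^-1) * well r x.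
Proof.
by move=> r0; rewrite /well -expRD /double_well; congr expR; field.
Qed.

Lemma partition_functionE r : 0 < r ->
  partition_function (r ^+ 2) = expR ((4 * r ^+ 2)^-1) * (2 * well_int r (fun=> 1)).
Proof.
move=> r0; have rn0 : r != 0 by rewrite gt_eqF.
have iw : leb.-integrable half (EFin \o well r).
  have := @integrable_well R (fun=> 1) 0 r 1 r0 _ _.
  have h1 : forall x : R, 0 <= x -> `|(1 : R)| <= 1 * `|x - 1| ^+ 0.
    by move=> x _; rewrite normr1 mulr1.
  move=> /(_ (measurable_cst _) h1) h; apply: eq_integrable h => // x _.
  by rewrite /= mul1r.
rewrite /partition_function /Rintegral.
under eq_integral do rewrite double_well_weight// EFinM.
rewrite ge0_integralZl_EFin ?expR_ge0//; last 2 first.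
- by move=> x _; rewrite lee_fin well_ge0.
- by apply/measurable_EFinP; exact: measurable_well.
rewrite integral_halves//; last 2 first.
- exact: measurable_well.
- by apply: eq_integrable iw => // x _; rewrite /= well_even.
under [X in (_ + X)%E]eq_integral do rewrite well_even.
rewrite /well_int /Rintegral; under [in RHS]eq_integral do rewrite mul1r.
have := integrable_fin_num mhalf iw.
move/fineK => <-; rewrite -EFinD -EFinM/= -mulr2n; congr (_ * _).
by rewrite mulr_natl.
Qed.

Lemma gibbs_pdfE r x : 0 < r <= 1 ->
  gibbs_pdf (r ^+ 2) x = well r x / (2 * well_int r (fun=> 1)).
Proof.
move=> r01; have I0 := well_mass_gt0 r01; case/andP: r01 => r0 _.
rewrite /gibbs_pdf partition_functionE// double_well_weight ?gt_eqF//.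
field; rewrite !gt_eqF ?expR_gt0//.
Qed.

(** [(-1) ^+ i] times the i-th derivative at -1 is the i-th derivative at 1 of F(-x), the
    contribution of the folded well. The range of i is the same for every m: terms with i > m
    vanish. *)
Definition gibbs_coef n F m : R :=
  \sum_(i < n.+1) (F^`(i)%classic 1 + (-1) ^+ i * F^`(i)%classic (-1)) / i`!%:R / 2
    * limit_coef R m i.

End gibbs_expansion.

Section gibbs_expansion.
Context (R : realType).
Local Notation leb := (@lebesgue_measure R).
Local Notation half := `[(0 : R), +oo[%classic.
Implicit Types (x r : R) (p N m n : nat) (F : R -> R).
Local Notation pow p := (fun x : R => (x - 1) ^+ p).

Let mhalf : @measurable _ (measurableTypeR R) half.
Proof. exact: measurable_itv. Qed.

Lemma well_intD r (f g : R -> R) :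
  leb.-integrable half (fun x => (f x * well r x)%:E) ->
  leb.-integrable half (fun x => (g x * well r x)%:E) ->
  leb.-integrable half (fun x => ((f x + g x) * well r x)%:E) /\
  well_int r (fun x => f x + g x) = well_int r f + well_int r g.
Proof.
move=> fi gi; split.
  apply: eq_integrable (integrableD mhalf fi gi) => // x _.
  by rewrite /= mulrDl EFinD.
rewrite -(@RintegralD _ _ _ leb half _ _ mhalf fi gi).
by apply: eq_Rintegral => x _; rewrite mulrDl.
Qed.

Lemma well_intZ r (c : R) (f : R -> R) :
  leb.-integrable half (fun x => (f x * well r x)%:E) ->
  leb.-integrable half (fun x => (c * f x * well r x)%:E) /\
  well_int r (fun x => c * f x) = c * well_int r f.
Proof.
move=> fi; split.
  apply: eq_integrable (integrableZl mhalf c fi) => // x _.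
  by rewrite /= -mulrA EFinM.
rewrite -(@RintegralZl _ _ _ leb half _ c mhalf fi).
by apply: eq_Rintegral => x _; rewrite mulrA.
Qed.

(** Meant for [f] a Taylor remainder: F is then recovered as [f] plus its Taylor polynomial, and its
    integrability comes from that of the remainder. *)
Lemma well_int_poly r (f : R -> R) (c : nat -> R) N : 0 < r ->
  leb.-integrable half (fun x => (f x * well r x)%:E) ->
  leb.-integrable half
    (fun x => ((f x + \sum_(i < N) c i * (x - 1) ^+ i) * well r x)%:E) /\
  well_int r (fun x => f x + \sum_(i < N) c i * (x - 1) ^+ i) =
    well_int r f + \sum_(i < N) c i * well_int r (pow i).
Proof.
move=> r0 fi; elim: N => [|N [IH1 IH2]].
  rewrite big_ord0 addr0.
  have -> : (fun x => f x + \sum_(i < 0) c i * (x - 1) ^+ i) = f.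
    by apply/funext => x; rewrite big_ord0 addr0.
  by split => //; apply: eq_integrable fi => // x _; rewrite /= big_ord0 addr0.
have [z1 z2] := well_intZ (c N) (integrable_pow_well N r0).
have [d1 d2] := well_intD IH1 z1.
have E : (fun x => f x + \sum_(i < N.+1) c i * (x - 1) ^+ i) =
  (fun x => f x + \sum_(i < N) c i * (x - 1) ^+ i + c N * (x - 1) ^+ N).
  by apply/funext => x; rewrite big_ord_recr/= addrA.
split; last by rewrite E d2 IH2 z2 big_ord_recr/= addrA.
by apply: eq_integrable d1 => // x _; rewrite /= big_ord_recr/= addrA.
Qed.

(** Splitting at |x - 1| = 1, where the two powers exchange dominance, leaves one power in each
    piece; the far piece is O(r^q), hence O(r^p) since r <= 1. *)
Lemma well_ratio_le2 (f : R -> R) p q (C : R) : (p <= q)%N -> 0 <= C ->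
  measurable_fun setT f ->
  (forall x, 0 <= x -> `|f x| <= C * (`|x - 1| ^+ p + `|x - 1| ^+ q)) ->
  (forall r, 0 < r -> leb.-integrable half (fun x => (f x * well r x)%:E)) /\
  exists2 K, 0 <= K & forall r, 0 < r <= 1 ->
    `|well_int r f / well_int r (fun=> 1)| <= K * r ^+ p.
Proof.
move=> pq C0 mf fC.
pose B : set R := [set x | `|x - 1| <= 1].
have mB : measurable B.
  rewrite (_ : B = `[0, 2]%classic); first exact: measurable_itv.
  by apply/seteqP; split => x; rewrite /B/= in_itv/= ler_distl; lra.
pose f1 x := f x * \1_B x; pose f2 x := f x * \1_(~` B) x.
have mf1 : measurable_fun setT f1 by apply: measurable_funM.
have mf2 : measurable_fun setT f2.
  by apply: measurable_funM => //; apply: measurable_indic; exact: measurableC.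
have b1 x : 0 <= x -> `|f1 x| <= 2 * C * `|x - 1| ^+ p.
  move=> x0; rewrite /f1 indicE; have [xB|_] := boolP (x \in B); last first.
    by rewrite mulr0 normr0 !mulr_ge0// exprn_ge0.
  rewrite mulr1 (le_trans (fC x x0))//; move: xB; rewrite inE /B/= => y1.
  rewrite [2 * C]mulrC -mulrA ler_wpM2l// mulr2n mulrDl !mul1r lerD2l.
  by rewrite ler_wiXn2l.
have b2 x : 0 <= x -> `|f2 x| <= 2 * C * `|x - 1| ^+ q.
  move=> x0; rewrite /f2 indicE; have [xB|_] := boolP (x \in ~` B); last first.
    by rewrite mulr0 normr0 !mulr_ge0// exprn_ge0.
  rewrite mulr1 (le_trans (fC x x0))//; move: xB; rewrite inE /B/= => /negP.
  rewrite -ltNge => y1.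
  rewrite [2 * C]mulrC -mulrA ler_wpM2l// mulr2n mulrDl !mul1r lerD2r.
  by rewrite ler_weXn2l// ltW.
have fE : f = (fun x => f1 x + f2 x).
  apply/funext => x; rewrite /f1 /f2 -mulrDr !indicE in_setC.
  by case: (x \in B); rewrite ?addr0 ?add0r mulr1.
have C20 : 0 <= 2 * C by rewrite mulr_ge0.
have i1 r (r0 : 0 < r) := integrable_well r0 mf1 b1.
have i2 r (r0 : 0 < r) := integrable_well r0 mf2 b2.
split.
  move=> r r0; have [d1 _] := well_intD (i1 r r0) (i2 r r0).
  by apply: eq_integrable d1 => // x _; rewrite [in RHS]fE.
have [K1 K10 h1] := well_ratio_le C20 mf1 b1.
have [K2 K20 h2] := well_ratio_le C20 mf2 b2.
exists (K1 + K2) => [|r r01]; first by rewrite addr_ge0.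
have := h1 r r01; have := h2 r r01; case/andP: (r01) => r0 r1 h2' h1'.
have [_ d2] := well_intD (i1 r r0) (i2 r r0).
rewrite fE d2 mulrDl (le_trans (ler_normD _ _))// mulrDl lerD//.
by rewrite (le_trans h2')// ler_wpM2l// ler_wiXn2l// ltW.
Qed.

Lemma integral_gibbs F r : 0 < r <= 1 -> measurable_fun setT F ->
  leb.-integrable half (fun x => (F x * well r x)%:E) ->
  leb.-integrable half (fun x => (F (- x) * well r x)%:E) ->
  (\int[gibbs (r ^+ 2)]_x (F x)%:E =
   ((well_int r F + well_int r (fun x => F (- x))) / (2 * well_int r (fun=> 1)))%:E)%E.
Proof.
move=> r01 mF iF iFN; have I0 := well_mass_gt0 r01.
set c := (2 * well_int r (fun=> 1))^-1.
have gE x : gibbs_pdf (r ^+ 2) x = c * well r x by rewrite gibbs_pdfE// mulrC.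
have mid : measurable_fun setT (id : R -> measurableTypeR R) by [].
rewrite (@integral_density _ _ _ _ R leb (gibbs (r ^+ 2)) id mid (gibbs_pdf (r ^+ 2)))//; last 2 first.
- by move=> x; exact: gibbs_pdf_ge0.
- exact: measurable_gibbs_pdf.
have iF' : leb.-integrable half (fun x => (F x * gibbs_pdf (r ^+ 2) x)%:E).
  apply: eq_integrable (integrableZl mhalf c iF) => // x _.
  by rewrite /= gE -EFinM mulrCA.
have iFN' : leb.-integrable half (fun x => (F (- x) * gibbs_pdf (r ^+ 2) (- x))%:E).
  apply: eq_integrable (integrableZl mhalf c iFN) => // x _.
  by rewrite /= gE well_even -EFinM mulrCA.
rewrite integral_halves//; last first.
  by apply: measurable_funM => //; exact: measurable_gibbs_pdf.
have e1 : (\int[leb]_(x in half) (F x * gibbs_pdf (r ^+ 2) x)%:E = (c * well_int r F)%:E)%E.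
  rewrite EFinM /well_int /Rintegral fineK; last exact: integrable_fin_num.
  rewrite -integralZl//; apply: eq_integral => x _.
  by rewrite gE -EFinM mulrCA.
have e2 : (\int[leb]_(x in half) (F (- x) * gibbs_pdf (r ^+ 2) (- x))%:E =
    (c * well_int r (fun x => F (- x)))%:E)%E.
  rewrite EFinM /well_int /Rintegral fineK; last exact: integrable_fin_num.
  rewrite -integralZl//; apply: eq_integral => x _.
  by rewrite gE well_even -EFinM mulrCA.
by rewrite e1 e2 -EFinD -mulrDr mulrC.
Qed.

Lemma powR_half (e : R) m : 0 < e -> e `^ (m%:R / 2) = Num.sqrt e ^+ m.
Proof.
by move=> e0; rewrite mulrC powRrM powR12_sqrt ?ltW// powR_mulrn// sqrtr_ge0.
Qed.

Lemma gibbs_expansion n F : C_k n.+1 F -> poly_growth n.+1 F ->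
  exists2 C : R, 0 < C & forall e : R, 0 < e < 1 ->
    exists r : R,
      (\int[gibbs e]_x (F x)%:E =
        (\sum_(m < n.+1) e `^ (m%:R / 2) * gibbs_coef n F m + r)%:E)%E /\
      `|r| <= C * e `^ (n.+1%:R / 2).
Proof.
move=> hF hFg.
have [C [Q [C0 tay]]] := taylor_growth hF hFg.
have cF := C_k_continuous hF.
have mF : measurable_fun setT F by exact: continuous_measurable_fun.
have mFN : measurable_fun setT (fun x => F (- x)) by exact: measurableT_comp.
pose c1 i := F^`(i)%classic 1 / i`!%:R.
pose c2 i := (-1) ^+ i * F^`(i)%classic (-1) / i`!%:R.
pose R1 x := F x - \sum_(i < n.+1) c1 i * (x - 1) ^+ i.
pose R2 x := F (- x) - \sum_(i < n.+1) c2 i * (x - 1) ^+ i.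
have mpoly (c : nat -> R) : measurable_fun setT (fun x => \sum_(i < n.+1) c i * (x - 1) ^+ i).
  by apply: measurable_sum => i; apply: measurable_funM => //; exact: measurable_pow_shift.
have mR1 : measurable_fun setT R1 by exact: measurable_funB.
have mR2 : measurable_fun setT R2 by exact: measurable_funB.
have b1 x : 0 <= x -> `|R1 x| <= C * (`|x - 1| ^+ n.+1 + `|x - 1| ^+ (n.+1 + Q)).
  by move=> _; apply: tay; rewrite normr1.
have b2 x : 0 <= x -> `|R2 x| <= C * (`|x - 1| ^+ n.+1 + `|x - 1| ^+ (n.+1 + Q)).
  (* [R2] is the Taylor remainder of F at -1 evaluated at -x; the signs in [c2] come from (-x + 1)^i
     = (-1)^i (x - 1)^i. *)
  move=> _; have := tay (-1) (- x); rewrite normrN1 => /(_ erefl).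
  rewrite opprK (_ : `|- x + 1| = `|x - 1|); last by rewrite -normrN opprD opprK.
  apply: le_trans; rewrite le_eqVlt; apply/orP; left; apply/eqP; congr (`|_ - _|).
  apply: eq_bigr => i _; rewrite /c2.
  have -> : - x + 1 = -1 * (x - 1) by ring.
  by rewrite exprMn; ring.
have [iR1 [K1 K10 h1]] := well_ratio_le2 (leq_addr Q n.+1) C0 mR1 b1.
have [iR2 [K2 K20 h2]] := well_ratio_le2 (leq_addr Q n.+1) C0 mR2 b2.
have FE : F = (fun x => R1 x + \sum_(i < n.+1) c1 i * (x - 1) ^+ i).
  by apply/funext => x; rewrite subrK.
have FNE : (fun x => F (- x)) = (fun x => R2 x + \sum_(i < n.+1) c2 i * (x - 1) ^+ i).
  by apply/funext => x; rewrite subrK.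
have /choice[K hK] : forall i, exists K, 0 <= K /\ forall r, 0 < r <= 1 ->
    `|well_mom i r - \sum_(m < n.+1) r ^+ m * limit_coef R m i| <= K * r ^+ n.+1.
  by move=> i; have [K K0 hK] := well_mom_expansion R n i; exists K.
pose k i := (c1 i + c2 i) / 2.
exists ((K1 + K2) / 2 + \sum_(i < n.+1) `|k i| * K i + 1).
  rewrite ltr_wpDl// addr_ge0 ?divr_ge0 ?addr_ge0// sumr_ge0// => i _.
  by rewrite mulr_ge0//; case: (hK i).
move=> e /andP[e0 e1]; pose r := Num.sqrt e.
have r0 : 0 < r by rewrite sqrtr_gt0.
have re : e = r ^+ 2 by rewrite sqr_sqrtr// ltW.
have r1 : r <= 1 by rewrite -(sqrtr1 R) ler_sqrt// ltW.
have r01 : 0 < r <= 1 by rewrite r0.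
have I0 := well_mass_gt0 r01.
have [i1 e1'] := well_int_poly c1 n.+1 r0 (iR1 r r0).
have [i2 e2'] := well_int_poly c2 n.+1 r0 (iR2 r r0).
rewrite -FE in e1'; rewrite -FNE in e2'.
have iF : leb.-integrable half (fun x => (F x * well r x)%:E).
  by apply: eq_integrable i1 => // x _; rewrite /= subrK.
have iFN : leb.-integrable half (fun x => (F (- x) * well r x)%:E).
  by apply: eq_integrable i2 => // x _; rewrite /= subrK.
(* Exchanging the sums regroups the powers of r, indexed by m, into the truncated expansion of each
   moment, indexed by the order i of differentiation. *)
have S : \sum_(m < n.+1) e `^ (m%:R / 2) * gibbs_coef n F m =
   \sum_(i < n.+1) k i * \sum_(m < n.+1) r ^+ m * limit_coef R m i.
  under eq_bigr do rewrite powR_half// /gibbs_coef mulr_sumr.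
  rewrite exchange_big/=; apply: eq_bigr => i _; rewrite mulr_sumr.
  apply: eq_bigr => m _; rewrite /k /c1 /c2; ring.
exists ((well_int r R1 / well_int r (fun=> 1) + well_int r R2 / well_int r (fun=> 1)) / 2 +
  \sum_(i < n.+1) k i * (well_mom i r - \sum_(m < n.+1) r ^+ m * limit_coef R m i)); split.
  rewrite re integral_gibbs// -re e1' e2' S; congr (_%:E).
  rewrite [RHS]addrCA -[in RHS]big_split/=.
  have -> : \sum_(i < n.+1) (k i * (\sum_(m < n.+1) r ^+ m * limit_coef R m i) +
      k i * (well_mom i r - \sum_(m < n.+1) r ^+ m * limit_coef R m i)) =
    (\sum_(i < n.+1) c1 i * well_int r (pow i) + \sum_(i < n.+1) c2 i * well_int r (pow i))
     / (2 * well_int r (fun=> 1)).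
    rewrite -big_split/= mulr_suml; apply: eq_bigr => i _.
    by rewrite -[LHS]mulrDr subrKC /k /well_mom; field; rewrite gt_eqF.
  by field; rewrite gt_eqF.
rewrite powR_half// -/r [leRHS](_ : _ = (K1 + K2) / 2 * r ^+ n.+1 +
  (\sum_(i < n.+1) `|k i| * K i) * r ^+ n.+1 + r ^+ n.+1); last by ring.
apply: le_trans (ler_normD _ _) _.
rewrite -[X in X <= _]addr0; apply: lerD; last by rewrite exprn_ge0 ?ltW.
apply: lerD.
  rewrite normrM [`|2^-1|]ger0_norm// mulrAC ler_wpM2r//.
  by rewrite (le_trans (ler_normD _ _))// mulrDl lerD ?h1 ?h2.
rewrite mulr_suml (le_trans (ler_norm_sum _ _ _))// ler_sum// => i _.
rewrite normrM -mulrA ler_wpM2l//.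
by case: (hK i) => _; apply.
Qed.

End gibbs_expansion.

(** * The noiseless flow *)

Section primitives.
Context (R : realType).
Local Notation leb := (@lebesgue_measure R).
Implicit Types (a f y : R -> R) (t s u v : R).

Lemma is_derive_integral f (c : R) y : continuous f ->
  (forall t, 0 <= t -> y t = c + \int[leb]_(s in `[0, t]) f s) ->
  forall t : R, 0 < t -> is_derive t 1 y (f t).
Proof.
move=> cf yE t t0.
have fi : leb.-integrable `[0, t + 1] (EFin \o f).
  apply: continuous_compact_integrable; first exact: segment_compact.
  exact: continuous_subspaceT.
have [|dF F'] := continuous_FTC1_closed _ fi t0 (cf t); first by rewrite ltrDl.
have d : is_derive t 1 (fun x => c + \int[leb]_(s in `[0, x]) f s) (f t).
  rewrite -[X in is_derive _ _ _ X]add0r; apply: is_deriveD.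
  by rewrite -F' derive1E; exact/derivableP.
apply: near_eq_is_derive d; near=> x; apply/esym/yE.
by apply: ltW; near: x; exact: lt_nbhsr.
Unshelve. all: by end_near. Qed.

(** Integrating factor exp(-A), with A a primitive of [a]. A positive multiple of the initial value
    has two uses: the sign of X_0 is preserved, and a quantity that vanishes initially vanishes
    forever. *)
Lemma linear_ode_pos a y : continuous a -> continuous y ->
  (forall t : R, 0 < t -> is_derive t 1 y (a t * y t)) ->
  forall t, 0 <= t -> exists2 k, 0 < k & y t = k * y 0.
Proof.
move=> ca cy dy t t0.
pose A (x : R) := \int[leb]_(s in `[0, x]) a s.
have [->|tn0] := eqVneq t 0; first by exists 1; rewrite ?mul1r.
have {tn0}tgt0 : 0 < t by rewrite lt_neqAle eq_sym tn0.
have fi : leb.-integrable `[0, t + 1] (EFin \o a).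
  apply: continuous_compact_integrable; first exact: segment_compact.
  exact: continuous_subspaceT.
have t1 : 0 <= t + 1 by rewrite addr_ge0.
have cA : {within `[0, t + 1], continuous A}.
  exact: parameterized_integral_continuous.
have cA' : {within `[0, t], continuous A}.
  apply: continuous_subspaceW cA => x; rewrite /= !in_itv/= => /andP[-> xt]/=.
  by rewrite (le_trans xt)// lerDl.
have dA (x : R) : 0 < x -> is_derive x 1 A (a x).
  by apply: (@is_derive_integral a 0 A ca) => u _; rewrite add0r.
pose z x := y x * expR (- A x).
have dz x : x \in `]0, t[ -> is_derive x 1 z 0.
  rewrite in_itv/= => /andP[x0 _].
  have d1 := dy x x0; have d2 := dA x x0.
  have d3 : is_derive x 1 (fun x => expR (- A x)) (expR (- A x) * - a x).
    exact: (@is_derive1_comp R expR (fun x => - A x) x _ _ (is_derive_expR _)).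
  have := @is_deriveM R R y _ x 1 _ _ d1 d3 => h; apply: (is_derive_eq h).
  by rewrite /GRing.scale/=; ring.
have cz : {within `[0, t], continuous z}.
  move=> x; apply: cvgM; first exact: (continuous_subspaceT cy).
  apply: continuous_comp; last exact: continuous_expR.
  by apply: cvgN; exact: cA'.
have [c _] := MVT_segment t0 dz cz.
rewrite mul0r => /eqP; rewrite subr_eq0 => /eqP; rewrite /z.
have -> : A 0 = 0 by rewrite /A set_itv1 Rintegral_set1.
rewrite oppr0 expR0 mulr1 => <-.
exists (expR (A t)); first exact: expR_gt0.
by rewrite mulrCA -expRD addrN expR0 mulr1.
Qed.

End primitives.

Section double_well_flow.
Context (R : realType) (x : R -> R) (cx : continuous x).
Context (dx : forall t : R, 0 < t -> is_derive t 1 x (x t - x t ^+ 3)).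
Implicit Types (t s : R).

Let cxn k : continuous (fun t => x t ^+ k).
Proof.
move=> t; apply: (@continuous_comp _ _ _ x (fun z : R => z ^+ k)); first exact: cx.
exact: exprn_continuous.
Qed.

Let cx2 : continuous (fun t => 2 * (1 - x t ^+ 2)).
Proof.
move=> t; apply: cvgMr; apply: cvgB; first exact: cvg_cst.
exact: cxn.
Qed.

Lemma flow_sign t : 0 <= t -> exists2 k, 0 < k & x t = k * x 0.
Proof.
apply: (@linear_ode_pos R (fun t => 1 - x t ^+ 2)) => //.
  move=> s; apply: cvgB; first exact: cvg_cst.
  exact: cxn.
by move=> s s0; apply: (is_derive_eq (dx s0)); ring.
Qed.

Lemma is_derive_exp2 (c t : R) : is_derive t 1 (fun t => expR (c * t)) (c * expR (c * t)).
Proof.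
have d1 : is_derive t 1 (fun t => c * t) c.
  by apply: is_derive_eq; rewrite /GRing.scale/= mulr1.
have d2 := @is_derive1_comp R expR (fun t => c * t) t _ _ (is_derive_expR _) d1.
by apply: (is_derive_eq d2); rewrite mulrC.
Qed.

Lemma continuous_exp2 (c : R) : continuous (fun t => expR (c * t)).
Proof.
move=> t; apply/differentiable_continuous/derivable1_diffP.
by have [] := is_derive_exp2 c t.
Qed.

(* x^2 solves a Bernoulli equation; its solution is verified through the linear
   equation satisfied by the defect. *)
Lemma flow_sqr t : 0 <= t ->
  x t ^+ 2 * (1 + x 0 ^+ 2 * (expR (2 * t) - 1)) = x 0 ^+ 2 * expR (2 * t).
Proof.
move=> t0; set r := x 0 ^+ 2.
pose y t := x t ^+ 2 * (1 + r * (expR (2 * t) - 1)) - r * expR (2 * t).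
have dy s : 0 < s -> is_derive s 1 y (2 * (1 - x s ^+ 2) * y s).
  move=> s0; have d1 := dx s0; have d2 := is_derive_exp2 2 s.
  apply: is_derive_eq; rewrite /GRing.scale/= /y.
  by ring.
have ce := @continuous_exp2 2.
have cy : continuous y.
  move=> s; apply: cvgB; last by apply: cvgMr; exact: ce.
  apply: cvgM; first exact: cxn.
  apply: cvgD; first exact: cvg_cst.
  by apply: cvgMr; apply: cvgB; [exact: ce|exact: cvg_cst].
have [k _] := linear_ode_pos cx2 cy dy t0.
have -> : y 0 = 0 by rewrite /y mulr0 expR0 subrr mulr0 addr0 !mulr1 subrr.
by rewrite mulr0 => /eqP; rewrite subr_eq0 => /eqP.
Qed.

Section bounds.
Context (lo hi : R) (lo0 : 0 < lo) (hlo : lo <= 1) (hhi : 1 <= hi).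
Context (x0b : lo <= x 0 ^+ 2 <= hi).

Let Q t := 1 + x 0 ^+ 2 * (expR (2 * t) - 1).

Let exp1 t : 0 <= t -> 1 <= expR (2 * t).
Proof. by move=> t0; rewrite -[X in X <= _](@expR0 R) ler_expR mulr_ge0. Qed.

Let Qlo t : 0 <= t -> lo * expR (2 * t) <= Q t.
Proof.
case/andP: x0b => a b /exp1 e1; rewrite /Q.
have : 0 <= (x 0 ^+ 2 - lo) * (expR (2 * t) - 1) by rewrite mulr_ge0 ?subr_ge0.
by move: hlo; lra.
Qed.

Let Qgt0 t : 0 <= t -> 0 < Q t.
Proof. by move=> t0; apply: lt_le_trans (Qlo t0); rewrite mulr_gt0// expR_gt0. Qed.

(** With r = x(0)^2 and p = r (exp(2t) - 1), the explicit solution is x(t)^2 = (r + p) / (1 + p), a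
    barycentre of r and 1; the interval contains both. *)
Lemma flow_sqr_bounds t : 0 <= t -> lo <= x t ^+ 2 <= hi.
Proof.
move=> t0; have e := flow_sqr t0; have Q0 := Qgt0 t0; rewrite -/(Q t) in e.
have e1 := exp1 t0; case/andP: x0b => a b.
have -> : x t ^+ 2 = x 0 ^+ 2 * expR (2 * t) / Q t by rewrite -e mulfK// gt_eqF.
rewrite ler_pdivlMr// ler_pdivrMr// /Q.
move: a b e1; set r := x 0 ^+ 2; set E := expR (2 * t) => a b e1.
have p0 : 0 <= r * (E - 1) by rewrite mulr_ge0 ?subr_ge0// (le_trans (ltW lo0)).
have -> : r * E = r + r * (E - 1) by ring.
move: p0; set p := r * (E - 1) => p0.
have p1 : lo * p <= p by rewrite ler_piMl.
have p2 : p <= hi * p by rewrite ler_peMl.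
by apply/andP; split; rewrite mulrDr mulr1; lra.
Qed.

(** Exactly, x(t)^2 - 1 = (x(0)^2 - 1) / Q(t), and Q grows at least like lo exp(2t). The rate is
    deterministic because the initial datum is bounded away from 0. *)
Lemma flow_sqr_limit t : 0 <= t ->
  `|x t ^+ 2 - 1| <= hi / lo * expR (- 2 * t).
Proof.
move=> t0; have e := flow_sqr t0; have Q0 := Qgt0 t0; rewrite -/(Q t) in e.
have e1 := exp1 t0; case/andP: x0b => a b.
have -> : x t ^+ 2 - 1 = (x 0 ^+ 2 - 1) / Q t.
  have -> : x t ^+ 2 = x 0 ^+ 2 * expR (2 * t) / Q t by rewrite -e mulfK// gt_eqF.
  by rewrite /Q; field; rewrite gt_eqF.
rewrite normrM normfV (gtr0_norm Q0) ler_pdivrMr//.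
apply: le_trans (_ : hi <= _).
  by move: lo0 hlo hhi => l0 l1 h1; rewrite ler_norml; apply/andP; split; lra.
have := Qlo t0 => h.
apply: le_trans (_ : hi / lo * expR (- 2 * t) * (lo * expR (2 * t)) <= _).
  rewrite le_eqVlt; apply/orP; left; apply/eqP.
  have -> : - 2 * t = - (2 * t) by rewrite mulNr.
  by rewrite expRN; field; rewrite !gt_eqF// expR_gt0.
rewrite ler_wpM2l// !mulr_ge0 ?invr_ge0 ?expR_ge0//; last exact: ltW.
exact: le_trans hhi.
Qed.

Lemma flow_neq0 t : 0 <= t -> x t != 0.
Proof.
move=> /flow_sqr_bounds/andP[h _]; apply/eqP => x0.
by move: h; rewrite x0 expr0n/= leNgt lo0.
Qed.

End bounds.
End double_well_flow.

Lemma eq_is_derive (R : realType) (f g : R -> R) (x df : R) :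
  f =1 g -> is_derive x 1 f df -> is_derive x 1 g df.
Proof. by move=> /funext ->. Qed.

(** * The hierarchy of expansion equations and variation of constants *)

Section system.
Context d (T : measurableType d) (R : realType) (P : probability T R).

Definition noise (b : R -> T -> R) (m : nat) (t : R) (w : T) : R :=
  if m == 1%N then Num.sqrt 2 * b t w else 0.

Definition increment (b : R -> T -> R) (s t : R) (w : T) : R := b t w - b s w.

(* The expansion equations, with all the almost sure properties holding surely
   and all the paths continuous on the whole line; [H t] generates a
   sigma-algebra for which the system is adapted. *)
Record expansion_system (n : nat) (b : R -> T -> R) (xi : nat -> T -> R)
    (X : nat -> R -> T -> R) (H : R -> set (set T)) (lo hi : R) : Prop := {
  sys_mb : forall t, measurable_fun setT (b t) ;
  sys_mxi : forall m, measurable_fun setT (xi m) ;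
  sys_mX : forall m t, measurable_fun setT (X m t) ;
  sys_cb : forall w, continuous (b^~ w) ;
  sys_cX : forall m w, continuous ((X m)^~ w) ;
  sys_b0 : forall w, b 0 w = 0 ;
  sys_X0 : forall m w, (m <= n)%N -> X m 0 w = xi m w ;
  sys_dX : forall m w, (m <= n)%N -> forall t : R, 0 < t ->
    is_derive t 1 (fun s => X m s w - noise b m s w)
      (expansion_drift m (fun k => X k t w)) ;
  sys_lo : 0 < lo <= 1 ;
  sys_hi : 1 <= hi ;
  sys_xi0 : forall w, lo <= xi 0%N w ^+ 2 <= hi ;
  sys_xi : forall m k, (m <= n)%N ->
    exists C, (\int[P]_w (xi m w ^+ (2 ^ k.+1))%:E <= C%:E)%E ;
  sys_normal : forall s t : R, 0 <= s < t -> forall A, measurable A ->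
    P (increment b s t @^-1` A) = normal_prob 0 (Num.sqrt (t - s)) A ;
  sys_H : forall t, H t `<=` measurable ;
  sys_xiH : forall m (t : R), (m <= n)%N -> 0 <= t ->
    measurable_fun setT (xi m : g_sigma_algebraType (H t) -> R) ;
  sys_bH : forall s t : R, 0 <= s <= t ->
    measurable_fun setT (b s : g_sigma_algebraType (H t) -> R) ;
  sys_indep : forall s t : R, 0 <= s < t -> forall A, <<s H s >> A ->
    forall B, measurable B ->
    P (A `&` increment b s t @^-1` B) =
      (P A * P (increment b s t @^-1` B))%E }.

Context (n : nat) (b : R -> T -> R) (xi : nat -> T -> R)
  (X : nat -> R -> T -> R) (H : R -> set (set T)) (lo hi : R)
  (sys : expansion_system n b xi X H lo hi).
Implicit Types (m k : nat) (s t : R) (w : T).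

Lemma sys_continuous m w : continuous ((X m)^~ w).
Proof. by move=> t; exact: (sys_cX sys). Qed.
Arguments sys_continuous : clear implicits.

Lemma sys_dx0 w t : 0 < t -> is_derive t 1 ((X 0%N)^~ w) (X 0%N t w - X 0%N t w ^+ 3).
Proof.
move=> t0; have := sys_dX sys w (leq0n n) t0.
rewrite /noise/= /expansion_drift/=; apply: eq_is_derive.
by move=> s; rewrite subr0.
Qed.

Let lo0 : 0 < lo. Proof. by case/andP: (sys_lo sys). Qed.
Let lo1 : lo <= 1. Proof. by case/andP: (sys_lo sys). Qed.
Let X00 w : lo <= X 0%N 0 w ^+ 2 <= hi.
Proof. by rewrite (sys_X0 sys)//; exact: sys_xi0 sys w. Qed.

Lemma sys_X0_bounds w t : 0 <= t -> lo <= X 0%N t w ^+ 2 <= hi.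
Proof.
exact: (flow_sqr_bounds (sys_continuous 0%N w) (@sys_dx0 w) lo0 lo1 (sys_hi sys) (X00 w)).
Qed.

Lemma sys_X0_limit w t : 0 <= t ->
  `|X 0%N t w ^+ 2 - 1| <= hi / lo * expR (- 2 * t).
Proof.
exact: (flow_sqr_limit (sys_continuous 0%N w) (@sys_dx0 w) lo0 lo1 (sys_hi sys) (X00 w)).
Qed.

Lemma sys_X0_neq0 w t : 0 <= t -> X 0%N t w != 0.
Proof.
exact: (flow_neq0 (sys_continuous 0%N w) (@sys_dx0 w) lo0 lo1 (sys_hi sys) (X00 w)).
Qed.

Lemma sys_X0_sign w t : 0 <= t -> exists2 k, 0 < k & X 0%N t w = k * xi 0%N w.
Proof.
move=> t0; rewrite -(sys_X0 sys w (leq0n n)).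
exact: (flow_sign (sys_continuous 0%N w) (@sys_dx0 w) t0).
Qed.

(* Solution operator of the equation linearised along X_0. *)
Definition propagator t s w : R :=
  (X 0%N t w / X 0%N s w) ^+ 3 * expR (- 2 * (t - s)).

(** The cube of the ratio of two values of X_0 is at most (hi / lo)^(3/2); since hi / lo >= 1,
    rounding up to the square avoids a fractional power. *)
Definition prop_bound : R := (hi / lo) ^+ 2.

Lemma prop_bound_ge0 : 0 <= prop_bound.
Proof. exact: sqr_ge0. Qed.

Lemma propagator_le t s w : 0 <= s <= t ->
  `|propagator t s w| <= prop_bound * expR (- 2 * (t - s)).
Proof.
move=> /andP[s0 st]; have t0 := le_trans s0 st.
rewrite normrM (ger0_norm (expR_ge0 _)) ler_wpM2r ?expR_ge0// normrX /prop_bound.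
have /andP[a1 a2] := sys_X0_bounds w s0; have /andP[b1 b2] := sys_X0_bounds w t0.
have h : `|X 0%N t w / X 0%N s w| ^+ 2 <= hi / lo.
  rewrite real_normK ?num_real// exprMn exprVn.
  have z : 0 < X 0%N s w ^+ 2 by rewrite (lt_le_trans lo0).
  rewrite ler_pdivrMr//.
  have ln0 : lo != 0 by rewrite gt_eqF.
  apply: le_trans b2 _; rewrite -[X in X <= _](divfK ln0).
  by rewrite ler_wpM2l// divr_ge0 ?(ltW lo0)// (le_trans ler01 (sys_hi sys)).
have h1 : 1 <= hi / lo by rewrite ler_pdivlMr// mul1r (le_trans lo1 (sys_hi sys)).
move: h; set q := `|_| => h.
have q0 : 0 <= q by exact: normr_ge0.
have [q1|q1] := leP q 1.
  apply: le_trans (_ : 1 <= _); first by rewrite exprn_ile1.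
  by rewrite exprn_ege1.
apply: le_trans (_ : q ^+ 4 <= _); first by rewrite ler_weXn2l// ltW.
by rewrite -[4%N]/(2 * 2)%N exprM lerXn2r// nnegrE ?sqr_ge0// (le_trans _ h1).
Qed.

Definition remainder_drift m (x : nat -> R) : R :=
  - \sum_(j in compositions 2 m) 3 * x 0%N * \prod_k x (j k)
  - \sum_(j in compositions 3 m) \prod_k x (j k).

(** The noise is centred at the final time t. Its increments from s to t are of size sqrt(t - s),
    which the decay exp(-2 (t - s)) of the propagator outweighs uniformly in t; centring at time 0
    would leave a term growing with s. *)
Definition forcing m t s w : R :=
  remainder_drift m (fun k => X k s w) +
  (1 - 3 * X 0%N s w ^+ 2) * (noise b m s w - noise b m t w).

Lemma expansion_driftE m (x : nat -> R) : (0 < m)%N ->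
  expansion_drift m x = (1 - 3 * x 0%N ^+ 2) * x m + remainder_drift m x.
Proof.
by move=> m0; rewrite /expansion_drift gtn_eqF// /remainder_drift addrA.
Qed.

Lemma continuous_noise m w : continuous ((noise b m)^~ w).
Proof.
rewrite /noise; case: (m == 1%N) => s; last exact: cvg_cst.
by apply: cvgMr; exact: (sys_cb sys).
Qed.

Lemma continuous_sum (J : Type) (r : seq J) (Q : pred J) (F : J -> R -> R) :
  (forall j, Q j -> continuous (F j)) -> continuous (fun t => \sum_(j <- r | Q j) F j t).
Proof.
move=> cF; elim: r => [|j r IH] t.
  have -> : (fun t => \sum_(j <- [::] | Q j) F j t) = fun=> 0.
    by apply/funext => s; rewrite big_nil.
  exact: cvg_cst.
have [Qj|Qj] := boolP (Q j).
  have -> : (fun t => \sum_(j <- j :: r | Q j) F j t) =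
      (fun t => F j t + \sum_(j <- r | Q j) F j t).
    by apply/funext => s; rewrite big_cons Qj.
  by apply: cvgD; [exact: cF|exact: IH].
have -> : (fun t => \sum_(j <- j :: r | Q j) F j t) = (fun t => \sum_(j <- r | Q j) F j t).
  by apply/funext => s; rewrite big_cons (negbTE Qj).
exact: IH.
Qed.

Lemma continuous_prod (J : Type) (r : seq J) (F : J -> R -> R) :
  (forall j, continuous (F j)) -> continuous (fun t => \prod_(j <- r) F j t).
Proof.
move=> cF; elim: r => [|j r IH] t.
  have -> : (fun t => \prod_(j <- [::]) F j t) = fun=> 1.
    by apply/funext => s; rewrite big_nil.
  exact: cvg_cst.
have -> : (fun t => \prod_(j <- j :: r) F j t) = (fun t => F j t * \prod_(j <- r) F j t).
  by apply/funext => s; rewrite big_cons.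
by apply: cvgM; [exact: cF|exact: IH].
Qed.

Lemma continuous_remainder_drift m w :
  continuous (fun t => remainder_drift m (fun k => X k t w)).
Proof.
have cX k := sys_continuous k w.
move=> t; rewrite /remainder_drift; apply: cvgB; first apply: cvgN.
  apply: continuous_sum => j _ s; apply: cvgM; first by apply: cvgMr; exact: cX.
  by apply: continuous_prod => l; exact: cX.
by apply: continuous_sum => j _ s; apply: continuous_prod => l; exact: cX.
Qed.

Lemma continuous_X0_pow w k : continuous (fun t => X 0%N t w ^+ k).
Proof.
move=> t; apply: (@continuous_comp _ _ _ (fun t => X 0%N t w) (fun z : R => z ^+ k)).
  exact: (sys_cX sys).
exact: exprn_continuous.
Qed.

Lemma continuous_rate w : continuous (fun s => 1 - 3 * X 0%N s w ^+ 2).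
Proof.
move=> s; apply: cvgB; first exact: cvg_cst.
by apply: cvgMr; exact: continuous_X0_pow.
Qed.

Lemma continuous_forcing m t w : continuous (fun s => forcing m t s w).
Proof.
move=> s; apply: cvgD; first exact: continuous_remainder_drift.
apply: cvgM; first exact: continuous_rate.
by apply: cvgB; [exact: continuous_noise|exact: cvg_cst].
Qed.

(* Only nonnegative times are meaningful for the propagator, hence the
   truncation at 0. *)
Local Notation pos s := (Num.max s 0).

Lemma continuous_pos (f : R -> R) : continuous f -> continuous (fun s => f (pos s)).
Proof.
move=> cf s; apply: (@continuous_comp _ _ _ (fun s => pos s) f); last exact: cf.
by apply: continuous_max; [exact: cvg_id|exact: cvg_cst].
Qed.

Lemma continuous_propagator t w : continuous (fun s => propagator t (pos s) w).
Proof.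
move=> s; rewrite /propagator.
apply: cvgM; last first.
  apply: (@continuous_pos (fun s => expR (- 2 * (t - s)))) => {}s.
  apply: (@continuous_comp _ _ _ (fun s : R => - 2 * (t - s)) (@expR R)); last exact: continuous_expR.
  by apply: cvgMr; apply: cvgB; [exact: cvg_cst|exact: cvg_id].
apply: (@continuous_comp _ _ _ (fun s => X 0%N t w / X 0%N (pos s) w) (fun z : R => z ^+ 3)).
  apply: cvgMr; apply: cvgV.
    by apply: sys_X0_neq0; rewrite le_max lexx orbT.
  exact: (continuous_pos (sys_continuous 0%N w)).
exact: exprn_continuous.
Qed.

(* Variation of constants: [duhamel m t] interpolates between the contribution
   of the initial datum at s = 0 and X_m(t) at s = t. *)
Definition duhamel m t s w : R :=
  propagator t (pos s) w * (X m s w - (noise b m s w - noise b m t w)).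

Lemma is_derive_pos (f : R -> R) (s df : R) : 0 < s ->
  is_derive s 1 f df -> is_derive s 1 (fun s => f (pos s)) df.
Proof.
move=> s0; apply: near_eq_is_derive; near=> u.
rewrite max_l//; apply: ltW; near: u; exact: lt_nbhsr.
Unshelve. all: by end_near. Qed.

(** X_0 has logarithmic derivative 1 - X_0^2, and 1 - 3 X_0^2 = 3 (1 - X_0^2) - 2: hence the cube
    and the rate 2 in the propagator. *)
Lemma is_derive_propagator t s w : 0 < s ->
  is_derive s 1 (fun s => propagator t (pos s) w)
    (- (1 - 3 * X 0%N s w ^+ 2) * propagator t (pos s) w).
Proof.
move=> s0; have xs0 : X 0%N s w != 0 by apply: sys_X0_neq0; exact: ltW.
have d1 := sys_dx0 w s0.
have posE : pos s = s by rewrite max_l// ltW.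
rewrite posE.
have d2 := @is_derive_exp2 R 2 s.
pose f s := X 0%N t w ^+ 3 * expR (- 2 * t) * ((X 0%N s w)^-1 ^+ 3 * expR (2 * s)).
have fE u : propagator t u w = f u.
  rewrite /propagator /f exprMn mulrBr expRD -[- (- 2 * u)]mulNr opprK; ring.
have d3 := is_deriveV xs0 d1.
have d4 : is_derive s 1 f (- (1 - 3 * X 0%N s w ^+ 2) * f s).
  apply: is_derive_eq; rewrite /f /GRing.scale/=; field; exact: xs0.
rewrite fE; apply: eq_is_derive (is_derive_pos s0 d4).
by move=> u; rewrite fE.
Qed.

Lemma is_derive_duhamel m t s w : (0 < m <= n)%N -> 0 < s ->
  is_derive s 1 (fun s => duhamel m t s w) (propagator t (pos s) w * forcing m t s w).
Proof.
move=> /andP[m0 mn] s0.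
have d1 := is_derive_propagator t w s0.
have d2 := sys_dX sys w mn s0.
have d3 : is_derive s 1 (fun s => X m s w - (noise b m s w - noise b m t w))
   (expansion_drift m (fun k => X k s w)).
  have := @is_deriveD R R R _ (cst (noise b m t w)) s 1 _ _ d2 (is_derive_cst _ _ _).
  rewrite addr0; apply: eq_is_derive.
  by move=> u; rewrite /= opprB addrA addrAC.
have := @is_deriveM R R _ _ s 1 _ _ d1 d3 => h; apply: (is_derive_eq h).
rewrite expansion_driftE// /forcing /GRing.scale/=; ring.
Qed.

(** The boundary term at 0 contains the noise at time t, as a result of centring there; the
    propagator from 0 to t compensates for its growth. *)
Lemma duhamel_cvg m t w : (0 < m <= n)%N -> 0 <= t ->
  riemann_sum (fun s => propagator t (pos s) w * forcing m t s w) 0 t N @[N --> \oo]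
    --> X m t w - propagator t 0 w * (xi m w + noise b m t w).
Proof.
move=> m0n t0; have /andP[m0 mn] := m0n.
have -> : X m t w - propagator t 0 w * (xi m w + noise b m t w) =
    duhamel m t t w - duhamel m t 0 w.
  rewrite /duhamel max_l// maxxx subrr subr0 (sys_X0 sys)//.
  rewrite {2}/propagator divff ?sys_X0_neq0// subrr mulr0 expR0 expr1n !mul1r.
  by rewrite /noise; case: eqP => _; rewrite ?(sys_b0 sys) ?mulr0 opprB ?subr0.
apply: (@riemann_sum_cvg R _ (fun s => duhamel m t s w)) => [|s|s|s s0].
- by rewrite lexx.
- by apply: cvgM; [exact: continuous_propagator|exact: continuous_forcing].
- apply: cvgM; first exact: continuous_propagator.
  apply: cvgB; first exact: (sys_cX sys).
  by apply: cvgB; [exact: continuous_noise|exact: cvg_cst].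
- exact: is_derive_duhamel.
Qed.

Lemma drift_cvg m s t w : (m <= n)%N -> 0 <= s <= t ->
  riemann_sum (fun u => expansion_drift m (fun k => X k u w)) s t N @[N --> \oo]
    --> X m t w - noise b m t w - (X m s w - noise b m s w).
Proof.
move=> mn st.
apply: (@riemann_sum_cvg R _ (fun s => X m s w - noise b m s w)) => //.
- have [->|m0] := posnP m.
    rewrite /expansion_drift/= => u; apply: cvgB; first exact: (sys_cX sys).
    exact: continuous_X0_pow.
  under eq_fun do rewrite expansion_driftE//.
  move=> u; apply: cvgD; last exact: continuous_remainder_drift.
  by apply: cvgM; [exact: continuous_rate|exact: (sys_cX sys)].
- by move=> u; apply: cvgB; [exact: (sys_cX sys)|exact: continuous_noise].
- by move=> u u0; exact: (sys_dX sys).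
Qed.

End system.

Arguments sys_continuous {d T R P n b xi X H lo hi} sys m w.
Arguments sys_dx0 {d T R P n b xi X H lo hi} sys w t.

Section measurable_inverse.
Context (R : realType).

(** Pointwise limit of the continuous functions x / (x^2 + 1/(N+1)); at 0 they all vanish, in
    agreement with the convention that the inverse of 0 is 0. *)
Lemma measurable_inv : measurable_fun setT (GRing.inv : R -> R).
Proof.
apply: (@measurable_fun_cvg _ _ _ _ (fun N (x : R) => x * (x ^+ 2 + N.+1%:R^-1)^-1)).
  move=> N; apply: measurable_funM => //; apply: continuous_measurable_fun => x.
  apply: cvgV; first by rewrite gt_eqF// ltr_wpDl ?sqr_ge0.
  by apply: cvgD; [exact: exprn_continuous|exact: cvg_cst].
move=> x _; have [->|x0] := eqVneq x 0.
  by rewrite invr0; under eq_fun do rewrite mul0r; exact: cvg_cst.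
have -> : x^-1 = x * (x ^+ 2 + 0)^-1 by rewrite addr0; field.
apply: cvgMr; apply: cvgV; first by rewrite addr0 expf_neq0.
by apply: cvgD; [exact: cvg_cst|exact: cvg_harmonic].
Qed.

Lemma measurable_sum_cond d (T : measurableType d) (J : Type) (r : seq J) (Q : pred J)
    (h : J -> T -> R) : (forall j, Q j -> measurable_fun setT (h j)) ->
  measurable_fun setT (fun w => \sum_(j <- r | Q j) h j w).
Proof.
move=> mh; under eq_fun do rewrite big_mkcond.
apply: measurable_sum => j; case: (boolP (Q j)) => [/mh//|_].
exact: measurable_cst.
Qed.

Lemma measurable_remainder_drift d (T : measurableType d) m (x : nat -> T -> R) :
  (forall j, (j < m)%N -> measurable_fun setT (x j)) ->
  measurable_fun setT (fun w => remainder_drift m (x^~ w)).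
Proof.
move=> mx.
have mp i : (1 < i)%N -> forall j : {ffun 'I_i -> 'I_m.+1},
    j \in (compositions i m)%SET -> measurable_fun setT (fun w => \prod_(k < i) x (j k) w).
  by move=> i1 j jc; apply: measurable_prod => k _; apply: mx; exact: (composition_lt k i1 jc).
rewrite /remainder_drift; apply: measurable_funB; first apply: measurableT_comp => //.
all: apply: measurable_sum_cond => j jc.
  apply: measurable_funM; last exact: mp.
  apply: measurable_funM => //; apply: mx.
  by rewrite (leq_ltn_trans _ (composition_lt ord0 _ jc)).
exact: mp.
Qed.

End measurable_inverse.

(** * Moment bounds uniform in time *)

Section system_moments.
Context d (T : measurableType d) (R : realType) (P : probability T R).
Context (n : nat) (b : R -> T -> R) (xi : nat -> T -> R)
  (X : nat -> R -> T -> R) (H : R -> set (set T)) (lo hi : R)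
  (sys : expansion_system P n b xi X H lo hi).
Implicit Types (m k : nat) (s t : R) (w : T).
Local Notation pos s := (Num.max s 0).

Definition time : Type := {t : R | 0 <= t}.
Definition times : Type := {z : R * R | 0 <= z.1 <= z.2}.

Definition unit_gauge (I : Type) (_ : I) : R := 1.

Lemma unit_gauge01 I (i : I) : 0 < unit_gauge i <= 1.
Proof. by rewrite /unit_gauge ltr01 lexx. Qed.

Lemma sqrt_le_expR (x : R) : 0 <= x -> Num.sqrt x <= expR x.
Proof.
move=> x0; apply: le_trans (expR_ge1Dx x).
have := sqr_ge0 (Num.sqrt x - 1); have := sqr_sqrtr x0; have := sqrtr_ge0 x.
by set q := Num.sqrt x; nra.
Qed.

Lemma increment_moment k : exists C, forall s t, 0 <= s <= t ->
  (\int[P]_w (increment b s t w ^+ (2 ^ k.+1))%:E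
    <= (C * Num.sqrt (t - s) ^+ (2 ^ k.+1))%:E)%E.
Proof.
exists (2 * (2 ^ k.+1)`!%:R * expR 1) => s t /andP[s0 st].
have mi : measurable_fun setT (increment b s t).
  by apply: measurable_funB; exact: (sys_mb sys).
have [->|ts] := eqVneq s t.
  have -> : (fun w => (increment b t t w ^+ (2 ^ k.+1))%:E) = fun=> 0%E.
    by apply/funext => w; rewrite /increment subrr expr0n expn_eq0.
  by rewrite integral0 lee_fin mulr_ge0 ?exprp_ge0// !mulr_ge0 ?expR_ge0.
have st' : s < t by rewrite lt_neqAle ts.
apply: (normal_moment mi); first by rewrite sqrtr_gt0 subr_gt0.
by apply: (sys_normal sys); rewrite s0.
Qed.

(** sqrt(x) <= exp(x). This spends half of the decay rate 2 of the propagator on the growth of the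
    noise; the other half makes the integrals in time converge. *)
Lemma increment_bigO : bigO P (@unit_gauge times) 0
  (fun (z : times) w => expR (- ((val z).2 - (val z).1)) * increment b (val z).1 (val z).2 w).
Proof.
have mi s t : measurable_fun setT (increment b s t).
  by apply: measurable_funB; exact: (sys_mb sys).
apply: bigO_intro; first exact: unit_gauge01.
  by move=> z; apply: measurable_funM.
move=> k; have [C hC] := increment_moment k; exists `|C| => -[[s t] /= st].
rewrite expr1n mulr1.
under eq_integral do rewrite exprMn EFinM.
rewrite ge0_integralZl_EFin ?exprp_ge0//; last 2 first.
- by move=> w _; rewrite lee_fin exprp_ge0.
- by apply/measurable_EFinP; apply: measurable_funX.
apply: le_trans (lee_wpmul2l _ (hC s t st)) _; first by rewrite lee_fin exprp_ge0.
rewrite -EFinM lee_fin mulrCA -exprMn.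
apply: le_trans (_ : `|C| * (expR (- (t - s)) * Num.sqrt (t - s)) ^+ (2 ^ k.+1) <= _).
  by rewrite ler_wpM2r ?exprp_ge0// ler_norm.
rewrite ler_piMr//; apply: exprn_ile1; first by rewrite mulr_ge0 ?expR_ge0 ?sqrtr_ge0.
have ts0 : 0 <= t - s by rewrite subr_ge0; case/andP: st.
apply: le_trans (_ : expR (- (t - s)) * expR (t - s) <= _).
  by rewrite ler_wpM2l ?expR_ge0// sqrt_le_expR.
by rewrite -expRD addNr expR0.
Qed.

Lemma sqr_le_normr (x c : R) : 0 <= c -> x ^+ 2 <= c -> `|x| <= 1 + c.
Proof.
by move=> c0; rewrite -[x ^+ 2]real_normK ?num_real//; have := sqr_ge0 (`|x| - 1); nra.
Qed.

Let hi0 : 0 <= hi. Proof. exact: le_trans (sys_hi sys). Qed.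

Lemma sys_X0_bigO : bigO P (@unit_gauge time) 0 (fun t : time => X 0%N (val t)).
Proof.
apply: (@bigO_bounded _ _ _ _ _ _ _ (1 + hi)).
  by move=> t; exact: (sys_mX sys).
move=> [t /= t0] w; apply: sqr_le_normr => //.
by have /andP[] := sys_X0_bounds sys w t0.
Qed.

Lemma bigO_noise_diff m (I : Type) (g : I -> R) a (s t : I -> R) (c : I -> R) :
  (forall i, 0 < g i <= 1) ->
  bigO P g a (fun i w => c i * increment b (s i) (t i) w) ->
  bigO P g a (fun i w => c i * (noise b m (s i) w - noise b m (t i) w)).
Proof.
move=> g01 Ob; rewrite /noise; case: (m == 1%N); last first.
  apply: (@eq_bigO _ _ _ P _ g a (fun _ _ => 0)); last exact: bigO0.
  by move=> i w; rewrite subrr mulr0.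
have := bigOZ (- Num.sqrt 2) Ob; apply: eq_bigO => i w.
rewrite /increment; ring.
Qed.

Lemma sys_rate_le w t : 0 <= t -> `|1 - 3 * X 0%N t w ^+ 2| <= 1 + 3 * hi.
Proof.
move=> t0; have /andP[h1 h2] := sys_X0_bounds sys w t0.
by have := sqr_ge0 (X 0%N t w); rewrite ler_norml => h; apply/andP; split; lra.
Qed.

Lemma measurable_propagator d' (T' : measurableType d') t s (x : R -> T' -> R) :
  measurable_fun setT (x t) -> measurable_fun setT (x s) ->
  measurable_fun setT (propagator (fun=> x) t s).
Proof.
move=> mt ms; apply: measurable_funM => //; apply: measurable_funX.
apply: measurable_funM => //; apply: measurableT_comp => //.
exact: measurable_inv.
Qed.

Lemma bigO_remainder_drift (I : Type) (g : I -> R) m (x : nat -> I -> T -> R) :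
  (forall i, 0 < g i <= 1) -> (forall j, (j < m)%N -> bigO P g 0 (x j)) ->
  bigO P g 0 (fun i w => remainder_drift m (fun k => x k i w)).
Proof.
move=> g01 Ox.
have Op l : (1 < l)%N -> forall j : {ffun 'I_l -> 'I_m.+1},
    j \in (compositions l m)%SET -> bigO P g 0 (fun i w => \prod_(k < l) x (j k) i w).
  by move=> l1 j jc; apply: bigO_prod => // k _; apply: Ox; exact: (composition_lt k l1 jc).
rewrite /remainder_drift; apply: bigOB => //; first apply: bigON => //.
all: apply: bigO_sum => // j jc.
  apply: (@bigOMl0 _ _ _ P _ _ _ (fun i w => 3 * x 0%N i w)); last exact: Op.
  apply: bigOZ => //; apply: Ox.
  by rewrite (leq_ltn_trans _ (composition_lt ord0 _ jc)).
exact: Op.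
Qed.

(** Each summand is below an increment of the exponential, because 1 + h <= exp(h), and the
    increments telescope; the bound is free of t and N. *)
Lemma riemann_exp_le1 t N : 0 <= t ->
  riemann_sum (fun s => expR (- (t - s))) 0 t N <= 1.
Proof.
move=> t0; rewrite /riemann_sum subr0; set h := t / N.+1%:R.
have h0 : 0 <= h by rewrite divr_ge0.
have hN : h * N.+1%:R = t by rewrite /h divfK.
pose v (j : nat) := expR (- (t - h * j%:R)).
apply: le_trans (_ : \sum_(j < N.+1) (v j.+1 - v j) <= _); last first.
  rewrite -(big_mkord xpredT (fun j => v j.+1 - v j)) telescope_sumr//.
  by rewrite /v hN subrr oppr0 expR0 lerBlDr lerDl expR_ge0.
apply: ler_sum => j _.
have -> : 0 + t * (j%:R / N.+1%:R) = h * j%:R by rewrite add0r /h mulrAC mulrA.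
have -> : v j.+1 = v j * expR h.
  by rewrite /v -expRD; congr expR; rewrite -natr1; ring.
rewrite -/(v j); have v0 : 0 <= v j := expR_ge0 _.
by have := ler_wpM2r v0 (expR_ge1Dx h); lra.
Qed.

(** Strong induction on [m] through variation of constants: the forcing only involves lower orders
    and noise increments. The integral part [Oint] and the initial part [Oini] are bounded
    separately. *)
Lemma sys_moments m : (m <= n)%N ->
  bigO P (@unit_gauge time) 0 (fun t : time => X m (val t)).
Proof.
elim/ltn_ind: m => m IH mn.
have [->|m0] := posnP m; first exact: sys_X0_bigO.
have u01 I := @unit_gauge01 I.
have m0n : (0 < m <= n)%N by rewrite m0.
have mprop t s : measurable_fun setT (propagator X t s).
  by apply: (@measurable_propagator _ T t s (X 0%N)); exact: (sys_mX sys).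
have mforc t s : measurable_fun setT (forcing b X m t s).
  apply: measurable_funD.
    by apply: (measurable_remainder_drift (x := fun k => X k s)) => j _; exact: (sys_mX sys).
  apply: measurable_funM.
    apply: measurable_funB => //; apply: measurable_funM => //.
    by apply: measurable_funX; exact: (sys_mX sys).
  rewrite /noise; case: (m == 1%N); last exact: measurable_cst.
  by apply: measurable_funB; apply: measurable_funM => //; exact: (sys_mb sys).
have ts (z : times) : 0 <= (val z).2 - (val z).1.
  by rewrite subr_ge0; case: z => -[s t]/= /andP[].
have Of : bigO P (@unit_gauge times) 0 (fun (z : times) w =>
    expR (- ((val z).2 - (val z).1)) * forcing b X m (val z).2 (val z).1 w).
  rewrite /forcing; under eq_fun do under eq_fun do rewrite mulrDr.
  apply: bigOD => //.
    apply: bigOMl0 => //.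
      apply: (@bigO_bounded _ _ _ _ _ _ _ 1) => // z _.
      by rewrite ger0_norm ?expR_ge0// expR_le1 oppr_le0.
    apply: (bigO_remainder_drift (x := fun k (z : times) => X k (val z).1)) => // j jm.
    have p (z : times) : 0 <= (val z).1 by case: z => -[s t]/= /andP[].
    apply: (bigO_reindex0 _ (fun z : times => exist _ (val z).1 (p z) : time)
      (f := fun t : time => X j (val t))).
    by apply: IH => //; exact: (leq_trans (ltnW jm)).
  under eq_fun do under eq_fun do rewrite mulrCA.
  apply: bigOMl0 => //.
    apply: (@bigO_bounded _ _ _ _ _ _ _ (1 + 3 * hi)) => //.
      move=> z; apply: measurable_funB => //; apply: measurable_funM => //.
      by apply: measurable_funX; exact: (sys_mX sys).
    by move=> z w; apply: sys_rate_le; case: z => -[s t]/= /andP[].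
  apply: bigO_noise_diff => //; exact: increment_bigO.
(* After the forcing has used one factor exp(-(t - s)) of the propagator, one such factor remains;
   it plays the role of [phi] in [moment_riemann_limit], with total weight at most 1. *)
have Oh : bigO P (@unit_gauge times) 0 (fun (z : times) w =>
    expR ((val z).2 - (val z).1) *
    (propagator X (val z).2 (pos (val z).1) w * forcing b X m (val z).2 (val z).1 w)).
  apply: (bigO_dom (c := prop_bound lo hi)) Of => //.
    by move=> z; apply: measurable_funM => //; exact: measurable_funM.
  move=> -[[s t] /= st] w.
  have h := propagator_le sys w st.
  have -> : pos s = s by rewrite max_l//; case/andP: st.
  move: (propagator X t s w) (forcing b X m t s w) h => q f h.
  rewrite !normrM !(ger0_norm (expR_ge0 _)) mulrA (mulrA (prop_bound lo hi)) ler_wpM2r//.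
  apply: le_trans (ler_wpM2l (expR_ge0 _) h) _.
  rewrite mulrCA -expRD; apply: ler_wpM2l; first exact: prop_bound_ge0.
  by rewrite ler_expR; lra.
have mprop0 t : measurable_fun setT (fun w => propagator X t 0 w * (xi m w + noise b m t w)).
  apply: measurable_funM => //; apply: measurable_funD; first exact: (sys_mxi sys).
  rewrite /noise; case: (m == 1%N); last exact: measurable_cst.
  by apply: measurable_funM => //; exact: (sys_mb sys).
have Oint : bigO P (@unit_gauge time) 0 (fun (t : time) w =>
    X m (val t) w - propagator X (val t) 0 w * (xi m w + noise b m (val t) w)).
  apply: bigO_intro => //.
    by move=> t; apply: measurable_funB => //; exact: (sys_mX sys).
  move=> k; have [C hC] := bigO_moment (u01 _) k Oh; exists C => -[t /= t0].
  rewrite expr0 [in X in (_ <= X)%E](_ : 1 = 1 ^+ 0)//.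
  apply: (@moment_riemann_limit _ _ _ P
    (fun s w => propagator X t (pos s) w * forcing b X m t s w) _ 0 t
    (fun s => expR (- (t - s))) 1 C k) => //.
  - by rewrite lexx.
  - by move=> s _; exact: measurable_funM.
  - by apply: measurable_funB => //; exact: (sys_mX sys).
  - by move=> w; exact: (duhamel_cvg sys m0n t0).
  - by move=> s; exact: expR_gt0.
  - by move=> N; exact: riemann_exp_le1.
  - move=> s st; have := hC (exist _ (s, t) st).
    rewrite /= !expr1n mulr1 => h.
    under eq_integral => w _.
      rewrite (_ : _ ^+ _ = expR (- (t - s)) ^+ (2 ^ k.+1) * (expR (t - s) *
       (propagator X t (pos s) w * forcing b X m t s w)) ^+ (2 ^ k.+1)); last first.
        by rewrite -exprMn [expR (- _) * _]mulrA -expRD addNr expR0 mul1r.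
      rewrite EFinM; over.
    rewrite ge0_integralZl_EFin ?exprp_ge0//; last 2 first.
    + by move=> w _; rewrite lee_fin exprp_ge0.
    + apply/measurable_EFinP; apply: measurable_funX; apply: measurable_funM => //.
      exact: measurable_funM.
    rewrite mulrC EFinM lee_wpmul2l// lee_fin exprp_ge0//.
have Oini : bigO P (@unit_gauge time) 0 (fun (t : time) w =>
    propagator X (val t) 0 w * (xi m w + noise b m (val t) w)).
  have p (t : time) : 0 <= ((0 : R), val t).1 <= ((0 : R), val t).2.
    by case: t => t /= t0; rewrite lexx.
  have pb (t : time) w : `|propagator X (val t) 0 w| <= prop_bound lo hi * expR (- 2 * val t).
    by have := propagator_le sys w (p t); rewrite /= subr0.
  have e1 (t : time) : expR (- val t) <= 1 by case: t => t /= t0; rewrite expR_le1 oppr_le0.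
  have O1 : bigO P (@unit_gauge time) 0 (fun (t : time) w => propagator X (val t) 0 w * xi m w).
    apply: bigOMl0 => //.
      apply: (@bigO_bounded _ _ _ _ _ _ _ (prop_bound lo hi)) => // t w.
      apply: le_trans (pb t w) _; rewrite ler_piMr ?prop_bound_ge0//.
      by case: t => t /= t0; rewrite expR_le1 mulNr oppr_le0 mulr_ge0.
    apply: bigO_intro => //; first by move=> _; exact: (sys_mxi sys).
    move=> k; have [C hC] := sys_xi sys k mn; exists C => t.
    by rewrite !expr1n mulr1.
  (* exp(-2t) is shared in the same way: exp(-t) keeps the propagator bounded and exp(-t) tames the
     noise at time t. *)
  have O2 : bigO P (@unit_gauge time) 0 (fun (t : time) w =>
      (propagator X (val t) 0 w * expR (val t)) * (expR (- val t) * noise b m (val t) w)).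
    apply: bigOMl0 => //.
      apply: (@bigO_bounded _ _ _ _ _ _ _ (prop_bound lo hi)) => [t|t w].
        exact: measurable_funM.
      rewrite normrM (ger0_norm (expR_ge0 _)).
      apply: le_trans (ler_wpM2r (expR_ge0 _) (pb t w)) _.
      rewrite -mulrA -expRD (_ : - 2 * val t + val t = - val t); last by ring.
      by rewrite ler_piMr ?prop_bound_ge0.
    have h := bigO_reindex0 (@unit_gauge time)
      (fun t : time => exist _ ((0 : R), val t) (p t) : times) increment_bigO.
    have h2 := @bigO_noise_diff m time (@unit_gauge time) 0 (fun=> 0) (fun t : time => val t)
      (fun t : time => expR (- (val t - 0))) (u01 _) h.
    have := bigON h2; apply: eq_bigO => t w.
    rewrite subr0 -mulrN opprB; congr (_ * _).
    by rewrite /noise; case: (m == 1%N); rewrite ?(sys_b0 sys) ?mulr0 subr0.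
  have := bigOD O1 O2; apply: eq_bigO => t w.
  by rewrite -mulrA [expR _ * (_ * _)]mulrA -expRD addrN expR0 mul1r mulrDr.
have := bigOD Oint Oini; apply: eq_bigO => t w.
by rewrite subrK.
Qed.

End system_moments.

(** * Adaptedness *)

Section system_adapted.
Context d (T : measurableType d) (R : realType) (P : probability T R).
Context (n : nat) (b : R -> T -> R) (xi : nat -> T -> R)
  (X : nat -> R -> T -> R) (H : R -> set (set T)) (lo hi : R)
  (sys : expansion_system P n b xi X H lo hi).
Implicit Types (m k : nat) (s t u : R) (w : T).
Local Notation pos s := (Num.max s 0).

(** [flow_sqr] gives the square and [flow_sign] the sign. The formula exhibits X_0 as a measurable
    function of its initial datum. *)
Lemma sys_X0E w t : 0 <= t ->
  X 0%N t w = xi 0%N w *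
    Num.sqrt (expR (2 * t) * (1 + xi 0%N w ^+ 2 * (expR (2 * t) - 1))^-1).
Proof.
move=> t0; have [k k0 xk] := sys_X0_sign sys w t0.
have e := flow_sqr (sys_continuous sys 0%N w) (sys_dx0 sys w) t0.
rewrite (sys_X0 sys w (leq0n n)) in e.
have x2 : xi 0%N w ^+ 2 != 0.
  have /andP[h _] := sys_xi0 sys w; have /andP[l0 _] := sys_lo sys.
  by rewrite gt_eqF// (lt_le_trans l0).
have q1 : 1 <= 1 + xi 0%N w ^+ 2 * (expR (2 * t) - 1).
  by rewrite lerDl mulr_ge0 ?sqr_ge0// subr_ge0 -[X in X <= _](@expR0 R) ler_expR mulr_ge0.
move: e q1; set Q := 1 + _ => e q1.
have Q0 : Q != 0 by rewrite gt_eqF// (lt_le_trans _ q1).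
have -> : expR (2 * t) * Q^-1 = k ^+ 2.
  have : xi 0%N w ^+ 2 * (k ^+ 2 * Q) = xi 0%N w ^+ 2 * expR (2 * t).
    by rewrite -e xk; ring.
  by move/(mulfI x2) => <-; rewrite mulfK.
by rewrite sqrtr_sqr gtr0_norm// mulrC.
Qed.

Lemma measurable_forcing d' (T' : measurableType d') (b' : R -> T' -> R)
    (X' : nat -> R -> T' -> R) m t s : (0 < m)%N ->
  (forall j, (j < m)%N -> measurable_fun setT (X' j s)) ->
  measurable_fun setT (b' s) -> measurable_fun setT (b' t) ->
  measurable_fun setT (forcing b' X' m t s).
Proof.
move=> m0 mX ms mt; apply: measurable_funD.
  exact: (measurable_remainder_drift (x := fun k => X' k s)).
apply: measurable_funM.
  by apply: measurable_funB => //; apply: measurable_funM => //; apply: measurable_funX; exact: mX.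
rewrite /noise; case: (m == 1%N); last exact: measurable_cst.
by apply: measurable_funB; apply: measurable_funM.
Qed.

(** The equation of order m is implicit in X_m and says nothing about measurability; the formula of
    [duhamel_cvg] makes X_m(u) a pointwise limit of finite expressions in the data, the noise and
    lower orders at times up to u. *)
Lemma sys_adapted m t : (m <= n)%N -> forall u, 0 <= u <= t ->
  measurable_fun setT (X m u : g_sigma_algebraType (H t) -> R).
Proof.
elim/ltn_ind: m => m IH mn u ut; have /andP[u0 ut'] := ut.
have t0 : 0 <= t := le_trans u0 ut'.
have mxi k : (k <= n)%N -> measurable_fun setT (xi k : g_sigma_algebraType (H t) -> R).
  by move=> kn; exact: (sys_xiH sys).
have [m0|m0] := posnP m.
  rewrite m0.
  have -> : (X 0%N u : g_sigma_algebraType (H t) -> R) = (fun w => xi 0%N w *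
    Num.sqrt (expR (2 * u) * (1 + xi 0%N w ^+ 2 * (expR (2 * u) - 1))^-1)).
    by apply/funext => w; rewrite sys_X0E.
  apply: measurable_funM; first exact: mxi.
  apply: (@measurableT_comp _ _ _ _ _ _ (@Num.sqrt R)).
    by apply: continuous_measurable_fun; exact: sqrt_continuous.
  apply: measurable_funM => //.
  apply: (@measurableT_comp _ _ _ _ _ _ (@GRing.inv R)); first exact: measurable_inv.
  apply: measurable_funD => //; apply: measurable_funM => //.
  by apply: measurable_funX; exact: mxi.
have m0n : (0 < m <= n)%N by rewrite m0.
have mb v : 0 <= v <= t -> measurable_fun setT (b v : g_sigma_algebraType (H t) -> R).
  exact: (sys_bH sys).
have mX0 v : 0 <= v <= t -> measurable_fun setT (X 0%N v : g_sigma_algebraType (H t) -> R).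
  by move=> vt; exact: IH.
have zt : 0 <= (0 : R) <= t by rewrite lexx.
have mprop v : 0 <= v <= t ->
    measurable_fun setT (propagator X u v : g_sigma_algebraType (H t) -> R).
  by move=> vt; apply: (measurable_propagator (x := (X 0%N : R -> g_sigma_algebraType (H t) -> R))); exact: mX0.
have mlim : measurable_fun setT ((fun w => X m u w - propagator X u 0 w * (xi m w + noise b m u w))
   : g_sigma_algebraType (H t) -> R).
  apply: (@measurable_fun_cvg _ (g_sigma_algebraType (H t)) _ _ (fun N w =>
    riemann_sum (fun s => propagator X u (pos s) w * forcing b X m u s w) 0 u N)).
    move=> N; apply: measurable_sum => j; apply: measurable_funM => //.
    set v := 0 + _.
    have vu : 0 <= v <= u.
      have j1 : 0 <= (j%:R / N.+1%:R : R) <= 1.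
        rewrite divr_ge0//= ler_pdivrMr// mul1r ler_nat.
        by rewrite ltnW.
      rewrite /v add0r subr0; move: j1; set q := _ / _ => /andP[q0 q1].
      by rewrite mulr_ge0//= ler_piMr.
    have vt : 0 <= v <= t by case/andP: vu => -> /le_trans; exact.
    have -> : pos v = v by rewrite max_l//; case/andP: vu.
    apply: measurable_funM; first exact: mprop.
    apply: (measurable_forcing (b' := (b : R -> g_sigma_algebraType (H t) -> R))
      (X' := (X : nat -> R -> g_sigma_algebraType (H t) -> R))) => //.
    - by move=> j' jm; apply: IH => //; exact: leq_trans (ltnW jm) mn.
    - exact: mb.
    - exact: mb.
  by move=> w _; exact: (duhamel_cvg sys m0n u0).
have -> : (X m u : g_sigma_algebraType (H t) -> R) =
  (fun w => (X m u w - propagator X u 0 w * (xi m w + noise b m u w)) +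
     propagator X u 0 w * (xi m w + noise b m u w)).
  by apply/funext => w; rewrite subrK.
apply: measurable_funD => //; apply: measurable_funM; first exact: mprop.
apply: measurable_funD; first exact: mxi.
rewrite /noise; case: (m == 1%N); last exact: measurable_cst.
by apply: measurable_funM => //; exact: mb.
Qed.

End system_adapted.

(** * Increments over short time steps *)

Section step_increments.
Context d (T : measurableType d) (R : realType) (P : probability T R).
Local Notation pos s := (Num.max s 0).

(* A step (t, s, u) consists of a time t, a scale s and a later time u <= t + s^2. *)
Definition steps : Type := {z : R * R * R |
  [&& 0 <= z.1.1, 0 < z.1.2 <= 1 & z.1.1 <= z.2 <= z.1.1 + z.1.2 ^+ 2]}.
Definition step_gauge (z : steps) : R := (val z).1.2.
Definition start (z : steps) : R := (val z).1.1.
Definition stop (z : steps) : R := (val z).2.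

Lemma step_gauge01 z : 0 < step_gauge z <= 1.
Proof. by have /and3P[] := valP z. Qed.

Lemma start_ge0 z : 0 <= start z.
Proof. by have /and3P[] := valP z. Qed.

Lemma start_le_stop z : 0 <= start z <= stop z.
Proof. by have /and3P[h _ /andP[h2 _]] := valP z; rewrite /start /stop h. Qed.

Lemma stop_ge0 z : 0 <= stop z.
Proof. by have /andP[h1 h2] := start_le_stop z; exact: le_trans h2. Qed.

Lemma stop_start z : 0 <= stop z - start z <= step_gauge z ^+ 2.
Proof.
have /and3P[_ _ /andP[h1 h2]] := valP z; rewrite /start /stop /step_gauge.
by rewrite subr_ge0 h1/= lerBlDl.
Qed.

Lemma bigO_start (f : R -> T -> R) :
  bigO P (@unit_gauge R (time R)) 0 (fun t => f (val t)) ->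
  bigO P step_gauge 0 (fun z => f (start z)).
Proof.
exact: (bigO_reindex0 step_gauge (fun z => exist _ (start z) (start_ge0 z) : time R)).
Qed.

Lemma bigO_stop (f : R -> T -> R) :
  bigO P (@unit_gauge R (time R)) 0 (fun t => f (val t)) ->
  bigO P step_gauge 0 (fun z => f (stop z)).
Proof.
exact: (bigO_reindex0 step_gauge (fun z => exist _ (stop z) (stop_ge0 z) : time R)).
Qed.

(** Hölder continuity of exponent 1/2 in time, in every L^p and uniformly, since the step of gauge s
    lasts at most s^2. The class is closed under sums and products. *)
Definition regular (f : R -> T -> R) :=
  bigO P (@unit_gauge R (time R)) 0 (fun t => f (val t)) /\
  bigO P step_gauge 1 (fun z w => f (stop z) w - f (start z) w).

Let u01 I := @unit_gauge01 R I.

Lemma regular_cst (c : R) : regular (fun _ _ => c).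
Proof.
split; first exact: (@bigO_cst _ _ _ P (time R) (@unit_gauge R (time R)) c).
apply: eq_bigO (bigO0 P step_gauge01 1) => z w.
by rewrite subrr.
Qed.

Lemma regularD f g : regular f -> regular g -> regular (fun t w => f t w + g t w).
Proof.
move=> [f0 f1] [g0 g1]; split; first exact: (bigOD f0 g0).
by apply: eq_bigO (bigOD f1 g1) => z w; ring.
Qed.

Lemma regularM f g : regular f -> regular g -> regular (fun t w => f t w * g t w).
Proof.
move=> [f0 f1] [g0 g1]; split; first exact: (bigOMl0 f0 g0).
apply: eq_bigO (bigOD (bigOMl0 (bigO_stop f0) g1) (bigOMl0 (bigO_start g0) f1)) => z w.
ring.
Qed.

Lemma regularN f : regular f -> regular (fun t w => - f t w).
Proof.
move=> rf; have [] := regularM (regular_cst (-1)) rf => h1 h2; split.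
  by apply: eq_bigO h1 => t w; rewrite mulN1r.
by apply: eq_bigO h2 => t w; rewrite !mulN1r.
Qed.

Lemma regularX f k : regular f -> regular (fun t w => f t w ^+ k).
Proof.
move=> rf; elim: k => [|k IH]; first exact: regular_cst.
have -> : (fun t w => f t w ^+ k.+1) = (fun t w => f t w * f t w ^+ k).
  by apply/funext => t; apply/funext => w; rewrite exprS.
exact: regularM.
Qed.

Lemma regular_sum (J : Type) (r : seq J) (Q : pred J) (F : J -> R -> T -> R) :
  (forall j, Q j -> regular (F j)) -> regular (fun t w => \sum_(j <- r | Q j) F j t w).
Proof.
move=> rF; elim: r => [|j r IH].
  have -> : (fun t w => \sum_(j <- [::] | Q j) F j t w) = (fun _ _ => 0).
    by apply/funext => t; apply/funext => w; rewrite big_nil.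
  exact: regular_cst.
have [Qj|Qj] := boolP (Q j).
  have -> : (fun t w => \sum_(j <- j :: r | Q j) F j t w) =
      (fun t w => F j t w + \sum_(j <- r | Q j) F j t w).
    by apply/funext => t; apply/funext => w; rewrite big_cons Qj.
  by apply: regularD => //; exact: rF.
have -> : (fun t w => \sum_(j <- j :: r | Q j) F j t w) =
    (fun t w => \sum_(j <- r | Q j) F j t w).
  by apply/funext => t; apply/funext => w; rewrite big_cons (negbTE Qj).
exact: IH.
Qed.

Lemma regular_prod (J : Type) (r : seq J) (F : J -> R -> T -> R) :
  (forall j, regular (F j)) -> regular (fun t w => \prod_(j <- r) F j t w).
Proof.
move=> rF; elim: r => [|j r IH].
  have -> : (fun t w => \prod_(j <- [::]) F j t w) = (fun _ _ => 1).
    by apply/funext => t; apply/funext => w; rewrite big_nil.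
  exact: regular_cst.
have -> : (fun t w => \prod_(j <- j :: r) F j t w) =
    (fun t w => F j t w * \prod_(j <- r) F j t w).
  by apply/funext => t; apply/funext => w; rewrite big_cons.
exact: regularM.
Qed.

(** A step lasts at most s^2, so integrating over it gains two powers of the gauge. The bound at an
    intermediate time v comes from the step (t, s, v): this is why steps carry a free stopping
    time. *)
Lemma bigO_riemann_limit a (f : R -> R -> T -> R) (D : R -> R -> T -> R) :
  (forall z : steps, measurable_fun setT (D (start z) (stop z))) ->
  (forall (s t : R) w, 0 <= s <= t -> riemann_sum (fun u => f s u w) s t N @[N --> \oo] --> D s t w) ->
  bigO P step_gauge a (fun z w => f (start z) (stop z) w) ->
  bigO P step_gauge a.+2 (fun z w => D (start z) (stop z) w).
Proof.
move=> mD fD Of; apply: bigO_intro => //; first exact: step_gauge01.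
move=> k; have [C hC] := bigO_moment step_gauge01 k Of; exists C => z.
have /andP[g0 g1] := step_gauge01 z.
rewrite -[a.+2]addn2 exprD exprMn mulrA; set t := start z; set u := stop z; set g := step_gauge z.
have zv v : t <= v <= u -> [&& 0 <= t, 0 < g <= 1 & t <= v <= t + g ^+ 2].
  move=> /andP[tv vu]; rewrite start_ge0 step_gauge01 tv/=.
  by rewrite (le_trans vu)// -lerBlDl; have /andP[] := stop_start z.
have inst v (tv : t <= v <= u) := hC (exist _ (t, g, v) (zv v tv)).
apply: (@moment_riemann_limit _ _ _ P (fun v => f t v) _ t u (fun=> 1) (g ^+ 2) _ k) => //.
- exact: start_le_stop.
- by rewrite exprn_gt0.
- move=> v tv; exact: (bigO_measurable (exist _ (t, g, v) (zv v tv) : steps) Of).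
- exact: mD.
- by move=> w; exact: fD (start_le_stop z).
- move=> N; rewrite /riemann_sum sumr_const card_ord mulr1 -[X in X <= _]mulr_natr divfK//.
  by have /andP[] := stop_start z.
- by move=> v tv; rewrite expr1n mulr1; exact: inst.
Qed.

End step_increments.

Section system_increments.
Context d (T : measurableType d) (R : realType) (P : probability T R).
Context (n : nat) (b : R -> T -> R) (xi : nat -> T -> R)
  (X : nat -> R -> T -> R) (H : R -> set (set T)) (lo hi : R)
  (sys : expansion_system P n b xi X H lo hi).
Implicit Types (m k : nat) (s t : R) (w : T).
Local Notation g := (@step_gauge R).
Let g01 := @step_gauge01 R.

Lemma increment_steps : bigO P g 1 (fun z => increment b (start z) (stop z)).
Proof.
apply: bigO_intro => //.
  by move=> z; apply: measurable_funB; exact: (sys_mb sys).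
move=> k; have [C hC] := increment_moment sys k; exists `|C| => z.
apply: le_trans (hC _ _ (start_le_stop z)) _; rewrite lee_fin.
have /andP[g0 g1] := g01 z; have /andP[h0 h1] := stop_start z.
apply: le_trans (_ : `|C| * Num.sqrt (stop z - start z) ^+ (2 ^ k.+1) <= _).
  by rewrite ler_wpM2r ?exprp_ge0// ler_norm.
rewrite ler_wpM2l// lerXn2r ?nnegrE ?sqrtr_ge0 ?exprn_ge0 ?(ltW g0)// expr1.
by apply: le_trans (ler_wsqrtr h1) _; rewrite sqrtr_sqr gtr0_norm.
Qed.

Lemma noise_steps m : bigO P g 1 (fun z w => noise b m (stop z) w - noise b m (start z) w).
Proof.
rewrite /noise; case: (m == 1%N); last first.
  by apply: eq_bigO (bigO0 P g01 1) => z w; rewrite subrr.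
apply: eq_bigO (bigOZ (Num.sqrt 2) increment_steps) => z w.
by rewrite /increment mulrBr.
Qed.

Lemma measurable_noise m t : measurable_fun setT (noise b m t).
Proof.
rewrite /noise; case: (m == 1%N); last exact: measurable_cst.
by apply: measurable_funM => //; exact: (sys_mb sys).
Qed.

(** Without the noise the path moves by O(s^2) over a step; the noise moves by O(s) and sets the
    order. *)
Lemma regular_of_drift m : (m <= n)%N ->
  bigO P (@unit_gauge R (time R)) 0
    (fun (t : time R) w => expansion_drift m (fun k => X k (val t) w)) ->
  regular P (X m).
Proof.
move=> mn Od; split; first exact: (sys_moments sys).
have h : bigO P g 2 (fun z w => X m (stop z) w - noise b m (stop z) w -
    (X m (start z) w - noise b m (start z) w)).
  apply: (@bigO_riemann_limit _ _ _ P 0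
    (fun _ u w => expansion_drift m (fun k => X k u w))
    (fun s t w => X m t w - noise b m t w - (X m s w - noise b m s w))).
  - by move=> z; apply: measurable_funB; apply: measurable_funB;
      solve [exact: (sys_mX sys)|exact: measurable_noise].
  - by move=> s t w st; exact: (drift_cvg sys).
  - exact: (bigO_stop (f := fun u w => expansion_drift m (fun k => X k u w)) Od).
have h' := bigOD (bigO_le g01 (isT : (1 <= 2)%N) h) (noise_steps m).
by apply: eq_bigO h' => z w; ring.
Qed.

Lemma drift_bigO m : (m <= n)%N ->
  bigO P (@unit_gauge R (time R)) 0
    (fun (t : time R) w => expansion_drift m (fun k => X k (val t) w)).
Proof.
move=> mn; have OX k : (k <= n)%N -> _ := sys_moments sys (m := k).
have [->|m0] := posnP m.
  have O0 := OX 0%N (leq0n n).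
  rewrite /expansion_drift/=; apply: bigOB => //.
  by apply: eq_bigO (bigOMl0 O0 (bigOMl0 O0 O0)) => t w; ring.
apply: (@eq_bigO _ _ _ P _ _ _ (fun (t : time R) w => (1 - 3 * X 0%N (val t) w ^+ 2) * X m (val t) w +
   remainder_drift m (fun k => X k (val t) w))).
  by move=> t w; rewrite expansion_driftE.
apply: bigOD; last first.
  apply: (@bigO_remainder_drift _ _ _ P _ _ m (fun k (t : time R) => X k (val t))).
    exact: unit_gauge01.
  by move=> j jm; apply: OX; exact: leq_trans (ltnW jm) mn.
apply: (@bigOMl0 _ _ _ P _ _ _ (fun (t : time R) w => 1 - 3 * X 0%N (val t) w ^+ 2)); last exact: OX.
apply: (@bigO_bounded _ _ _ _ _ _ _ (1 + 3 * hi)).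
  move=> t; apply: measurable_funB => //; apply: measurable_funM => //.
  by apply: measurable_funX; exact: (sys_mX sys).
by move=> [t /= t0] w; exact: (sys_rate_le sys).
Qed.

Lemma sys_regular m : (m <= n)%N -> regular P (X m).
Proof. by move=> mn; apply: regular_of_drift => //; exact: drift_bigO. Qed.

Lemma drift_regular m : (m <= n)%N ->
  regular P (fun t w => expansion_drift m (fun k => X k t w)).
Proof.
move=> mn; have [->|m0] := posnP m.
  rewrite /expansion_drift/=; apply: regularD; first exact: sys_regular.
  by apply: regularN; apply: regularX; exact: sys_regular.
rewrite /expansion_drift gtn_eqF//.
have rX (j : 'I_m.+1) : regular P (X j).
  by apply: sys_regular; exact: leq_trans (leq_ord j) mn.
have r0 := sys_regular (leq0n n).
apply: (@regularD _ _ _ P (fun t w => _ * _ - _) (fun t w => - _)); last first.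
  apply: regularN; apply: regular_sum => j _.
  by apply: regular_prod => k; exact: rX.
apply: (@regularD _ _ _ P (fun t w => _ * _) (fun t w => - _)); last first.
  apply: regularN; apply: regular_sum => j _.
  apply: (@regularM _ _ _ P (fun t w => 3 * X 0%N t w) (fun t w => \prod_(k < 2) X (j k) t w)).
    exact: (regularM (regular_cst P 3) r0).
  by apply: regular_prod => k; exact: rX.
apply: (@regularM _ _ _ P (fun t w => 1 - 3 * X 0%N t w ^+ 2) (X m)); last exact: sys_regular.
apply: (regularD (regular_cst P 1)); apply: regularN.
exact: (regularM (regular_cst P 3) (regularX 2 r0)).
Qed.

(* Freezing the drift at the beginning of the step costs O(s^3). *)
Lemma step_expansion m : (m <= n)%N ->
  bigO P g 3 (fun z w => X m (stop z) w - X m (start z) w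
    - (noise b m (stop z) w - noise b m (start z) w)
    - (stop z - start z) * expansion_drift m (fun k => X k (start z) w)).
Proof.
move=> mn; have mX k t : measurable_fun setT (X k t) by exact: (sys_mX sys).
have md t : measurable_fun setT (fun w => expansion_drift m (fun k => X k t w)).
  have [->|m0] := posnP m.
    by rewrite /expansion_drift/=; apply: measurable_funB => //; exact: measurable_funX.
  under eq_fun do rewrite expansion_driftE//.
  apply: measurable_funD; last by apply: (measurable_remainder_drift (x := fun k => X k t)).
  apply: measurable_funM => //; apply: measurable_funB => //; apply: measurable_funM => //.
  exact: measurable_funX.
have h : bigO P g 3 (fun z w => X m (stop z) w - noise b m (stop z) w -
    (X m (start z) w - noise b m (start z) w) -
    (stop z - start z) * expansion_drift m (fun k => X k (start z) w)).
  (* The integrand is the drift minus its value at the start, which is O(s) by [drift_regular];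
     integration brings it to order three. *)
  apply: (@bigO_riemann_limit _ _ _ P 1
    (fun s u w => expansion_drift m (fun k => X k u w) - expansion_drift m (fun k => X k s w))
    (fun s t w => X m t w - noise b m t w - (X m s w - noise b m s w)
       - (t - s) * expansion_drift m (fun k => X k s w))).
  - move=> z; apply: measurable_funB; last exact: measurable_funM.
    by apply: measurable_funB; apply: measurable_funB => //; exact: measurable_noise.
  - move=> s t w st.
    have -> : riemann_sum (fun u => expansion_drift m (fun k => X k u w) -
         expansion_drift m (fun k => X k s w)) s t =
       (fun N => riemann_sum (fun u => expansion_drift m (fun k => X k u w)) s t N
         - (t - s) * expansion_drift m (fun k => X k s w)).
      apply/funext => N; rewrite /riemann_sum.
      under eq_bigr do rewrite mulrBr.
      rewrite sumrB sumr_const card_ord; congr (_ - _); set c := expansion_drift _ _.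
      by rewrite -[LHS]mulr_natr mulrAC divfK.
    by apply: cvgB; [exact: (drift_cvg sys)|exact: cvg_cst].
  - by have [] := drift_regular mn.
by apply: eq_bigO h => z w; ring.
Qed.

End system_increments.

(** * Stochastic expansion of powers of the fluctuation polynomial *)

Section polynomial_orders.
Context d (T : measurableType d) (R : realType) (P : probability T R).
Context (I : Type) (gamma : I -> R) (gamma01 : forall i, 0 < gamma i <= 1) (n : nat).
Implicit Types (p q : I -> T -> {poly R}) (f : I -> T -> R) (a b : nat).

Definition poly_bigO a p :=
  forall m, (m <= n)%N -> bigO P gamma a (fun i w => (p i w)`_m).

Lemma eq_poly_bigO a p q : (forall i w, p i w = q i w) -> poly_bigO a p -> poly_bigO a q.
Proof. by move=> pq Op m mn; apply: eq_bigO (Op m mn) => i w; rewrite pq. Qed.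

Lemma poly_bigO_le a b p : (b <= a)%N -> poly_bigO a p -> poly_bigO b p.
Proof. by move=> ba Op m mn; exact: bigO_le ba (Op m mn). Qed.

Lemma poly_bigOD a p q : poly_bigO a p -> poly_bigO a q ->
  poly_bigO a (fun i w => p i w + q i w).
Proof.
move=> Op Oq m mn; apply: eq_bigO (bigOD (Op m mn) (Oq m mn)) => i w.
by rewrite coefD.
Qed.

Lemma poly_bigOM a b p q : poly_bigO a p -> poly_bigO b q ->
  poly_bigO (a + b) (fun i w => p i w * q i w).
Proof.
move=> Op Oq m mn.
apply: (@eq_bigO _ _ _ P _ _ _ (fun i w => \sum_(j < m.+1) (p i w)`_j * (q i w)`_(m - j))).
  by move=> i w; rewrite coefM.
apply: bigO_sum => // j _; apply: (bigOM (Op j _) (Oq (m - j)%N _)).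
  exact: leq_trans (leq_ord j) mn.
exact: leq_trans (leq_subr _ _) mn.
Qed.

Lemma poly_bigOC a f : bigO P gamma a f -> poly_bigO a (fun i w => (f i w)%:P).
Proof.
move=> Of [|m] mn; first by apply: eq_bigO Of => i w; rewrite coefC.
by apply: eq_bigO (bigO0 P gamma01 a) => i w; rewrite coefC.
Qed.

Lemma poly_bigO_X : poly_bigO 0 (fun _ _ => 'X).
Proof.
move=> m mn; apply: eq_bigO (bigO_cst P gamma (m == 1%N)%:R) => i w.
by rewrite coefX.
Qed.

Lemma poly_bigON a p : poly_bigO a p -> poly_bigO a (fun i w => - p i w).
Proof. by move=> Op m mn; apply: eq_bigO (bigON (Op m mn)) => i w; rewrite coefN. Qed.

Lemma poly_bigOX p k : poly_bigO 0 p -> poly_bigO 0 (fun i w => p i w ^+ k).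
Proof.
move=> Op; elim: k => [|k IH].
  apply: eq_poly_bigO (poly_bigOC (bigO_cst P gamma 1)) => i w.
  by rewrite expr0.
by apply: eq_poly_bigO (poly_bigOM Op IH) => i w; rewrite exprS.
Qed.

Lemma poly_bigOMn a p k : poly_bigO a p -> poly_bigO a (fun i w => p i w *+ k).
Proof.
move=> Op; apply: eq_poly_bigO (poly_bigOM (poly_bigOC (bigO_cst P gamma k%:R)) Op) => i w.
by rewrite polyC_natr mulr_natl.
Qed.

(* A stochastic Taylor formula: q is the part of e^2 of second order. *)
Lemma poly_bigO_power y y' e q r i :
  poly_bigO 0 y -> poly_bigO 1 e -> poly_bigO 2 q -> poly_bigO 3 r ->
  (forall i w, y' i w = y i w + e i w + r i w) ->
  poly_bigO 3 (fun i w => e i w ^+ 2 - q i w *+ 2) ->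
  poly_bigO 3 (fun k w => y' k w ^+ i - (y k w ^+ i + (y k w ^+ i.-1 *+ i) * e k w +
    (y k w ^+ i.-2 *+ (i * i.-1)) * q k w)).
Proof.
move=> Oy Oe Oq Or yE Oeq.
have Oy' : poly_bigO 0 y'.
  have h := poly_bigOD (poly_bigOD Oy (poly_bigO_le (isT : (0 <= 1)%N) Oe))
    (poly_bigO_le (isT : (0 <= 3)%N) Or).
  by apply: eq_poly_bigO h => k w; rewrite yE.
(* [A], [B] and [C] are the coefficients of 1, e and q; with q standing for e^2 / 2 the binomial
   factor j (j - 1) / 2 becomes j (j - 1). Multiplying by y' = y + e + r reproduces them through
   [AS], [BS] and [CS], up to products of total order at least three. *)
pose A j k w := y k w ^+ j.
pose B j k w := y k w ^+ j.-1 *+ j.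
pose C j k w := y k w ^+ j.-2 *+ (j * j.-1).
have OA j : poly_bigO 0 (A j) by exact: poly_bigOX.
have OB j : poly_bigO 0 (B j) by apply: poly_bigOMn; exact: poly_bigOX.
have OC j : poly_bigO 0 (C j) by apply: poly_bigOMn; exact: poly_bigOX.
have AS j k w : A j.+1 k w = y k w * A j k w by rewrite /A exprS.
have BS j k w : B j.+1 k w = y k w * B j k w + A j k w.
  rewrite /B /A mulrS addrC mulrnAr; case: j => [|j]; first by rewrite !mulr0n.
  by rewrite -exprS.
have CS j k w : C j.+1 k w = y k w * C j k w + B j k w *+ 2.
  rewrite /C /B -mulrnA mulrnAr; case: j => [|[|j]]/=.
  - by rewrite !mulr0n addr0.
  - by rewrite !mulr0n add0r.
  by rewrite -exprS -mulrnDr; congr (_ *+ _); lia.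
have -> : (fun k w => y' k w ^+ i - (y k w ^+ i + (y k w ^+ i.-1 *+ i) * e k w +
    (y k w ^+ i.-2 *+ (i * i.-1)) * q k w)) =
    (fun k w => y' k w ^+ i - (A i k w + B i k w * e k w + C i k w * q k w)) by [].
elim: i => [|i IH].
  have h : poly_bigO 3 (fun _ _ => 0%:P) by apply: poly_bigOC; exact: bigO0.
  apply: eq_poly_bigO h => k w.
  by rewrite /A /B /C !mulr0n !mul0r !addr0 expr0 subrr.
have h1 := poly_bigOM Oy' IH.
have h2 := poly_bigOM (OB i) Oeq.
have h3 := poly_bigOM (OC i) (poly_bigOM Oq Oe).
have h4 := poly_bigOM Or (OA i).
have h5 := poly_bigOM Or (poly_bigOM (OB i) (poly_bigO_le (isT : (0 <= 1)%N) Oe)).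
have h6 := poly_bigOM Or (poly_bigOM (OC i) (poly_bigO_le (isT : (0 <= 2)%N) Oq)).
have h := poly_bigOD h1 (poly_bigOD h2 (poly_bigOD h3 (poly_bigOD h4 (poly_bigOD h5 h6)))).
apply: eq_poly_bigO h => k w; rewrite [_ ^+ i.+1]exprS AS BS CS yE; ring.
Qed.

End polynomial_orders.

Section fluctuation.
Context d (T : measurableType d) (R : realType) (P : probability T R).
Context (n : nat) (b : R -> T -> R) (xi : nat -> T -> R)
  (X : nat -> R -> T -> R) (H : R -> set (set T)) (lo hi : R)
  (sys : expansion_system P n b xi X H lo hi).
Implicit Types (m k i : nat) (s t : R) (w : T).
Local Notation g := (@step_gauge R).
Let g01 := @step_gauge01 R.

(* Generating polynomial of the coefficients of positive order; 'X stands for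
   the square root of epsilon. *)
Definition fluctuation t w : {poly R} :=
  \poly_(j < n.+1) (if j == 0%N then 0 else X j t w).

(** With f(x) = x - x^3 this is f(X_0 + Y) - f(X_0), expanded in Y. The equations of positive order
    are thus the coefficients of one equation, with noise sqrt(2) 'X dW, modulo 'X^(n+1). *)
Definition fluctuation_drift t w : {poly R} :=
  (1 - 3 * X 0%N t w ^+ 2)%:P * fluctuation t w
  - (3 * X 0%N t w)%:P * fluctuation t w ^+ 2 - fluctuation t w ^+ 3.

Lemma coef_fluctuation t w m : (0 < m <= n)%N -> (fluctuation t w)`_m = X m t w.
Proof. by move=> /andP[m0 mn]; rewrite coef_poly ltnS mn gtn_eqF. Qed.

Lemma fluctuation0 t w : (fluctuation t w)`_0 = 0.
Proof. by rewrite coef_poly. Qed.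

Lemma coef_fluctuation_exp t w i m : (0 < i)%N -> (m <= n)%N ->
  (fluctuation t w ^+ i)`_m = \sum_(j in compositions i m) \prod_k X (j k) t w.
Proof.
move=> i0 mn; rewrite coef_exp_compositions ?fluctuation0//.
apply: eq_bigr => j jc; apply: eq_bigr => k _; rewrite coef_fluctuation//.
by rewrite (composition_gt0 k jc) (leq_trans (leq_ord _) mn).
Qed.

Lemma coef_fluctuation_gt t w i m : (m <= n)%N -> (m < i)%N -> (fluctuation t w ^+ i)`_m = 0.
Proof.
move=> mn mi; rewrite coef_fluctuation_exp ?(leq_ltn_trans _ mi)// big1// => j.
rewrite inE => /and3P[_ /forallP h /eqP e].
have : (\sum_(k < i) 1 <= \sum_(k < i) j k)%N by apply: leq_sum => k _; exact: h.
by rewrite e sum1_card card_ord leqNgt mi.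
Qed.

Lemma coef_fluctuation_drift t w m : (0 < m <= n)%N ->
  (fluctuation_drift t w)`_m = expansion_drift m (fun k => X k t w).
Proof.
move=> m0n; have /andP[m0 mn] := m0n.
rewrite /expansion_drift gtn_eqF// /fluctuation_drift !coefB !coefCM.
rewrite coef_fluctuation// !coef_fluctuation_exp//.
by congr (_ - _ - _); rewrite big_distrr.
Qed.

Lemma fluctuation_drift0 t w : (fluctuation_drift t w)`_0 = 0.
Proof.
by rewrite /fluctuation_drift !coefB !coefCM !exprS !coef0M fluctuation0 !mul0r !mulr0 !subr0.
Qed.

Lemma fluctuation_bigO : poly_bigO P (@unit_gauge R (time R)) n 0
  (fun (t : time R) => fluctuation (val t)).
Proof.
move=> m mn; have [->|m0] := posnP m.
  apply: eq_bigO (bigO_cst P (@unit_gauge R (time R)) 0) => t w.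
  by rewrite fluctuation0.
apply: eq_bigO (sys_moments sys mn) => t w.
by rewrite coef_fluctuation// m0.
Qed.

Lemma fluctuation_start : poly_bigO P g n 0 (fun z => fluctuation (start z)).
Proof.
move=> m mn; exact: (bigO_start (f := fun t w => (fluctuation t w)`_m) (fluctuation_bigO mn)).
Qed.

Lemma X0_start : bigO P g 0 (fun z => X 0%N (start z)).
Proof. exact: bigO_start (sys_moments sys (leq0n n)). Qed.

Definition noise_part (z : steps R) w : {poly R} :=
  (Num.sqrt 2 * increment b (start z) (stop z) w)%:P * 'X.

(** Half of the square of [noise_part]; its expectation produces the second order term of the
    generator. *)
Definition square_part (z : steps R) w : {poly R} :=
  (increment b (start z) (stop z) w ^+ 2)%:P * 'X^2.

Lemma step_length_bigO : bigO P g 2 (fun z _ => stop z - start z).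
Proof.
apply: (bigO_dom (c := 1)) (bigO_gauge P g01 2) => [z|z w]; first exact: measurable_cst.
have /andP[h1 h2] := stop_start z.
by rewrite mul1r !ger0_norm// exprn_ge0//; have /andP[/ltW] := g01 z.
Qed.

Lemma fluctuation_drift_bigO :
  poly_bigO P g n 0 (fun z => fluctuation_drift (start z)).
Proof.
have O0 := fluctuation_start; have Ox0 := X0_start.
have OC a f : bigO P g a f -> poly_bigO P g n a (fun z w => (f z w)%:P) by exact: poly_bigOC.
have O1' := bigOB (bigO_cst P g 1) (bigOZ 3 (bigOM Ox0 Ox0)).
have h1 := poly_bigOM g01 (OC _ _ O1') O0.
have h2 := poly_bigOM g01 (OC _ _ (bigOZ 3 Ox0)) (poly_bigOX g01 2 O0).
have h3 := poly_bigOX g01 3 O0.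
by apply: eq_poly_bigO (poly_bigOD (poly_bigOD h1 (poly_bigON h2)) (poly_bigON h3)).
Qed.

Lemma fluctuation_step i :
  poly_bigO P g n 3 (fun z w => fluctuation (stop z) w ^+ i -
    (fluctuation (start z) w ^+ i +
     (fluctuation (start z) w ^+ i.-1 *+ i) *
       ((stop z - start z)%:P * fluctuation_drift (start z) w + noise_part z w) +
     (fluctuation (start z) w ^+ i.-2 *+ (i * i.-1)) * square_part z w)).
Proof.
have O0 := fluctuation_start.
have OC a f : bigO P g a f -> poly_bigO P g n a (fun z w => (f z w)%:P) by exact: poly_bigOC.
have Oh := OC _ _ step_length_bigO.
have OX := @poly_bigO_X _ _ _ P _ g n.
have Or := fluctuation_drift_bigO.
have On : poly_bigO P g n 1 noise_part.
  have h := poly_bigOM g01 (OC _ _ (bigOZ (Num.sqrt 2) (increment_steps sys))) OX.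
  exact: h.
have Ohb := poly_bigOM g01 Oh Or.
have Oq : poly_bigO P g n 2 square_part.
  have h := poly_bigOM g01 (OC _ _ (bigOM (increment_steps sys) (increment_steps sys)))
    (poly_bigOX g01 2 OX).
  by apply: eq_poly_bigO h => z w; rewrite /square_part expr2.
have le12 : (1 <= 2)%N by [].
apply: (poly_bigO_power g01 (y := fun z => fluctuation (start z))
  (r := fun z w => fluctuation (stop z) w - fluctuation (start z) w -
    ((stop z - start z)%:P * fluctuation_drift (start z) w + noise_part z w))) => //.
- apply: poly_bigOD => //; exact: (poly_bigO_le g01 le12 Ohb).
- move=> m mn; have [->|m0] := posnP m.
    apply: eq_bigO (bigO0 P g01 3) => z w.
    rewrite /noise_part !coefB coefD !coefCM !fluctuation0 fluctuation_drift0 coefX.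
    by rewrite !mulr0 addr0 !subrr.
  apply: eq_bigO (step_expansion sys mn) => z w.
  have m0n : (0 < m <= n)%N by rewrite m0.
  rewrite !coefB coefD !coef_fluctuation// coefCM coef_fluctuation_drift//.
  rewrite /noise_part coefCM coefX /increment.
  by rewrite /noise; case: (m == 1%N) => /=; rewrite ?mulr1 ?mulr0; ring.
- by move=> z w; ring.
(* In the square of drift part plus noise part, the pure drift term is of order four and the cross
   term of order three; only the square of the noise survives. *)
- have h1 := poly_bigOM g01 Ohb Ohb.
  have h2 := poly_bigOM g01 Ohb On.
  have h := poly_bigOD (poly_bigO_le g01 (isT : (3 <= 4)%N) h1) (poly_bigOMn g01 2 h2).
  apply: eq_poly_bigO h => z w.
  rewrite /noise_part /square_part.
  have E : (Num.sqrt 2 * increment b (start z) (stop z) w)%:P ^+ 2 =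
     (increment b (start z) (stop z) w ^+ 2)%:P *+ 2 :> {poly R}.
    rewrite -polyC_exp exprMn sqr_sqrtr// polyCM.
    by rewrite polyC_natr mulr_natl.
  by ring: E.
Qed.

End fluctuation.

Lemma measurable_coefM d (T : measurableType d) (R : realType) (p q : T -> {poly R}) m :
  (forall j, (j <= m)%N -> measurable_fun setT (fun w => (p w)`_j)) ->
  (forall j, (j <= m)%N -> measurable_fun setT (fun w => (q w)`_j)) ->
  measurable_fun setT (fun w => (p w * q w)`_m).
Proof.
move=> mp mq; under eq_fun do rewrite coefM.
apply: measurable_sum => j; apply: measurable_funM; first by apply: mp; exact: leq_ord.
by apply: mq; exact: leq_subr.
Qed.

Lemma measurable_coefX d (T : measurableType d) (R : realType) (p : T -> {poly R}) k m :
  (forall j, (j <= m)%N -> measurable_fun setT (fun w => (p w)`_j)) ->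
  measurable_fun setT (fun w => (p w ^+ k)`_m).
Proof.
elim: k m => [|k IH] m mp.
  under eq_fun do rewrite expr0.
  exact: measurable_cst.
under eq_fun do rewrite exprS.
apply: measurable_coefM => // j jm; apply: IH => l lj.
by apply: mp; exact: leq_trans lj jm.
Qed.

(** * Long time limits in one well *)

Section one_sided_limit.
Context d (T : measurableType d) (R : realType) (P : probability T R).
Context (n : nat) (b : R -> T -> R) (xi : nat -> T -> R)
  (X : nat -> R -> T -> R) (H : R -> set (set T)) (lo hi : R)
  (sys : expansion_system P n b xi X H lo hi) (sg : R) (sg1 : sg ^+ 2 = 1).
Implicit Types (m k i : nat) (s t : R) (w : T).
Local Notation g := (@step_gauge R).
Local Notation Y := (fluctuation n X).
Local Notation A := [set w | 0 < sg * xi 0%N w].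
Let g01 := @step_gauge01 R.

Lemma sys_sigma_measurable t B : <<s H t >> B -> measurable B.
Proof.
apply: smallest_sub; last exact: (sys_H sys).
exact: sigma_algebra_measurable.
Qed.

Lemma adapted_measurable t (K : T -> R) :
  measurable_fun setT (K : g_sigma_algebraType (H t) -> R) -> measurable_fun setT K.
Proof.
move=> mK _ B mB; rewrite setTI; apply: (@sys_sigma_measurable t).
by have := mK measurableT B mB; rewrite setTI.
Qed.

(** Independence of the increment from the past replaces the martingale property and Ito's isometry:
    the weight [K] is known at time s, so expectations factor. *)
Lemma adapted_increment (K : T -> R) s t : 0 <= s < t ->
  measurable_fun setT (K : g_sigma_algebraType (H s) -> R) ->
  P.-integrable setT (EFin \o K) ->
  P.-integrable setT (fun w => (K w * increment b s t w)%:E) ->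
  P.-integrable setT (fun w => (K w * increment b s t w ^+ 2)%:E) ->
  P.-integrable setT (fun w => (increment b s t w)%:E) ->
  P.-integrable setT (fun w => (increment b s t w ^+ 2)%:E) ->
  \int[P]_w (K w * increment b s t w) = 0 /\
  \int[P]_w (K w * increment b s t w ^+ 2) = (t - s) * \int[P]_w K w.
Proof.
move=> /andP[s0 st] mK iK iK1 iK2 i1 i2.
have mT := adapted_measurable mK.
have mD : measurable_fun setT (increment b s t).
  by apply: measurable_funB; exact: (sys_mb sys).
have sH B : measurable B -> <<s H s >> (K @^-1` B).
  by move=> mB; have := mK measurableT B mB; rewrite setTI.
have s0t : 0 <= s < t by rewrite s0.
have sts : 0 < Num.sqrt (t - s) by rewrite sqrtr_gt0 subr_gt0.
have nD := sys_normal sys s0t.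
split; rewrite /Rintegral.
  rewrite (integral_indep mT mD)//; last first.
    by move=> B C mB mC; apply: (sys_indep sys s0t) => //; exact: sH.
  by rewrite (normal_mean mD sts nD) mule0.
rewrite (integral_indep mT (measurable_funX 2 mD))//; last first.
  move=> B C mB mC.
  have -> : (fun w => increment b s t w ^+ 2) @^-1` C =
      increment b s t @^-1` ((fun x => x ^+ 2) @^-1` C) by [].
  apply: (sys_indep sys s0t); first exact: sH.
  by rewrite -[X in measurable X]setTI; exact: (measurable_funX 2 (@measurable_id _ R setT)).
rewrite (normal_variance mD sts nD) sqr_sqrtr ?subr_ge0 ?ltW// muleC fineM//.
exact: integrable_fin_num.
Qed.

(** [sg] is 1 or -1 and selects the well. The factor [sg ^+ i] turns the barred numbers into
    c_{m,i}, so one argument covers both wells. *)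
Definition sided_weight i w : R := \1_A w * sg ^+ i.
Local Notation J := sided_weight.

Definition sided_mean m i t : R := \int[P]_w (J i w * (Y t w ^+ i)`_m).

Lemma measurable_sided_weight i t : 0 <= t ->
  measurable_fun setT (J i : g_sigma_algebraType (H t) -> R).
Proof.
move=> t0; apply: measurable_funM => //.
apply: (@measurable_indic _ (g_sigma_algebraType (H t))).
have := sys_xiH sys (leq0n n) t0 => mxi.
have -> : A = setT `&` (fun w => sg * xi 0%N w) @^-1` `]0, +oo[%classic.
  by rewrite setTI; apply/seteqP; split => w /=; rewrite in_itv/= andbT.
have mf : measurable_fun setT ((fun w => sg * xi 0%N w) : g_sigma_algebraType (H t) -> R).
  exact: measurable_funM.
by apply: mf.
Qed.

Lemma sided_weight_bigO (I : Type) (ga : I -> R) i : bigO P ga 0 (fun _ => J i).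
Proof.
apply: (@bigO_bounded _ _ _ _ _ _ _ `|sg ^+ i|) => [_|_ w].
  exact: adapted_measurable (measurable_sided_weight i (lexx 0)).
by rewrite normrM ler_piMl// indicE; case: (_ \in _); rewrite ?normr1 ?normr0.
Qed.

Lemma measurable_coef_fluctuation t m : 0 <= t ->
  measurable_fun setT ((fun w => (Y t w)`_m) : g_sigma_algebraType (H t) -> R).
Proof.
move=> t0; under eq_fun do rewrite coef_poly.
case: ltnP => [mn|_]; last exact: measurable_cst.
case: eqP => _; first exact: measurable_cst.
by apply: (sys_adapted sys) => //; rewrite t0 lexx.
Qed.

Lemma power_bigO i : poly_bigO P (@unit_gauge R (time R)) n 0
  (fun (t : time R) w => Y (val t) w ^+ i).
Proof. by apply: poly_bigOX; [exact: unit_gauge01|exact: (fluctuation_bigO sys)]. Qed.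

Lemma sided_mean_bound m i : (m <= n)%N ->
  exists M, forall t, 0 <= t -> `|sided_mean m i t| <= M.
Proof.
move=> mn.
have [C hC] := bigO_expectation (@unit_gauge01 R _)
  (bigOMl0 (@sided_weight_bigO _ (@unit_gauge R (time R)) i) (power_bigO i mn)).
exists C => t t0; have := hC (exist _ t t0).
by rewrite expr0 mulr1.
Qed.

Definition sided_drift m i t w : R := J i w *
  ((Y t w ^+ i.-1 *+ i) * fluctuation_drift n X t w +
   (Y t w ^+ i.-2 *+ (i * i.-1)) * 'X^2)`_m.

(** In expectation, the linear noise term of [fluctuation_step] vanishes and the squared increment
    becomes s^2, so the mean moves along the drift. The constant does not depend on t. *)
Lemma sided_step m i : (m <= n)%N -> exists C, forall t s, 0 <= t -> 0 < s <= 1 ->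
  `|sided_mean m i (t + s ^+ 2) - sided_mean m i t
    - s ^+ 2 * \int[P]_w sided_drift m i t w| <= C * s ^+ 3.
Proof.
move=> mn.
have u01 := @unit_gauge01 R (time R).
have OJ := @sided_weight_bigO _ g i.
have [C hC] := bigO_expectation g01 (bigOMl0 OJ (fluctuation_step sys i mn)).
have le t s : 0 <= t -> 0 < s <= 1 ->
    [&& 0 <= (t, s, t + s ^+ 2).1.1, 0 < (t, s, t + s ^+ 2).1.2 <= 1 &
      (t, s, t + s ^+ 2).1.1 <= (t, s, t + s ^+ 2).2 <=
        (t, s, t + s ^+ 2).1.1 + (t, s, t + s ^+ 2).1.2 ^+ 2].
  by move=> t0 s01/=; rewrite t0 s01 lexx lerDl sqr_ge0.
exists C => t s t0 s01.
pose z : steps R := exist _ (t, s, t + s ^+ 2) (le t s t0 s01).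
have := hC z; rewrite -/(step_gauge z).
have -> : step_gauge z = s by [].
congr (`|_| <= _).
have OY := fluctuation_start sys.
have Oi := poly_bigOMn g01 i (poly_bigOX g01 i.-1 OY).
have Oii := poly_bigOMn g01 (i * i.-1) (poly_bigOX g01 i.-2 OY).
have Ob := fluctuation_drift_bigO sys.
have OX := @poly_bigO_X _ _ _ P _ g n.
have OW := increment_steps sys.
have OW2 : bigO P g 2 (fun z w => increment b (start z) (stop z) w ^+ 2).
  by apply: eq_bigO (bigOM OW OW) => z' w; rewrite expr2.
have OD : bigO P g 0 (fun z w => J i w * ((Y (start z) w ^+ i.-1 *+ i) *
    fluctuation_drift n X (start z) w)`_m).
  exact: bigOMl0 OJ (poly_bigOM g01 Oi Ob mn).
have OK1 : bigO P g 0 (fun z w => J i w * ((Y (start z) w ^+ i.-1 *+ i) * 'X)`_m).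
  exact: bigOMl0 OJ (poly_bigOM g01 Oi OX mn).
have OK2 : bigO P g 0 (fun z w => J i w * ((Y (start z) w ^+ i.-2 *+ (i * i.-1)) * 'X^2)`_m).
  exact: bigOMl0 OJ (poly_bigOM g01 Oii (poly_bigOX g01 2 OX) mn).
have Og : bigO P g 0 (fun z w => J i w * (Y (start z) w ^+ i)`_m).
  exact: bigOMl0 OJ (poly_bigOX g01 i OY mn).
have Og' : bigO P g 0 (fun z w => J i w * (Y (stop z) w ^+ i)`_m).
  apply: bigOMl0 OJ _.
  exact: (bigO_stop (f := fun t w => (Y t w ^+ i)`_m) (power_bigO i mn)).
pose h := stop z - start z.
have hE : h = s ^+ 2 by rewrite /h /start /stop/= addrC addKr.
pose W := increment b t (t + s ^+ 2).
pose D w := J i w * ((Y t w ^+ i.-1 *+ i) * fluctuation_drift n X t w)`_m.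
pose K1 w := J i w * ((Y t w ^+ i.-1 *+ i) * 'X)`_m.
pose K2 w := J i w * ((Y t w ^+ i.-2 *+ (i * i.-1)) * 'X^2)`_m.
have mcoef k l p m' : measurable_fun setT
    ((fun w => ((Y t w ^+ k *+ l) * 'X^p)`_m') : g_sigma_algebraType (H t) -> R).
  apply: (@measurable_coefM _ (g_sigma_algebraType (H t)) R
    (fun w => Y t w ^+ k *+ l) (fun _ => 'X^p)) => j jm; last exact: measurable_cst.
  under eq_fun do rewrite coefMn -mulr_natr.
  apply: measurable_funM => //.
  apply: (@measurable_coefX _ (g_sigma_algebraType (H t)) R (Y t)) => j' _.
  exact: measurable_coef_fluctuation.
have mK1 : measurable_fun setT (K1 : g_sigma_algebraType (H t) -> R).
  apply: measurable_funM; first exact: measurable_sided_weight.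
  by have := mcoef i.-1 i 1%N m; rewrite expr1.
have mK2 : measurable_fun setT (K2 : g_sigma_algebraType (H t) -> R).
  by apply: measurable_funM; [exact: measurable_sided_weight|exact: mcoef].
have ts : 0 <= t < t + s ^+ 2.
  by rewrite t0 ltrDl exprn_gt0//; have /andP[] := s01.
have int0 a f (Of : bigO P g a f) : P.-integrable setT (EFin \o f z) := bigO_integrable g01 z Of.
have iW := int0 _ _ OW; have iW2 := int0 _ _ OW2.
have iK1 := int0 _ _ OK1; have iK2 := int0 _ _ OK2.
have iK1W := int0 _ _ (bigOM OK1 OW); have iK1W2 := int0 _ _ (bigOM OK1 OW2).
have iK2W := int0 _ _ (bigOM OK2 OW); have iK2W2 := int0 _ _ (bigOM OK2 OW2).
have [e1 _] := adapted_increment ts mK1 iK1 iK1W iK1W2 iW iW2.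
have [_ e2] := adapted_increment ts mK2 iK2 iK2W iK2W2 iW iW2.
have iD := int0 _ _ OD; have ig := int0 _ _ Og; have ig' := int0 _ _ Og'.
have mB f f' : P.-integrable setT (EFin \o f) -> P.-integrable setT (EFin \o f') ->
    P.-integrable setT (EFin \o (fun w => f w - f' w)) /\
    \int[P]_w (f w - f' w) = \int[P]_w f w - \int[P]_w f' w.
  move=> i1 i2; split; last exact: RintegralB.
  by apply: eq_integrable (integrableB measurableT i1 i2) => // w _; rewrite /= EFinB.
have mZ c f : P.-integrable setT (EFin \o f) ->
    P.-integrable setT (EFin \o (fun w => c * f w)) /\
    \int[P]_w (c * f w) = c * \int[P]_w f w.
  move=> i1; split; last exact: RintegralZl.
  by apply: eq_integrable (integrableZl measurableT c i1) => // w _; rewrite /= EFinM.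
have [iZ1 eZ1] := mZ (Num.sqrt 2) _ iK1W.
have [iZD eZD] := mZ h _ iD.
have [i12 e12] := mB _ _ ig' ig.
have [i13 e13] := mB _ _ i12 iZD.
have [i14 e14] := mB _ _ i13 iZ1.
have [i15 e15] := mB _ _ i14 iK2W2.
have -> : \int[P]_w sided_drift m i t w = \int[P]_w D w + \int[P]_w K2 w.
  rewrite -RintegralD//; apply: eq_Rintegral => w _.
  by rewrite /sided_drift coefD mulrDr.
have -> : \int[P]_w (J i w * (Y (stop z) w ^+ i - (Y (start z) w ^+ i +
     (Y (start z) w ^+ i.-1 *+ i) * ((stop z - start z)%:P * fluctuation_drift n X (start z) w
       + noise_part b z w) +
     (Y (start z) w ^+ i.-2 *+ (i * i.-1)) * square_part b z w))`_m) =
  \int[P]_w (J i w * (Y (stop z) w ^+ i)`_m - J i w * (Y (start z) w ^+ i)`_m - h * D w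
    - Num.sqrt 2 * (K1 w * W w) - K2 w * W w ^+ 2).
  apply: eq_Rintegral => w _; rewrite /noise_part /square_part -/h /D /K1 /K2 /W.
  have tE : start z = t by [].
  have uE : stop z = t + s ^+ 2 by [].
  rewrite tE uE mulrDr [_ * (h%:P * _)]mulrCA [_ * ((Num.sqrt 2 * _)%:P * _)]mulrCA.
  rewrite [_ * ((_ ^+ 2)%:P * _)]mulrCA.
  rewrite !(coefB, coefD) !coefCM; ring.
rewrite e15 e14 e13 e12 eZ1 eZD e1 e2 hE /sided_mean.
have -> : stop z = t + s ^+ 2 by [].
have -> : start z = t by [].
rewrite [t + _]addrC addrK -[s ^+ 2 + t]addrC; ring.
Qed.

End one_sided_limit.

Lemma expR_decay (R : realType) : expR (- 2 * t) @[t --> +oo] --> (0 : R).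
Proof.
have h : (fun t : R => 2 * t) @ +oo --> +oo by apply: gt0_cvgMry => //; exact: cvg_id.
have -> : (fun t : R => expR (- 2 * t)) = (fun x => expR (- x)) \o (fun t => 2 * t).
  by apply/funext => t /=; rewrite mulNr.
exact: cvg_comp h (@cvgr_expR R).
Qed.

Section one_sided_recursion.
Context d (T : measurableType d) (R : realType) (P : probability T R).
Context (n : nat) (b : R -> T -> R) (xi : nat -> T -> R)
  (X : nat -> R -> T -> R) (H : R -> set (set T)) (lo hi : R)
  (sys : expansion_system P n b xi X H lo hi) (sg : R) (sg1 : sg ^+ 2 = 1).
Implicit Types (m k i : nat) (s t : R) (w : T).
Local Notation Y := (fluctuation n X).
Local Notation A := [set w | 0 < sg * xi 0%N w].
Local Notation J := (sided_weight xi sg).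
Local Notation mean := (sided_mean P n xi X sg).

Lemma measurable_sided : measurable A.
Proof.
have -> : A = setT `&` (fun w => sg * xi 0%N w) @^-1` `]0, +oo[%classic.
  by rewrite setTI; apply/seteqP; split => w /=; rewrite in_itv/= andbT.
have mf : measurable_fun setT (fun w => sg * xi 0%N w).
  by apply: measurable_funM => //; exact: (sys_mxi sys).
by apply: mf.
Qed.

(** On the selected event X_0 has the sign of [sg], so |X_0 + sg| >= 1 and dividing X_0^2 - 1 by
    this factor costs nothing. *)
Lemma sided_X0 t w : 0 <= t ->
  `|\1_A w * (X 0%N t w - sg)| <= hi / lo * expR (- 2 * t).
Proof.
move=> t0; apply: le_trans (sys_X0_limit sys w t0).
rewrite indicE; case: (boolP (w \in A)) => [|_]; last by rewrite mul0r normr0.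
rewrite inE/= mul1r => Aw.
have [k k0 xk] := sys_X0_sign sys w t0.
have sx : 0 < sg * X 0%N t w by rewrite xk mulrCA mulr_gt0.
have -> : X 0%N t w ^+ 2 - 1 = (X 0%N t w - sg) * (X 0%N t w + sg).
  by rewrite -subr_sqr sg1.
have s1 : `|sg| = 1.
  by apply/eqP; rewrite -(@eqrXn2 _ 2)// real_normK ?num_real// sg1 expr1n.
rewrite normrM ler_peMr// -[leRHS]mul1r -s1 -normrM mulrDr -expr2 sg1.
by rewrite ger0_norm; lra.
Qed.

(** Multiplied by exp(2t), the first factor is bounded, and the [bigO] calculus applies to the
    product. *)
Lemma decaying_mean (a f : R -> T -> R) C :
  (forall t, 0 <= t -> measurable_fun setT (a t)) ->
  (forall t w, 0 <= t -> `|a t w| <= C * expR (- 2 * t)) ->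
  bigO P (@unit_gauge R (time R)) 0 (fun t : time R => f (val t)) ->
  \int[P]_w (a t w * f t w) @[t --> +oo] --> 0.
Proof.
move=> ma aC Of.
have Oa : bigO P (@unit_gauge R (time R)) 0
    (fun (t : time R) w => expR (2 * val t) * a (val t) w).
  apply: (@bigO_bounded _ _ _ _ _ _ _ C) => [[t t0]|[t /= t0] w].
    by apply: measurable_funM => //; exact: ma.
  rewrite normrM ger0_norm ?expR_ge0//.
  apply: le_trans (ler_wpM2l (expR_ge0 _) (aC t w t0)) _.
  by rewrite mulrCA -expRD mulNr addrN expR0 mulr1.
have Oaf := bigOMl0 Oa Of.
have [C' hC'] := bigO_expectation (@unit_gauge01 R _) Oaf.
have bound t : 0 <= t -> `|\int[P]_w (a t w * f t w)| <= C' * expR (- 2 * t).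
  move=> t0; have := hC' (exist _ t t0 : time R); rewrite expr0 mulr1 /=.
  under eq_Rintegral do rewrite -mulrA.
  rewrite RintegralZl//; last first.
    have h := bigO_integrable (@unit_gauge01 R _) (exist _ t t0 : time R) Oaf.
    apply: eq_integrable (integrableZl measurableT (expR (- 2 * t)) h) => // w _.
    by rewrite /= -EFinM mulrA mulrA -expRD mulNr addNr expR0 mul1r.
  rewrite normrM (ger0_norm (expR_ge0 _)) mulrC -ler_pdivlMr ?expR_gt0//.
  by rewrite -expRN mulNr.
have e0 : C' * expR (- 2 * t) @[t --> +oo] --> 0.
  by rewrite -[X in _ --> X](mulr0 C'); apply: cvgMr; exact: expR_decay.
apply: (squeeze_cvgr (f := fun t => - (C' * expR (- 2 * t)))
  (h := fun t => C' * expR (- 2 * t))).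
  near=> t; rewrite -ler_norml; apply: bound; near: t; exact: nbhs_pinfty_ge.
by rewrite -[X in _ --> X]oppr0; exact: cvgN.
Unshelve. all: by end_near. Qed.

(** Writing 1 - 3 X_0^2 = -2 + 3 (1 - X_0^2) isolates the rate 2 i, and X_0 = sg + (X_0 - sg) does
    the same for the quadratic term. The two leftover integrals decay exponentially; [sg] itself is
    absorbed by the weight of index i + 1. *)
Definition sided_remainder m i t : R :=
  3 * i%:R * \int[P]_w ((1 - X 0%N t w ^+ 2) * (J i w * (Y t w ^+ i)`_m))
  - 3 * i%:R * \int[P]_w ((\1_A w * (X 0%N t w - sg)) * (J i w * (Y t w ^+ i.+1)`_m))
  - 3 * i%:R * mean m i.+1 t - i%:R * mean m i.+2 t
  + (i * i.-1)%:R * mean (m - 2) (i - 2) t.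

(** Written as a chain of differences, double minus included, so that a single rule for the integral
    of a difference separates all the terms. *)
Lemma sided_driftE m i t w : (0 < i <= m)%N -> sided_drift n xi X sg m i t w =
  3 * i%:R * ((1 - X 0%N t w ^+ 2) * (J i w * (Y t w ^+ i)`_m))
  - 3 * i%:R * ((\1_A w * (X 0%N t w - sg)) * (J i w * (Y t w ^+ i.+1)`_m))
  - 2 * i%:R * (J i w * (Y t w ^+ i)`_m) - 3 * i%:R * (J i.+1 w * (Y t w ^+ i.+1)`_m)
  - i%:R * (J i.+2 w * (Y t w ^+ i.+2)`_m)
  - - (i * i.-1)%:R * (J (i - 2)%N w * (Y t w ^+ (i - 2))`_(m - 2)).
Proof.
move=> /andP[i0 im]; rewrite /sided_drift.
have ieq1 : (m < 2)%N -> i = 1%N by lia.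
have sgSS j : sg ^+ j.+2 = sg ^+ j by rewrite -addn2 exprD sg1 mulr1.
have II : \1_A w * \1_A w = \1_A w :> R.
  by rewrite indicE; case: (_ \in _); rewrite ?mulr1 ?mulr0.
have JS : J i.+1 w = J i w * sg by rewrite /sided_weight exprSr mulrA.
have JSS : J i.+2 w = J i w by rewrite /sided_weight sgSS.
have JI : \1_A w * J i w = J i w by rewrite /sided_weight mulrA II.
(* For j < 2 the truncated [j - 2] gives a wrong power of [sg], but the factor j (j - 1) vanishes;
   otherwise sg^2 = 1. *)
have J2 j : (j * j.-1)%:R * J j w = (j * j.-1)%:R * J (j - 2)%N w.
  case: j => [|[|j]]; rewrite ?muln0 ?mul0r//.
  by rewrite /sided_weight sgSS !subSS subn0.
have YX : (Y t w ^+ i.-2 *+ (i * i.-1) * 'X^2)`_m =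
    (i * i.-1)%:R * (Y t w ^+ (i - 2))`_(m - 2).
  rewrite coefMXn; case: ltnP => [/ieq1 ->|_]; first by rewrite /= muln0 mul0r.
  by rewrite coefMn !subn2 mulr_natl.
have YB : (Y t w ^+ i.-1 *+ i * fluctuation_drift n X t w)`_m =
    i%:R * ((1 - 3 * X 0%N t w ^+ 2) * (Y t w ^+ i)`_m - 3 * X 0%N t w * (Y t w ^+ i.+1)`_m
      - (Y t w ^+ i.+2)`_m).
  have E : Y t w ^+ i.-1 * fluctuation_drift n X t w =
      (1 - 3 * X 0%N t w ^+ 2)%:P * Y t w ^+ i - (3 * X 0%N t w)%:P * Y t w ^+ i.+1
        - Y t w ^+ i.+2.
    rewrite /fluctuation_drift !(exprS _ i.+1) !(exprS _ i).
    rewrite (_ : Y t w ^+ i = Y t w * Y t w ^+ i.-1); last by rewrite -exprS prednK.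
    ring.
  by rewrite mulrnAl coefMn E -[LHS]mulr_natl !coefB !coefCM.
rewrite coefD YX YB JSS mulrDr.
have -> : J i w * ((i * i.-1)%:R * (Y t w ^+ (i - 2))`_(m - 2)) =
  (i * i.-1)%:R * (J (i - 2)%N w * (Y t w ^+ (i - 2))`_(m - 2)).
  by rewrite mulrCA mulrA J2 mulrA.
have -> : 3 * i%:R * (\1_A w * (X 0%N t w - sg) * (J i w * (Y t w ^+ i.+1)`_m)) =
  3 * i%:R * ((X 0%N t w - sg) * (J i w * (Y t w ^+ i.+1)`_m)).
  by rewrite -{2}JI; ring.
rewrite JS; ring.
Qed.

Lemma sided_drift_mean m i t : (0 < i <= m)%N -> (m <= n)%N -> 0 <= t ->
  \int[P]_w sided_drift n xi X sg m i t w = - (2 * i%:R) * mean m i t + sided_remainder m i t.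
Proof.
move=> i0m mn t0; have /andP[i0 im] := i0m.
have u01 := @unit_gauge01 R (time R).
have Oc k m' j : (m' <= n)%N -> bigO P (@unit_gauge R (time R)) 0
    (fun (t : time R) w => J j w * (Y (val t) w ^+ k)`_m').
  move=> m'n; apply: (bigOMl0 (sided_weight_bigO sys sg _ j)).
  exact: (power_bigO sys).
have OX := sys_moments sys (leq0n n).
have O1 : bigO P (@unit_gauge R (time R)) 0 (fun (t : time R) w => 1 - X 0%N (val t) w ^+ 2).
  by apply: eq_bigO (bigOB (bigO_cst P _ 1) (bigOMl0 OX OX)) => z w; rewrite expr2.
have O2 : bigO P (@unit_gauge R (time R)) 0 (fun (t : time R) w => \1_A w * (X 0%N (val t) w - sg)).
  have h := bigOMl0 (sided_weight_bigO sys sg (@unit_gauge R (time R)) 0)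
    (bigOB OX (bigO_cst P _ sg)).
  by apply: eq_bigO h => z w; rewrite /sided_weight expr0 mulr1.
have int0 f : bigO P (@unit_gauge R (time R)) 0 (fun (t : time R) => f (val t)) ->
    P.-integrable setT (EFin \o f t).
  by move=> Of; exact: (bigO_integrable u01 (exist _ t t0 : time R) Of).
have mB f f' : P.-integrable setT (EFin \o f) -> P.-integrable setT (EFin \o f') ->
    P.-integrable setT (EFin \o (fun w => f w - f' w)) /\
    \int[P]_w (f w - f' w) = \int[P]_w f w - \int[P]_w f' w.
  move=> i1 i2; split; last exact: RintegralB.
  by apply: eq_integrable (integrableB measurableT i1 i2) => // w _; rewrite /= EFinB.
have mZ c f : P.-integrable setT (EFin \o f) ->
    P.-integrable setT (EFin \o (fun w => c * f w)) /\
    \int[P]_w (c * f w) = c * \int[P]_w f w.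
  move=> i1; split; last exact: RintegralZl.
  by apply: eq_integrable (integrableZl measurableT c i1) => // w _; rewrite /= EFinM.
have i1 := int0 (fun t w => (1 - X 0%N t w ^+ 2) * (J i w * (Y t w ^+ i)`_m))
  (bigOMl0 O1 (Oc i m i mn)).
have i2 := int0 (fun t w => (\1_A w * (X 0%N t w - sg)) * (J i w * (Y t w ^+ i.+1)`_m))
  (bigOMl0 O2 (Oc i.+1 m i mn)).
have i3 := int0 (fun t w => J i w * (Y t w ^+ i)`_m) (Oc i m i mn).
have i4 := int0 (fun t w => J i.+1 w * (Y t w ^+ i.+1)`_m) (Oc i.+1 m i.+1 mn).
have i5 := int0 (fun t w => J i.+2 w * (Y t w ^+ i.+2)`_m) (Oc i.+2 m i.+2 mn).
have i6 := int0 (fun t w => J (i - 2)%N w * (Y t w ^+ (i - 2))`_(m - 2))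
  (Oc (i - 2)%N (m - 2)%N (i - 2)%N (leq_trans (leq_subr _ _) mn)).
have [k1 e1] := mZ (3 * i%:R) _ i1.
have [k2 e2] := mZ (3 * i%:R) _ i2.
have [k3 e3] := mZ (2 * i%:R) _ i3.
have [k4 e4] := mZ (3 * i%:R) _ i4.
have [k5 e5] := mZ (i%:R) _ i5.
have [k6 e6] := mZ (- (i * i.-1)%:R) _ i6.
have [l1 f1] := mB _ _ k1 k2.
have [l2 f2] := mB _ _ l1 k3.
have [l3 f3] := mB _ _ l2 k4.
have [l4 f4] := mB _ _ l3 k5.
have [l5 f5] := mB _ _ l4 k6.
transitivity (\int[P]_w (3 * i%:R * ((1 - X 0%N t w ^+ 2) * (J i w * (Y t w ^+ i)`_m))
  - 3 * i%:R * ((\1_A w * (X 0%N t w - sg)) * (J i w * (Y t w ^+ i.+1)`_m))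
  - 2 * i%:R * (J i w * (Y t w ^+ i)`_m) - 3 * i%:R * (J i.+1 w * (Y t w ^+ i.+1)`_m)
  - i%:R * (J i.+2 w * (Y t w ^+ i.+2)`_m)
  - - (i * i.-1)%:R * (J (i - 2)%N w * (Y t w ^+ (i - 2))`_(m - 2)))).
  by apply: eq_Rintegral => w _; exact: sided_driftE.
rewrite f5 f4 f3 f2 f1 e1 e2 e3 e4 e5 e6 /sided_remainder /sided_mean; ring.
Qed.

Theorem sided_limit m i : (m <= n)%N ->
  mean m i t @[t --> +oo] --> fine (P A) * limit_coef R m i.
Proof.
have [N] := ubnP (2 * m - i); elim: N m i => // N IH m i.
rewrite ltnS => le mn.
have [->|i0] := posnP i.
  have -> : (fun t => mean m 0 t) = fun=> fine (P A) * limit_coef R m 0.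
    apply/funext => t; rewrite /sided_mean limit_coef0.
    under eq_Rintegral do rewrite expr0 coef1 mulrC.
    rewrite RintegralZl//; last first.
      exact: (bigO_integrable (@unit_gauge01 R _) tt
        (sided_weight_bigO sys sg (@unit_gauge R unit) 0)).
    rewrite mulrC; congr (_ * _).
    under eq_Rintegral do rewrite /sided_weight expr0 mulr1.
    rewrite /Rintegral integral_indic ?setIT//; exact: measurable_sided.
  exact: cvg_cst.
have [mi|im] := ltnP m i.
  have -> : (fun t => mean m i t) = fun=> 0.
    apply/funext => t; rewrite /sided_mean.
    under eq_Rintegral do rewrite coef_fluctuation_gt// mulr0.
    by rewrite /Rintegral integral0.
  by rewrite limit_coef_gt// mulr0; exact: cvg_cst.
have i0m : (0 < i <= m)%N by rewrite i0.
have [M hM] := sided_mean_bound sys sg i mn.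
have [C hC] := sided_step sys sg i mn.
have := @cvg_one_step R (mean m i) (sided_remainder m i) (2 * i%:R)
  (fine (P A) * (- 3 * i%:R * limit_coef R m i.+1 - i%:R * limit_coef R m i.+2 +
    (i * i.-1)%:R * limit_coef R (m - 2) (i - 2))) C M.
(* Multiplying [limit_coefE] by i and by the probability of the event identifies L / (2 i) with the
   announced limit. *)
have -> : fine (P A) * (- 3 * i%:R * limit_coef R m i.+1 - i%:R * limit_coef R m i.+2 +
    (i * i.-1)%:R * limit_coef R (m - 2) (i - 2)) / (2 * i%:R) = fine (P A) * limit_coef R m i.
  have iR : i%:R != 0 :> R by rewrite pnatr_eq0 -lt0n.
  apply: (mulIf (_ : 2 * i%:R != 0)); first by rewrite mulf_neq0// pnatr_eq0.
  rewrite divfK ?mulf_neq0 ?pnatr_eq0//; last by rewrite -lt0n.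
  by rewrite natrM -[RHS]mulrA [limit_coef R m i * _]mulrCA mulrC; ring: (limit_coefE R i0m).
apply => //.
- by rewrite mulr_gt0// ltr0n.
- by move=> t s t0 s01; rewrite -sided_drift_mean//; exact: hC.
rewrite /sided_remainder.
have -> : fine (P A) * (- 3 * i%:R * limit_coef R m i.+1 - i%:R * limit_coef R m i.+2 +
    (i * i.-1)%:R * limit_coef R (m - 2) (i - 2)) =
  3 * i%:R * 0 - 3 * i%:R * 0 - 3 * i%:R * (fine (P A) * limit_coef R m i.+1)
  - i%:R * (fine (P A) * limit_coef R m i.+2) +
  (i * i.-1)%:R * (fine (P A) * limit_coef R (m - 2) (i - 2)) by ring.
have Oc k : bigO P (@unit_gauge R (time R)) 0
    (fun (t : time R) w => J i w * (Y (val t) w ^+ k)`_m).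
  apply: (bigOMl0 (sided_weight_bigO sys sg _ i)).
  exact: (power_bigO sys).
have mX0 t : measurable_fun setT (X 0%N t) by exact: (sys_mX sys).
apply: cvgD; last first.
  apply: cvgMr.
  have [i1|i1] := leqP i 1.
    apply: IH; last exact: leq_trans (leq_subr _ _) mn.
    by lia.
  by apply: IH; [lia|exact: leq_trans (leq_subr _ _) mn].
apply: cvgB; last by apply: cvgMr; apply: IH => //; lia.
apply: cvgB; last by apply: cvgMr; apply: IH => //; lia.
apply: cvgB; apply: cvgMr.
  apply: (@decaying_mean (fun t w => 1 - X 0%N t w ^+ 2)
    (fun t w => J i w * (Y t w ^+ i)`_m) (hi / lo)); last exact: Oc.
    by move=> t _; apply: measurable_funB => //; exact: measurable_funX.
  by move=> t w t0; rewrite distrC; exact: (sys_X0_limit sys).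
apply: (@decaying_mean (fun t w => \1_A w * (X 0%N t w - sg))
  (fun t w => J i w * (Y t w ^+ i.+1)`_m) (hi / lo)); last exact: Oc.
  move=> t _; apply: measurable_funM; last exact: measurable_funB.
  exact: measurable_indic measurable_sided.
by move=> t w t0; exact: sided_X0.
Qed.

End one_sided_recursion.

Lemma Rintegral_sum d (T : measurableType d) (R : realType) (mu : {measure set T -> \bar R})
    (J : Type) (r : seq J) (f : J -> T -> R) :
  (forall j, mu.-integrable setT (EFin \o f j)) ->
  mu.-integrable setT (EFin \o (fun w => \sum_(j <- r) f j w)) /\
  \int[mu]_w (\sum_(j <- r) f j w) = \sum_(j <- r) \int[mu]_w f j w.
Proof.
move=> fi; elim: r => [|j r [IH1 IH2]].
  rewrite big_nil; have -> : (fun w => \sum_(j <- [::]) f j w) = fun=> 0.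
    by apply/funext => w; rewrite big_nil.
  by split; [exact: integrable0|rewrite /Rintegral integral0].
have -> : (fun w => \sum_(j <- j :: r) f j w) = (fun w => f j w + \sum_(j <- r) f j w).
  by apply/funext => w; rewrite big_cons.
rewrite big_cons -IH2; split; last exact: RintegralD.
by apply: eq_integrable (integrableD measurableT (fi j) IH1) => // w _; rewrite /= EFinD.
Qed.

(** * Limits of the weak expansion coefficients *)

Section weak_limit.
Context d (T : measurableType d) (R : realType) (P : probability T R).
Context (n : nat) (b : R -> T -> R) (xi : nat -> T -> R)
  (X : nat -> R -> T -> R) (H : R -> set (set T)) (lo hi : R)
  (sys : expansion_system P n b xi X H lo hi).
Context (F : R -> R) (CF : C_k n.+1 F) (gF : poly_growth n.+1 F).
Implicit Types (m k i : nat) (s t : R) (w : T).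
Local Notation Y := (fluctuation n X).
Local Notation A sg := [set w | 0 < sg * xi 0%N w].

Lemma C_k_is_derive i (x : R) : (i <= n)%N ->
  is_derive x 1 F^`(i)%classic (F^`(i.+1)%classic x).
Proof.
have [dF _] := CF => iin; rewrite derive1nS derive1E; apply: derivableP.
exact: dF.
Qed.

Lemma C_k_derive_continuous i : (i <= n)%N -> continuous F^`(i)%classic.
Proof.
have [dF _] := CF => iin x; apply/differentiable_continuous/derivable1_diffP.
exact: dF.
Qed.

Lemma sys_X0_le t w : 0 <= t -> `|X 0%N t w| <= 1 + hi.
Proof.
move=> t0; have hi0 := le_trans ler01 (sys_hi sys).
by apply: sqr_le_normr => //; have /andP[] := sys_X0_bounds sys w t0.
Qed.

Lemma growth_bounded i (x r : R) q C : 0 < q -> 0 < C ->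
  (forall y, `|F^`(i)%classic y| <= C * (1 + `|y| `^ q)) -> `|x| <= r ->
  `|F^`(i)%classic x| <= C * (1 + r `^ q).
Proof.
move=> q0 C0 bF xr; apply: le_trans (bF x) _.
rewrite ler_pM2l// lerD2l ge0_ler_powR ?nnegrE// ?(ltW q0)//.
exact: le_trans xr.
Qed.

Lemma sys_derive_bigO i : (i <= n)%N -> bigO P (@unit_gauge R (time R)) 0
  (fun (t : time R) w => F^`(i)%classic (X 0%N (val t) w)).
Proof.
move=> iin; have [q [C [q0 C0 bF]]] := gF.
apply: (@bigO_bounded _ _ _ _ _ _ _ (C * (1 + (1 + hi) `^ q))) => [t|[t /= t0] w].
  apply: measurableT_comp; last exact: (sys_mX sys).
  by apply: continuous_measurable_fun; exact: C_k_derive_continuous.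
apply: growth_bounded => //; last exact: sys_X0_le.
exact: bF (leq_trans iin (leqnSn n)).
Qed.

(** Replacing the derivative of F at X_0 by its value at [sg] costs an exponentially small term, by
    the mean value inequality; the weight required by [sided_limit] is then produced by inserting
    sg^i sg^i = 1. *)
Lemma sided_derive_cvg sg i m : sg ^+ 2 = 1 -> (i <= n)%N -> (m <= n)%N ->
  \int[P]_w (\1_(A sg) w * (F^`(i)%classic (X 0%N t w) * (Y t w ^+ i)`_m)) @[t --> +oo]
    --> F^`(i)%classic sg * sg ^+ i * fine (P (A sg)) * limit_coef R m i.
Proof.
move=> sg1 iin mn; have [q [C [q0 C0 bF]]] := gF.
have sgn : `|sg| = 1.
  by apply/eqP; rewrite -(@eqrXn2 _ 2)// real_normK ?num_real// sg1 expr1n.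
have hi0 := le_trans ler01 (sys_hi sys).
(* A point x with |x - sg| <= |X_0 - sg| satisfies |x| <= |X_0| + 2, and |X_0| <= 1 + hi. *)
pose M := C * (1 + (3 + hi) `^ q).
have M0 : 0 <= M by rewrite mulr_ge0 ?addr_ge0 ?powR_ge0// ltW.
pose a t w := \1_(A sg) w * (F^`(i)%classic (X 0%N t w) - F^`(i)%classic sg).
have mF := continuous_measurable_fun (C_k_derive_continuous iin).
have ma t : measurable_fun setT (a t).
  apply: measurable_funM; first exact: measurable_indic (measurable_sided sys sg).
  apply: measurable_funB => //; apply: measurableT_comp => //; exact: (sys_mX sys).
have ba t w : 0 <= t -> `|a t w| <= M * (hi / lo) * expR (- 2 * t).
  move=> t0; rewrite -mulrA.
  apply: le_trans (ler_wpM2l M0 (sided_X0 sys sg1 w t0)).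
  rewrite !normrM mulrCA ler_wpM2l//.
  apply: (@mvt_le R _ (F^`(i.+1)%classic)) => [x|x xX]; first exact: C_k_is_derive.
  apply: growth_bounded => //; first by apply: bF; rewrite ltnS.
  rewrite -[x](subrK sg) (le_trans (ler_normD _ _))// sgn.
  have := le_trans xX (ler_normB _ _); rewrite sgn.
  have := sys_X0_le w t0; lra.
have OY : bigO P (@unit_gauge R (time R)) 0 (fun (t : time R) w => (Y (val t) w ^+ i)`_m).
  exact: (power_bigO sys i mn).
have h1 := decaying_mean (f := fun t w => (Y t w ^+ i)`_m) (fun t _ => ma t) ba OY.
have h2 : F^`(i)%classic sg * sg ^+ i * sided_mean P n xi X sg m i t @[t --> +oo] -->
    F^`(i)%classic sg * sg ^+ i * (fine (P (A sg)) * limit_coef R m i).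
  by apply: cvgMr; exact: (sided_limit sys sg1).
have h : (fun t => \int[P]_w (a t w * (Y t w ^+ i)`_m) +
    F^`(i)%classic sg * sg ^+ i * sided_mean P n xi X sg m i t) @ +oo -->
    F^`(i)%classic sg * sg ^+ i * fine (P (A sg)) * limit_coef R m i.
  by rewrite -[X in _ --> X]add0r -[X in _ + X]mulrA; exact: cvgD h1 h2.
move: h; apply: cvg_trans; apply: near_eq_cvg; near=> t.
have t0 : 0 <= t by near: t; exact: nbhs_pinfty_ge.
have O1 := bigOMl0 (sided_weight_bigO sys sg (@unit_gauge R (time R)) i) OY.
have i1 := bigO_integrable (@unit_gauge01 R _) (exist _ t t0 : time R) O1.
have Oa : bigO P (@unit_gauge R (time R)) 0 (fun t : time R => a (val t)).
  apply: (@bigO_bounded _ _ _ _ _ _ _ (M * (hi / lo))) => [u|[u /= u0] w]; first exact: ma.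
  apply: le_trans (ba u w u0) _; rewrite ler_piMr//.
    by rewrite mulr_ge0// divr_ge0// ltW//; have /andP[] := sys_lo sys.
  by rewrite expR_le1 mulNr oppr_le0 mulr_ge0.
have i2 := bigO_integrable (@unit_gauge01 R _) (exist _ t t0 : time R) (bigOMl0 Oa OY).
rewrite /= /sided_mean -RintegralZl// -RintegralD//; last first.
  by apply: eq_integrable (integrableZl measurableT (F^`(i)%classic sg * sg ^+ i) i1) => // w _;
    rewrite /= EFinM.
apply: eq_Rintegral => w _; rewrite /a /sided_weight.
have ss : sg ^+ i * sg ^+ i = 1 by rewrite -exprD addnn -mul2n exprM sg1 expr1n.
by ring: ss.
Unshelve. all: by end_near. Qed.

(** One sum for every m: the term i = 0 is F(x0) when m = 0 and vanishes otherwise, and for i > m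
    there is no composition. This avoids the case distinction of [weak_coef]. *)
Definition weak_integrand (x0 : R) (y : {poly R}) m : R :=
  \sum_(i < n.+1) i`!%:R^-1 * (F^`(i)%classic x0 * (y ^+ i)`_m).

Lemma weak_integrand_integrable m t : (m <= n)%N -> 0 <= t ->
  P.-integrable setT (EFin \o (fun w => weak_integrand (X 0%N t w) (Y t w) m)).
Proof.
move=> mn t0.
have h : bigO P (@unit_gauge R (time R)) 0
    (fun (t : time R) w => weak_integrand (X 0%N (val t) w) (Y (val t) w) m).
  apply: bigO_sum => [|i _]; first exact: unit_gauge01.
  apply: bigOZ; apply: bigOMl0; first exact: (sys_derive_bigO (leq_ord i)).
  exact: (power_bigO sys i mn).
exact: (bigO_integrable (@unit_gauge01 R _) (exist _ t t0 : time R) h).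
Qed.

Lemma sided_cover w : \1_(A 1) w + \1_(A (-1)) w = 1 :> R.
Proof.
have xi0 : xi 0%N w != 0.
  apply/eqP => x0; have /andP[h _] := sys_xi0 sys w; have /andP[l0 _] := sys_lo sys.
  by move: h; rewrite x0 expr0n/= leNgt l0.
rewrite !indicE; have [x0|x0|x0] := ltgtP 0 (xi 0%N w); last by rewrite x0 eqxx in xi0.
- by rewrite mem_set/= ?mul1r// memNset/= ?addr0// mulN1r oppr_gt0 ltNge ltW.
- by rewrite memNset/= ?mul1r ?ltNge ?ltW// mem_set/= ?add0r// mulN1r oppr_gt0.
Qed.

Theorem sys_weak_limit m : (m <= n)%N ->
  \int[P]_w weak_integrand (X 0%N t w) (Y t w) m @[t --> +oo] -->
    \sum_(i < n.+1) (F^`(i)%classic 1 * fine (P (A 1)) +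
       (-1) ^+ i * F^`(i)%classic (-1) * fine (P (A (-1)))) / i`!%:R * limit_coef R m i.
Proof.
move=> mn.
pose G sg (i : nat) t w := \1_(A sg) w * (F^`(i)%classic (X 0%N t w) * (Y t w ^+ i)`_m).
have h : (fun t => \sum_(i < n.+1) i`!%:R^-1 *
    (\int[P]_w G 1 i t w + \int[P]_w G (-1) i t w)) @ +oo -->
   \sum_(i < n.+1) i`!%:R^-1 * (F^`(i)%classic 1 * 1 ^+ i * fine (P (A 1)) * limit_coef R m i +
     F^`(i)%classic (-1) * (-1) ^+ i * fine (P (A (-1))) * limit_coef R m i).
  apply: cvg_big => [|i _]; first exact: add_continuous.
  apply: cvgMr; apply: cvgD; apply: sided_derive_cvg => //.
  - by rewrite expr1n.
  - exact: leq_ord.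
  - by rewrite sqrrN expr1n.
  - exact: leq_ord.
rewrite (_ : \sum_(i < n.+1) _ = \sum_(i < n.+1) i`!%:R^-1 *
  (F^`(i)%classic 1 * 1 ^+ i * fine (P (A 1)) * limit_coef R m i +
     F^`(i)%classic (-1) * (-1) ^+ i * fine (P (A (-1))) * limit_coef R m i)); last first.
  by apply: eq_bigr => i _; rewrite expr1n; ring.
move: h; apply: cvg_trans; apply: near_eq_cvg; near=> t.
have t0 : 0 <= t by near: t; exact: nbhs_pinfty_ge.
have OG sg i : (i <= n)%N -> bigO P (@unit_gauge R (time R)) 0 (fun t : time R => G sg i (val t)).
  move=> iin; apply: (@bigOMl0 _ _ _ P _ _ _ (fun _ => \1_(A sg))).
    have := sided_weight_bigO sys sg (@unit_gauge R (time R)) 0.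
    by apply: eq_bigO => u w; rewrite /sided_weight expr0 mulr1.
  apply: bigOMl0; first exact: (sys_derive_bigO iin).
  exact: (power_bigO sys i mn).
have iG sg (i : 'I_n.+1) : P.-integrable setT (EFin \o G sg i t).
  exact: (bigO_integrable (@unit_gauge01 R _) (exist _ t t0 : time R) (OG sg i (leq_ord i))).
pose S (i : 'I_n.+1) w := i`!%:R^-1 * (G 1 i t w + G (-1) i t w).
have iGG (i : 'I_n.+1) : P.-integrable setT (EFin \o (fun w => G 1 i t w + G (-1) i t w)).
  by apply: eq_integrable (integrableD measurableT (iG 1 i) (iG (-1) i)) => // w _;
    rewrite /= EFinD.
have iS (i : 'I_n.+1) : P.-integrable setT (EFin \o S i).
  by apply: eq_integrable (integrableZl measurableT i`!%:R^-1 (iGG i)) => // w _;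
    rewrite /= EFinM.
have [_ eS] := Rintegral_sum (index_enum 'I_n.+1) iS.
rewrite /=; transitivity (\sum_(i < n.+1) \int[P]_w S i w).
  apply: eq_bigr => i _; rewrite /S (RintegralZl i`!%:R^-1 measurableT (iGG i)).
  by rewrite (RintegralD measurableT (iG 1 i) (iG (-1) i)).
rewrite -eS; apply: eq_Rintegral => w _; apply: eq_bigr => i _.
by rewrite /S /G -mulrDl sided_cover mul1r.
Unshelve. all: by end_near. Qed.

End weak_limit.

(** * From almost sure to sure properties *)

Section null_set.
Context d (T : measurableType d) (R : realType) (P : probability T R).
Context (N : set T) (mN : measurable N) (PN : P N = 0%E).
Implicit Types (A B : set T) (f : T -> R) (c : R).

Lemma null_set_eq A B : measurable A -> measurable B ->
  (forall w, ~ N w -> A w <-> B w) -> P A = P B.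
Proof.
move=> mA mB AB.
have drop C : measurable C -> P C = P (C `\` N).
  move=> mC; rewrite measureD//; last by rewrite (le_lt_trans (probability_le1 _ _))// ltry.
  rewrite [X in (_ - X)%E](_ : _ = 0%E) ?sube0//.
  by apply: (subset_measure0 _ mN) => //; exact: measurableI.
rewrite (drop A)// (drop B)//; congr (P _).
by apply/seteqP; split => w [h Nw]; split => //; apply/AB.
Qed.

Definition patch_null c f w : R := if w \in N then c else f w.

Lemma patch_null_out c f w : ~ N w -> patch_null c f w = f w.
Proof. by move=> Nw; rewrite /patch_null memNset. Qed.

Lemma patch_null_in c f w : N w -> patch_null c f w = c.
Proof. by move=> Nw; rewrite /patch_null mem_set. Qed.

Lemma measurable_patch_null c f : measurable_fun setT f ->
  measurable_fun setT (patch_null c f).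
Proof.
move=> mf.
have -> : patch_null c f = fun w => c * \1_N w + (1 - \1_N w) * f w.
  apply/funext => w; rewrite /patch_null indicE; case: (w \in N) => /=.
    by rewrite mulr1 subrr mul0r addr0.
  by rewrite mulr0 add0r subr0 mul1r.
have mi : measurable_fun setT (\1_N : T -> R) by exact: measurable_indic.
apply: measurable_funD; first exact: measurable_funM.
by apply: measurable_funM => //; exact: measurable_funB.
Qed.

End null_set.

Section generated.
Context d (T : measurableType d) (R : realType) (P : probability T R).
Implicit Types (S : set (T -> R)) (G : set (set T)).

Lemma sigma_of_preimage S (f : T -> R) B : S f -> measurable B -> sigma_of S (f @^-1` B).
Proof.
move=> Sf mB; apply: sub_gen_smallest; exists f => //.
by exists B => //; rewrite setTI.
Qed.

Lemma sigma_of_sub S G : sigma_algebra setT G ->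
  (forall f B, S f -> measurable B -> G (f @^-1` B)) -> sigma_of S `<=` G.
Proof.
move=> sG SG; apply: smallest_sub => // _ [f Sf [B mB <-]].
by rewrite setTI; exact: SG.
Qed.

Lemma sigma_ofI S A B : sigma_of S A -> sigma_of S B -> sigma_of S (A `&` B).
Proof. exact: (@measurableI _ (g_sigma_algebraType _)). Qed.

Lemma sigma_ofT S : sigma_of S setT.
Proof. exact: (@measurableT _ (g_sigma_algebraType _)). Qed.

Lemma sigma_of_algebra S : sigma_algebra setT (sigma_of S).
Proof. exact: smallest_sigma_algebra. Qed.

Lemma sigma_of_measurable S : (forall f, S f -> measurable_fun setT f) ->
  sigma_of S `<=` measurable.
Proof.
move=> mS; apply: sigma_of_sub => [|f B Sf mB]; first exact: sigma_algebra_measurable.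
by have := mS f Sf measurableT B mB; rewrite setTI.
Qed.

(** A -> P(A [&] E) and P(E) P are finite measures that agree on the pi-system [G], hence on what it
    generates. *)
Lemma independent_of_generated G (E : set T) : measurable E -> G `<=` measurable ->
  G setT -> setI_closed G -> (forall A, G A -> P (A `&` E) = (P A * P E)%E) ->
  forall A, <<s G >> A -> P (A `&` E) = (P A * P E)%E.
Proof.
move=> mE mG GT GI GE A GA.
have PE : P E \is a fin_num by exact: fin_num_measure.
pose r : {nonneg R} := NngNum (fine_ge0 (measure_ge0 P E)).
have rE : (r%:num)%:E = P E by rewrite -[r%:num]/(fine (P E)) fineK.
have sE B : mscale r P B = (P B * P E)%E by rewrite muleC -rE.
have e : mrestr P mE A = mscale r P A.
  apply: (@g_sigma_algebra_measure_unique _ R T G mG (fun=> setT)) => //.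
  - by rewrite bigcup_const//; exists 0%N.
  - by move=> B GB; transitivity (P (B `&` E)) => //; rewrite GE// -sE.
  - move=> _; apply: le_lt_trans (ltry 1).
    by apply: (@probability_le1 _ _ _ P (setT `&` E)); rewrite setTI.
by rewrite sE in e; exact: e.
Qed.

End generated.

Lemma within_continuous_pos (R : realType) (f : R -> R) :
  {within `[0, +oo[, continuous f} -> continuous (fun t : R => f (Num.max t 0)).
Proof.
move=> /subspace_continuousP cf t.
have in0 (s : R) : `[0, +oo[%classic (Num.max s 0) by rewrite /= in_itv/= andbT le_max lexx orbT.
have cm : continuous (fun s : R => Num.max s 0).
  by move=> s; apply: continuous_max; [exact: cvg_id|exact: cvg_cst].
apply: (@cvg_comp _ _ _ (fun s : R => Num.max s 0) f _ (within `[0, +oo[%classic (nbhs (Num.max t 0)))).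
  move=> U hU.
  have h : nbhs t (fun s : R => `[0, +oo[%classic (Num.max s 0) -> U (Num.max s 0)).
    exact: cm t _ hU.
  rewrite /nbhs/=; change (nbhs t (fun s : R => U (Num.max s 0))).
  by apply: filterS h => s; apply; exact: in0.
exact: cf.
Qed.

Lemma eq_expansion_drift (R : realType) m (x y : nat -> R) :
  (forall k, (k <= m)%N -> x k = y k) -> expansion_drift m x = expansion_drift m y.
Proof.
move=> xy; rewrite /expansion_drift !(xy 0%N)// (xy m)//.
have e i (j : {ffun 'I_i -> 'I_m.+1}) : \prod_k x (j k) = \prod_k y (j k).
  by apply: eq_bigr => k _; rewrite xy// leq_ord.
case: eqP => // _; congr (_ - _ - _); apply: eq_bigr => j _; by rewrite e.
Qed.

(** The equilibrium 1 without fluctuation solves every equation when the noise is zero; these are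
    the values assigned on the exceptional null set. *)
Lemma expansion_drift_stationary (R : realType) m :
  expansion_drift m (fun k => (k == 0%N)%:R : R) = 0.
Proof.
rewrite /expansion_drift /=; case: eqP => [_|m0]; first by rewrite expr1n subrr.
have p0 i (j : {ffun 'I_i -> 'I_m.+1}) : (0 < i)%N -> j \in (compositions i m)%SET ->
    \prod_k ((j k == 0%N :> nat)%:R : R) = 0.
  move=> i0 jc; rewrite (bigD1 (Ordinal i0))//= gtn_eqF ?mul0r//.
  exact: composition_gt0 jc.
rewrite mulr0 sub0r big1 ?oppr0 ?sub0r => [|j jc]; last by rewrite (p0 2%N)// mulr0.
by rewrite big1 ?oppr0// => j jc; exact: (p0 3%N).
Qed.

Lemma continuous_expansion_drift (R : realType) m (x : nat -> R -> R) :
  (forall k, continuous (x k)) -> continuous (fun t => expansion_drift m (fun k => x k t)).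
Proof.
move=> cx t; rewrite /expansion_drift; case: eqP => _.
  apply: cvgB; first exact: cx.
  apply: (@continuous_comp _ _ _ (x 0%N) (fun z : R => z ^+ 3)); first exact: cx.
  exact: exprn_continuous.
apply: cvgB; first apply: cvgB.
- apply: cvgM; last exact: cx.
  apply: cvgB; first exact: cvg_cst.
  apply: cvgMr; apply: (@continuous_comp _ _ _ (x 0%N) (fun z : R => z ^+ 2)); first exact: cx.
  exact: exprn_continuous.
- apply: continuous_sum => j _ s; apply: cvgM; first by apply: cvgMr; exact: cx.
  by apply: continuous_prod => k; exact: cx.
by apply: continuous_sum => j _; apply: continuous_prod => k; exact: cx.
Qed.

Section surely.
Context (R : realType) (d : measure_display) (T : measurableType d)
  (P : probability T R) (n : nat) (W : R -> {RV P >-> R})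
  (xieps : R -> {RV P >-> R}) (xi : nat -> {RV P >-> R})
  (X : nat -> R -> {RV P >-> R}).
Context (hW : brownian_motion W) (hindep : data_independent n W xieps xi)
  (hA1 : assumption_A1 n xieps xi) (hA2 : assumption_A2 (xi 0%N))
  (hX : expansion_solution n W xi X).
Local Notation data := ([set (xieps e : T -> R) | e in `]0, 1[] `|`
               [set (xi k : T -> R) | k in [set k | (k <= n)%N]]).
Local Notation past t := [set (W u : T -> R) | u in `[0, t]].
Local Notation path := [set (W u : T -> R) | u in `[0, +oo[].

Let surely_path w := {within `[0, +oo[, continuous (fun t => W t w)}.
Let surely_X w := forall m, (m <= n)%N ->
  {within `[0, +oo[, continuous (fun t => X m t w)} /\
    forall t, 0 <= t ->
      X m t w = xi m w
        + \int[lebesgue_measure]_(s in `[0, t]) expansion_drift m (fun k => X k s w)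
        + (if m == 1%N then Num.sqrt 2 * W t w else 0).

Lemma surely : exists N : set T, exists rmin rmax : R,
  [/\ measurable N, P N = 0%E, 0 < rmin, rmin < rmax &
    forall w, ~ N w ->
      [/\ W 0 w = 0, surely_path w, rmin < `|xi 0%N w| < rmax & surely_X w]].
Proof.
have [W0 Wc _ _] := hW; have [rmin [rmax [r0 rr ra]]] := hA2.
have aX : {ae P, forall w, surely_X w}.
  apply: ae_foralln => m; have [mn|mn] := leqP m n.
    by have := hX mn; apply: filterS => w h _; exact: h.
  by apply: aeW => w.
have [N [mN PN NQ]] := filterI W0 (filterI Wc (filterI ra aX)).
exists N, rmin, rmax; split => // w Nw.
have [h1 [h2 [h3 h4]]] : ([set w | W 0 w = 0] `&` ([set w | surely_path w] `&`
    ([set w | rmin < `|xi 0%N w| < rmax] `&` [set w | surely_X w]))) w.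
  by apply: contrapT => h; apply: Nw; exact: NQ.
by split.
Qed.

Context (N : set T) (rmin rmax : R) (mN : measurable N) (PN : P N = 0%E)
  (r0 : 0 < rmin) (rr : rmin < rmax).
Context (good : forall w, ~ N w ->
      [/\ W 0 w = 0, surely_path w, rmin < `|xi 0%N w| < rmax & surely_X w]).

Definition sure_path (t : R) : T -> R := patch_null N 0 (W (Num.max t 0)).
Definition sure_data (m : nat) : T -> R := patch_null N (m == 0%N)%:R (xi m).
(** Negative times are frozen at 0, because continuity and the equations are known on [0, +oo[ only;
    orders above [n], about which nothing is known, are set to 0. *)
Definition sure_X (m : nat) (t : R) : T -> R :=
  if (m <= n)%N then patch_null N (m == 0%N)%:R (X m (Num.max t 0)) else fun=> 0.

(** Intersections of a data event and a past event, up to [N]. The null set need not belong to the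
    natural filtration, so the patched processes are adapted only to this enlargement; intersections
    form a pi-system on which independence can be checked. *)
Definition observable (t : R) : set (set T) :=
  [set D | measurable D /\ exists B C, [/\ sigma_of data B, sigma_of (past t) C &
    forall w, ~ N w -> D w <-> B w /\ C w]].

Lemma data_measurable : sigma_of data `<=` measurable.
Proof. by apply: sigma_of_measurable => _ [[e _ <-]|[k _ <-]]. Qed.

Lemma path_measurable : sigma_of path `<=` measurable.
Proof. by apply: sigma_of_measurable => _ [u _ <-]. Qed.

Lemma past_path t : sigma_of (past t) `<=` sigma_of path.
Proof.
apply: sigma_of_sub => [|_ B [u ut <-] mB]; first exact: sigma_of_algebra.
apply: sigma_of_preimage => //; exists u => //.
by move: ut; rewrite /= !in_itv/= => /andP[-> _].
Qed.

Lemma increment_path s t B : 0 <= s -> 0 <= t -> measurable B ->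
  sigma_of path ((W t \- W s) @^-1` B).
Proof.
move=> s0 t0 mB.
have mW u : 0 <= u -> measurable_fun setT (W u : g_sigma_algebraType
    (\bigcup_(Z in path) preimage_set_system setT Z measurable) -> R).
  move=> u0 _ C mC; rewrite setTI; apply: sigma_of_preimage => //.
  by exists u => //; rewrite /= in_itv/= u0.
have h : measurable_fun setT ((W t \- W s) : g_sigma_algebraType
    (\bigcup_(Z in path) preimage_set_system setT Z measurable) -> R).
  by apply: measurable_funB; exact: mW.
by have := h measurableT B mB; rewrite setTI.
Qed.

Lemma observableT t : observable t setT.
Proof.
by split => //; exists setT, setT; split => //; exact: sigma_ofT.
Qed.

Lemma observableI t : setI_closed (observable t).
Proof.
move=> D D' [mD [B [C [hB hC e]]]] [mD' [B' [C' [hB' hC' e']]]].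
split; first exact: measurableI.
exists (B `&` B'), (C `&` C'); split; [exact: sigma_ofI|exact: sigma_ofI|].
move=> w Nw; split.
  by move=> [/(e w Nw)[? ?] /(e' w Nw)[? ?]].
by move=> [[? ?] [? ?]]; split; [apply/(e w Nw)|apply/(e' w Nw)].
Qed.

Lemma increment_sureE s t w : 0 <= s -> 0 <= t -> ~ N w ->
  increment sure_path s t w = W t w - W s w.
Proof.
by move=> s0 t0 Nw; rewrite /increment /sure_path !patch_null_out// !max_l.
Qed.

Lemma measurable_increment_sure s t B : measurable B ->
  measurable (increment sure_path s t @^-1` B).
Proof.
move=> mB; have h : measurable_fun setT (increment sure_path s t).
  by apply: measurable_funB; exact: measurable_patch_null.
by have := h measurableT B mB; rewrite setTI.
Qed.

Lemma measurable_increment s t B : measurable B -> measurable ((W t \- W s) @^-1` B).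
Proof.
move=> mB; have h : measurable_fun setT (W t \- W s) by exact: measurable_funB.
by have := h measurableT B mB; rewrite setTI.
Qed.

Lemma increment_sure_eq s t B : 0 <= s -> 0 <= t -> measurable B ->
  P (increment sure_path s t @^-1` B) = P ((W t \- W s) @^-1` B).
Proof.
move=> s0 t0 mB; apply: (null_set_eq mN PN).
- exact: measurable_increment_sure.
- exact: measurable_increment.
by move=> w Nw; rewrite /= increment_sureE.
Qed.

(** On a generator, the data event splits off from past and increment together, which both belong to
    the path; past and increment are then separated by the independence of increments. *)
Lemma increment_sure_indep s t : 0 <= s < t -> forall A, <<s observable s >> A ->
  forall B, measurable B -> P (A `&` increment sure_path s t @^-1` B) =
    (P A * P (increment sure_path s t @^-1` B))%E.
Proof.
move=> /andP[s0 st] A HA B mB; have t0 : 0 <= t := le_trans s0 (ltW st).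
move: A HA; apply: independent_of_generated => //.
- exact: measurable_increment_sure.
- by move=> D [].
- exact: observableT.
- exact: observableI.
move=> D [mD [C1 [C2 [h1 h2 e]]]].
have m1 := data_measurable h1; have m2 := path_measurable (past_path h2).
have mE := measurable_increment s t mB.
have hE := increment_path s0 t0 mB.
rewrite (null_set_eq mN PN mD (measurableI _ _ m1 m2)); last by move=> w /e.
rewrite increment_sure_eq//.
rewrite (null_set_eq mN PN (B := C1 `&` (C2 `&` (W t \- W s) @^-1` B))); last 3 first.
- by apply: measurableI => //; exact: measurable_increment_sure.
- by apply: measurableI => //; exact: measurableI.
- move=> w Nw; rewrite /= increment_sureE//; split.
    by move=> [/(e w Nw)[? ?] ?].
  by move=> [? [? ?]]; split => //; apply/(e w Nw).
rewrite (hindep h1 (sigma_ofI (past_path h2) hE)) (hindep h1 (past_path h2)).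
have [_ _ _ Wi] := hW.
have s0t : 0 <= s < t by rewrite s0.
have hE' : sigma_of [set (W t \- W s : T -> R)] ((W t \- W s) @^-1` B).
  exact: sigma_of_preimage.
by rewrite [C2 `&` _]setIC (Wi s t s0t _ _ hE' h2) [in LHS](muleC (P ((W t \- W s) @^-1` B))) muleA.
Qed.

Lemma sure_X_in m t w : N w -> sure_X m t w = (m == 0%N)%:R.
Proof.
move=> Nw; rewrite /sure_X; case: leqP => mn; first by rewrite patch_null_in.
by rewrite gtn_eqF// (leq_trans _ mn).
Qed.

Lemma sure_X_out m t w : (m <= n)%N -> ~ N w -> sure_X m t w = X m (Num.max t 0) w.
Proof. by move=> mn Nw; rewrite /sure_X mn patch_null_out. Qed.

Lemma sure_path_out t w : ~ N w -> sure_path t w = W (Num.max t 0) w.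
Proof. by move=> Nw; rewrite /sure_path patch_null_out. Qed.

Lemma sure_X_continuous m w : continuous ((sure_X m)^~ w).
Proof.
have [Nw|Nw] := pselect (N w).
  have -> : (sure_X m)^~ w = fun=> (m == 0%N)%:R.
    by apply/funext => t; rewrite sure_X_in.
  by move=> t; exact: cvg_cst.
have [mn|mn] := leqP m n; last first.
  have -> : (sure_X m)^~ w = fun=> 0 by apply/funext => t; rewrite /sure_X leqNgt mn.
  by move=> t; exact: cvg_cst.
have -> : (sure_X m)^~ w = (fun t : R => X m (Num.max t 0) w).
  by apply/funext => t; rewrite sure_X_out.
have [_ _ _ /(_ m mn)[h _]] := good Nw.
exact: (@within_continuous_pos R (fun t => X m t w)).
Qed.

Lemma sure_path_continuous w : continuous (sure_path^~ w).
Proof.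
have [Nw|Nw] := pselect (N w).
  have -> : sure_path^~ w = fun=> 0.
    by apply/funext => t; rewrite /sure_path patch_null_in.
  by move=> t; exact: cvg_cst.
have -> : sure_path^~ w = (fun t : R => W (Num.max t 0) w).
  by apply/funext => t; rewrite sure_path_out.
have [_ h _ _] := good Nw.
exact: (@within_continuous_pos R (fun t => W t w)).
Qed.

Lemma sure_path0 w : sure_path 0 w = 0.
Proof.
have [Nw|Nw] := pselect (N w); first by rewrite /sure_path patch_null_in.
by rewrite sure_path_out// maxxx; have [] := good Nw.
Qed.

Lemma sure_X0 m w : (m <= n)%N -> sure_X m 0 w = sure_data m w.
Proof.
move=> mn; have [Nw|Nw] := pselect (N w).
  by rewrite sure_X_in// /sure_data patch_null_in.
rewrite sure_X_out// maxxx /sure_data patch_null_out//.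
have [h0 _ _ /(_ m mn)[_ /(_ 0 (lexx 0)) ->]] := good Nw.
rewrite set_itv1 Rintegral_set1 h0 addr0.
by case: eqP; rewrite ?mulr0 addr0.
Qed.

Lemma sure_X_is_derive m w : (m <= n)%N -> forall t : R, 0 < t ->
  is_derive t 1 (fun s => sure_X m s w - noise sure_path m s w)
    (expansion_drift m (fun k => sure_X k t w)).
Proof.
move=> mn t t0; have [Nw|Nw] := pselect (N w).
  have -> : (fun k => sure_X k t w) = fun k => (k == 0%N)%:R.
    by apply/funext => k; rewrite sure_X_in.
  rewrite expansion_drift_stationary.
  have -> : (fun s => sure_X m s w - noise sure_path m s w) = fun=> (m == 0%N)%:R.
    apply/funext => s; rewrite sure_X_in// /noise /sure_path patch_null_in//.
    by case: (m == 1%N); rewrite ?mulr0 subr0.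
  exact: is_derive_cst.
apply: (@is_derive_integral R (fun s => expansion_drift m (fun k => sure_X k s w)) (xi m w)) => //.
  by apply: continuous_expansion_drift => k; exact: sure_X_continuous.
move=> s s0; rewrite sure_X_out// max_l//.
have [_ _ _ /(_ m mn)[_ /(_ s s0) ->]] := good Nw.
rewrite /noise sure_path_out// max_l//.
rewrite addrK; congr (_ + _); apply: eq_Rintegral => u; rewrite inE/= in_itv/= => /andP[u0 _].
apply: eq_expansion_drift => k km.
by rewrite sure_X_out ?max_l// (leq_trans km).
Qed.

Lemma sure_data_moment m k : (m <= n)%N ->
  exists C, (\int[P]_w (sure_data m w ^+ (2 ^ k.+1))%:E <= C%:E)%E.
Proof.
move=> mn; have p1 : 1 <= (2 ^ k)%:R :> R by rewrite ler1n expn_gt0.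
have [fin _] := hA1 p1 mn.
have ms : measurable_fun setT (sure_data m) by exact: measurable_patch_null.
have e : (\int[P]_w (sure_data m w ^+ (2 ^ k.+1))%:E =
    \int[P]_w (`|xi m w| `^ (2 * (2 ^ k)%:R))%:E)%E.
  have E w : `|xi m w| `^ (2 * (2 ^ k)%:R) = xi m w ^+ (2 ^ k.+1).
    by rewrite -natrM -expnS powR_mulrn// normXp.
  apply: ge0_ae_eq_integral => //.
  - by apply/measurable_EFinP; apply: measurable_funX.
  - under eq_fun do rewrite E.
    by apply/measurable_EFinP; apply: measurable_funX.
  - by move=> w _; rewrite lee_fin exprp_ge0.
  exists N; split => // w /= h; apply: contrapT => Nw; apply: h => _.
  by rewrite E /sure_data patch_null_out.
exists (fine (\int[P]_w (`|xi m w| `^ (2 * (2 ^ k)%:R))%:E)); rewrite e fineK//.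
move: fin; rewrite unlock => fin.
by rewrite ge0_fin_numE//; apply: integral_ge0 => w _; rewrite lee_fin powR_ge0.
Qed.

(** The bounds on the squared datum are widened to include 1: the flow estimates need the
    equilibrium inside, and so does the value assigned on the null set. *)
Lemma sure_system : expansion_system P n sure_path sure_data sure_X observable
  (Num.min (rmin ^+ 2) 1) (Num.max (rmax ^+ 2) 1).
Proof.
split.
- by move=> t; exact: measurable_patch_null.
- by move=> m; exact: measurable_patch_null.
- move=> m t; rewrite /sure_X; case: ifP => _; last exact: measurable_cst.
  exact: measurable_patch_null.
- exact: sure_path_continuous.
- exact: sure_X_continuous.
- exact: sure_path0.
- by move=> m w; exact: sure_X0.
- exact: sure_X_is_derive.
- by rewrite lt_min ltr01 exprn_gt0//= ge_min lexx orbT.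
- by rewrite le_max lexx orbT.
- move=> w; have [Nw|Nw] := pselect (N w).
    by rewrite /sure_data patch_null_in// expr1n ge_min le_max lexx !orbT.
  rewrite /sure_data patch_null_out//; have [_ _ /andP[h1 h2] _] := good Nw.
  rewrite -[xi 0%N w ^+ 2]real_normK ?num_real// ge_min le_max.
  rewrite !lerXn2r ?nnegrE ?(ltW h1) ?(ltW h2) ?(ltW r0)//.
  exact: ltW (lt_trans r0 rr).
- exact: sure_data_moment.
- move=> s t s0t A mA; have /andP[s0 st] := s0t.
  rewrite increment_sure_eq//; last exact: le_trans s0 (ltW st).
  by have [_ _ Wn _] := hW; exact: Wn.
- by move=> t D [].
- move=> m t mn t0 _ B mB; rewrite setTI; apply: sub_gen_smallest; split.
    have h : measurable_fun setT (sure_data m) by exact: measurable_patch_null.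
    by have := h measurableT B mB; rewrite setTI.
  exists (xi m @^-1` B), setT; split; last 2 first.
  + exact: sigma_ofT.
  + by move=> w Nw; rewrite /= /sure_data patch_null_out//; split => [//|[]].
  by apply: sigma_of_preimage => //; right; exists m.
- move=> s t /andP[s0 st] _ B mB; rewrite setTI; apply: sub_gen_smallest; split.
    have h : measurable_fun setT (sure_path s) by exact: measurable_patch_null.
    by have := h measurableT B mB; rewrite setTI.
  exists setT, (W s @^-1` B); split; first exact: sigma_ofT.
    by apply: sigma_of_preimage => //; exists s => //; rewrite /= in_itv/= s0.
  by move=> w Nw; rewrite /= sure_path_out// max_l//; split => [//|[]].
- exact: increment_sure_indep.
Qed.

End surely.

(** * Identification of the two expansions *)

Section weak_coefficients_limit.
Context (R : realType) (d : measure_display) (T : measurableType d)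
  (P : probability T R) (n : nat) (F : R -> R) (CF : C_k n.+1 F).

Lemma weak_coefE (X : nat -> R -> {RV P >-> R}) m t : (m <= n)%N ->
  weak_coef X F m t = (\int[P]_w (weak_integrand n F (X 0%N t w)
    (fluctuation n (fun k s => X k s : T -> R) t w) m)%:E)%E.
Proof.
move=> mn; pose Y := fluctuation n (fun k s => X k s : T -> R) t.
have -> : weak_coef X F m t = (\int[P]_w (if m == 0%N then F (X 0%N t w) else
    \sum_(1 <= i < m.+1) (i`!%:R)^-1 *
         \sum_(j in compositions i m) F^`(i)%classic (X 0%N t w) * \prod_k X (j k) t w)%:E)%E.
  by rewrite /weak_coef; case: eqP => _; rewrite unlock.
apply: eq_integral => w _; congr (_%:E); rewrite /weak_integrand -/(Y w).
rewrite -(big_mkord xpredT (fun i => i`!%:R^-1 * (F^`(i)%classic (X 0%N t w) * (Y w ^+ i)`_m))).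
rewrite [RHS](big_cat_nat (n := m.+1))//= [X in _ = _ + X]big_nat_cond [X in _ = _ + X]big1 ?addr0.
- rewrite [RHS]big_ltn//= expr0 coef1 fact0 invr1 mul1r.
  case: eqP => [->|m0]; first by rewrite big_geq// mulr1 addr0.
  rewrite mulr0 add0r; apply: eq_big_nat => i /andP[i0 im].
  by rewrite /Y coef_fluctuation_exp// -big_distrr.
- move=> i /andP[/andP[mi _] _].
  by rewrite /Y coef_fluctuation_gt// !mulr0.
Qed.

Lemma measurable_weak_integrand (X : nat -> R -> T -> R) m t : (m <= n)%N ->
  (forall k, measurable_fun setT (X k t)) ->
  measurable_fun setT (fun w => weak_integrand n F (X 0%N t w) (fluctuation n X t w) m).
Proof.
move=> mn mX; apply: measurable_sum => i; apply: measurable_funM => //.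
apply: measurable_funM.
  apply: (@measurableT_comp _ _ _ _ _ _ F^`(i)%classic) => //.
  by apply: continuous_measurable_fun; exact: (C_k_derive_continuous CF (leq_ord i)).
apply: measurable_coefX => j _; under eq_fun do rewrite coef_poly.
case: ltnP => _; last exact: measurable_cst.
by case: eqP => _; [exact: measurable_cst|exact: mX].
Qed.

End weak_coefficients_limit.

Theorem theorem1p5 (R : realType) (d : measure_display) (T : measurableType d)
    (P : probability T R) (n : nat)
    (W : R -> {RV P >-> R})
    (xieps : R -> {RV P >-> R}) (xi : nat -> {RV P >-> R})
    (X : nat -> R -> {RV P >-> R})
    (hW : brownian_motion W)
    (hindep : data_independent n W xieps xi)
    (hA1 : assumption_A1 n xieps xi)
    (hA2 : assumption_A2 (xi 0%N))
    (hX : expansion_solution n W xi X)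
    (F : R -> R) (hF : C_k n.+1 F) (hFgrowth : poly_growth n.+1 F) :
  exists (e0 : R) (B : nat -> R),
    [/\ 0 < e0 <= 1,
        exists2 C : R, 0 < C & forall e : R, 0 < e < e0 ->
          exists r : R,
            (\int[gibbs e]_x (F x)%:E =
              (\sum_(m < n.+1) e `^ (m%:R / 2) * B m + r)%:E)%E /\
            `|r| <= C * e `^ (n.+1%:R / 2) &
        P [set w | 0 < xi 0%N w] = (2^-1)%:E ->
        P [set w | xi 0%N w < 0] = (2^-1)%:E ->
        forall m : nat, (m <= n)%N ->
          weak_coef X F m t @[t --> +oo] --> (B m)%:E].
Proof.
(* The threshold 1 suffices: with r = sqrt(e), all the estimates on the wells hold for 0 < r <=
   1. *)
exists 1, (gibbs_coef n F); split; first by rewrite ltr01 lexx.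
  exact: gibbs_expansion.
move=> pos neg m mn.
have [N [rmin [rmax [mN PN r0 rr good]]]] := surely hW hA2 hX.
have sys := sure_system hW hindep hA1 mN PN r0 rr good.
set X' := sure_X n X N in sys; set xi' := sure_data xi N in sys.
have half sg : measurable [set w | 0 < sg * xi 0%N w] ->
    P [set w | 0 < sg * xi' 0%N w] = P [set w | 0 < sg * xi 0%N w].
  move=> ms; apply: (null_set_eq mN PN) => //; first exact: (measurable_sided sys).
  by move=> w Nw; rewrite /= /xi' /sure_data patch_null_out.
have mxi (A : set R) : measurable A -> measurable (xi 0%N @^-1` A).
  by move=> mA; rewrite -[X in measurable X]setTI; exact: measurable_funPT.
have pos' : P [set w | 0 < 1 * xi' 0%N w] = (2^-1)%:E.
  have e : [set w | 0 < 1 * xi 0%N w] = [set w | 0 < xi 0%N w].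
    by apply/seteqP; split => w /=; rewrite mul1r.
  rewrite half e//; rewrite (_ : [set w | _] = xi 0%N @^-1` `]0, +oo[%classic); first exact: mxi.
  by apply/seteqP; split => w /=; rewrite in_itv/= andbT.
have neg' : P [set w | 0 < -1 * xi' 0%N w] = (2^-1)%:E.
  have e : [set w | 0 < -1 * xi 0%N w] = [set w | xi 0%N w < 0].
    by apply/seteqP; split => w /=; rewrite mulN1r oppr_gt0.
  rewrite half e//; rewrite (_ : [set w | _] = xi 0%N @^-1` `]-oo, 0[%classic); first exact: mxi.
  by apply/seteqP; split => w /=; rewrite in_itv/=.
have lim := sys_weak_limit sys hF hFgrowth mn.
(* Restricted to t >= 0, since the patched processes are frozen at negative times; this determines
   the limit at +oo. *)
have eq t : 0 <= t -> weak_coef X F m t =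
    (\int[P]_w weak_integrand n F (X' 0%N t w) (fluctuation n X' t w) m)%:E.
  move=> t0; have i1 := weak_integrand_integrable sys hF hFgrowth mn t0.
  rewrite /Rintegral fineK; last exact: integrable_fin_num.
  rewrite (weak_coefE F X t mn); apply: ae_eq_integral => //.
  - apply/measurable_EFinP.
    exact: (measurable_weak_integrand hF (X := fun k s => X k s : T -> R)).
  - by apply/measurable_EFinP; apply: measurable_weak_integrand => // k; exact: (sys_mX sys).
  exists N; split => // w /= h; apply: contrapT => Nw; apply: h => _; congr (_%:E).
  rewrite /X' sure_X_out// max_l//; congr weak_integrand.
  apply/polyP => j; rewrite !coef_poly; case: ltnP => // jn; case: eqP => // _.
  by rewrite sure_X_out// max_l.
apply/fine_cvgP; split.
  by near=> t; rewrite eq//; near: t; exact: nbhs_pinfty_ge.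
(* Equal probabilities 1/2 turn the weighted combination of the two wells into the symmetric one
   selected by the Gibbs measure. *)
have -> : gibbs_coef n F m = \sum_(i < n.+1) (F^`(i)%classic 1 *
    fine (P [set w | 0 < 1 * xi' 0%N w]) + (-1) ^+ i * F^`(i)%classic (-1) *
    fine (P [set w | 0 < -1 * xi' 0%N w])) / i`!%:R * limit_coef R m i.
  by apply: eq_bigr => i _; rewrite pos' neg' /=; ring.
move: lim; apply: cvg_trans; apply: near_eq_cvg; near=> t.
by rewrite /= eq//; near: t; exact: nbhs_pinfty_ge.
Unshelve. all: by end_near. Qed.
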